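(* Let $d\in \mathbb{N}$ and $\mathbf{s}=(s_1,\dots,s_d)\in\mathbb{N}^d$ with $s_1\ge 2$, and $|\mathbf{s}|=s_1+\cdots+s_d$. For each $j$ let $l_j$ be one of the functions $m\mapsto 2m$, $m\mapsto 2m+1$, $m\mapsto 2m-1$; put $\delta(l)=0$ if $l(m)=2m$ and $\delta(l)=1$ if $l(m)=2m\pm1$; put $\nu(l)=1$ if $l(m)=2m-1$ and $\nu(l)=0$ otherwise. Let $\succ_j$ be ''$\ge$'' if $l_j(m)=2m+1$ and ''$>$'' otherwise, and set \[ S=\sum_{n_1 \succ_1 n_2\succ_2 \cdots\succ_{d-1} n_d\succ_d 0}\frac{b_{n_1}}{l_1(n_1)^{s_1}\cdots l_d(n_d)^{s_d}}. \] (a) If every $l_j(m)\in\{2m,2m+1\}$, then $S\in i^{\delta(l_1)}\,\mathsf{CMZV}^4_{|\mathbf{s}|}$. (b) If every $l_j(m)\in\{2m,2m\pm1\}$ and for every $j\ge2$ with $l_j(m)=2m-1$ we have $l_{j-1}(m)\ne 2m$, then $S\in i^{\delta(l_1)}\big(\mathsf{CMZV}^4_{|\mathbf{s}|}+\nu(l_1)\,\mathsf{CMZV}^4_{|\mathbf{s}|+1}\big)$. In particular this holds if $l_j(m)\neq 2m$ for all $j$. (c) In general (all $l_j(m)\in\{2m,2m\pm1\}$), $S\in \mathsf{CMZV}^4_{\le |\mathbf{s}|+\nu(l_1)}\otimes\mathbb{Q}[i]$. (d) The conclusion of (c) still holds if any of the relations between consecutive indices $n_j,n_{j+1}$ ($1\le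 j\le d$, with $n_{d+1}=0$) is changed from ''$>$'' to ''$\ge$'' or vice versa, provided the resulting series is defined; i.e. for arbitrary choices of each ''$\succ$'' among ''$\ge$'', ''$>$'', \[ \sum_{n_1 \succ n_2 \succ\cdots \succ n_d\succ 0 }\frac{b_{n_1}}{l_1(n_1)^{s_1}\cdots l_d(n_d)^{s_d}} \in \mathsf{CMZV}^4_{\le |\mathbf{s}|+\nu(l_1)}\otimes\mathbb{Q}[i]. \]
   Context: $b_n=4^n\binom{2n}{n}^{-1}$ for $n\in\mathbb{N}_0$. Colored multiple zeta values of level 4: for $\mathbf{k}=(k_1,\dots,k_r)\in\mathbb{N}^r$ and $z_1,\dots,z_r$ fourth roots of unity with $(k_1,z_1)\ne(1,1)$, $\operatorname{Li}_{\mathbf{k}}(\mathbf{z})=\sum_{m_1>\cdots>m_r>0} \frac{z_1^{m_1}\cdots z_r^{m_r}}{m_1^{k_1}\cdots m_r^{k_r}}$, of weight $k_1+\cdots+k_r$. $\mathsf{CMZV}^4_w$ denotes the $\mathbb{Q}$-vector space spanned by all such values of weight $w$ (with $\mathsf{CMZV}^4_0=\mathbb{Q}$); $\mathsf{CMZV}^4_{\le w}=\sum_{k\le w}\mathsf{CMZV}^4_k$; $V\otimes\mathbb{Q}[i]$ denotes the $\mathbb{Q}[i]$-span of $V$; $i^{\delta}V=\{i^{\delta}v: v\in V\}$; and $0\cdot V=\{0\}$. *)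

(* Defs.v *)
From HB Require Import structures.
From mathcomp Require Import all_boot all_order all_algebra.
From mathcomp Require Import all_classical all_reals all_analysis.
From mathcomp Require Import complex.
Set Implicit Arguments.
Unset Strict Implicit.
Unset Printing Implicit Defensive.
Import Order.TTheory GRing.Theory Num.Theory.
Import numFieldNormedType.Exports.
Local Open Scope classical_set_scope.
Local Open Scope ring_scope.

(* Complex numbers are R[i] for R : realType. Convergence is taken in R[i]^o,
   the same type equipped with the topology of the complex modulus. *)

Section IndexChains.
Variable d : nat.
Implicit Types (w : 'I_d -> bool) (n : 'I_d -> nat).

(* Indices are 0-based: the j-th entry for j : 'I_d stands for n_{j+1},
   and the entry following the last one is 0. *)
Definition next_index n (j : 'I_d) : nat :=
  if insub j.+1 is Some k then n k else 0%N.

(* n_1 >_1 n_2 >_2 ... >_{d-1} n_d >_d 0, where the j-th relation is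
   weak (>=) if w j holds, and strict (>) otherwise. *)
Definition chain w n : bool :=
  [forall j : 'I_d,
    if w j then (next_index n j <= n j)%N else (next_index n j < n j)%N].

End IndexChains.

Section Spans.
Variable R : realType.
Implicit Types (K V W : set R[i]) (c : R[i]).

Definition span_over K V : set R[i] :=
  [set x | exists2 t : seq (R[i] * R[i]),
      (forall p, p \in t -> K p.1 /\ V p.2) &
      x = \sum_(p <- t) p.1 * p.2].

Definition scale_set c V : set R[i] := [set c * v | v in V].

Definition add_set V W : set R[i] := [set v + w | v in V & w in W].

Definition Qset : set R[i] := range (@ratr R[i]).

Definition Qi : set R[i] := [set ratr a + 'i%C * ratr b | a in setT & b in setT].

End Spans.

Arguments Qset : clear implicits.
Arguments Qi : clear implicits.

Section ColoredMZV.
Variable R : realType.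

Definition Li_partial (r : nat) (k : 'I_r -> nat) (z : 'I_r -> R[i]) (N : nat)
    : R[i]^o :=
  \sum_(m : {ffun 'I_r -> 'I_N} | chain (fun=> false) (fun j => m j : nat))
    \prod_(j < r) (z j ^+ m j / (m j)%:R ^+ k j).

(* x = Li_k(z) for some admissible (k, z) of level 4 and weight w. The series
   may converge only conditionally; as is usual, it is summed by increasing
   largest index m_1. *)
Definition is_CMZV4_value (w : nat) (x : R[i]) : Prop :=
  exists (r : nat) (r_gt0 : (0 < r)%N) (k : 'I_r -> nat) (z : 'I_r -> R[i]),
    [/\ forall j, (0 < k j)%N,
        forall j, z j ^+ 4 = 1,
        (k (Ordinal r_gt0), z (Ordinal r_gt0)) <> (1%N, 1),
        (\sum_(j < r) k j)%N = w &
        Li_partial k z @ \oo --> (x : R[i]^o)].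

Definition CMZV4 (w : nat) : set R[i] :=
  if w is 0 then Qset R else span_over (Qset R) (is_CMZV4_value w).

Definition CMZV4_le (w : nat) : set R[i] :=
  [set x | exists2 v : nat -> R[i],
      (forall k, (k <= w)%N -> CMZV4 k (v k)) &
      x = \sum_(k < w.+1) v k].

End ColoredMZV.

Arguments CMZV4 : clear implicits.
Arguments CMZV4_le : clear implicits.

(* The functions m |-> 2m, m |-> 2m+1 and m |-> 2m-1. *)
Inductive linform := Even | OddSucc | OddPred.

(* Integer-valued, as 2m-1 is -1 at m = 0. *)
Definition lval (l : linform) (m : nat) : int :=
  match l with
  | Even => 2 * m%:Z
  | OddSucc => 2 * m%:Z + 1
  | OddPred => 2 * m%:Z - 1
  end.

Definition delta (l : linform) : nat := if l is Even then 0 else 1.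

Definition nu (l : linform) : nat := if l is OddPred then 1 else 0.

Section AperyTypeSeries.
Variables (R : realType) (d : nat).

Definition b_coef (n : nat) : R[i] := 4 ^+ n / 'C(2 * n, n)%:R.

Definition std_weak (l : 'I_d -> linform) (j : 'I_d) : bool :=
  if l j is OddSucc then true else false.

Definition apery_partial (d_gt0 : (0 < d)%N) (s : 'I_d -> nat)
    (l : 'I_d -> linform) (w : 'I_d -> bool) (N : nat) : R[i]^o :=
  \sum_(n : {ffun 'I_d -> 'I_N} | chain w (fun j => n j : nat))
    b_coef (n (Ordinal d_gt0)) / \prod_(j < d) (lval (l j) (n j))%:~R ^+ s j.

(* The series converges and its sum belongs to V. *)
Definition apery_sum_in (d_gt0 : (0 < d)%N) (s : 'I_d -> nat)
    (l : 'I_d -> linform) (w : 'I_d -> bool) (V : set R[i]) : Prop :=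
  exists2 S : R[i], apery_partial d_gt0 s l w @ \oo --> (S : R[i]^o) & V S.

(* No summand has a vanishing denominator. *)
Definition apery_defined (l : 'I_d -> linform) (w : 'I_d -> bool) : Prop :=
  forall n : 'I_d -> nat, chain w n -> forall j, lval (l j) (n j) <> 0.

End AperyTypeSeries.

(* Main.v *)
(* With x = sin t, b_n/(2n) and b_n/(2n+1) are the integrals of x^(2n-1) dt and
   x^(2n+1) dt over [0, pi/2], and the nested sum over n_2, ..., n_d is an
   iterated integral of dx/x, x dx/(1-x^2) and dx/(1-x^2).  The substitution
   x = 2u/(1+u^2) turns these forms into rational combinations of du/u and
   du/(eta - u) with eta^4 = 1, and the outermost form into du/u or
   2 du/(1+u^2); the latter accounts for the factor i.  Expanding in powers of
   u and letting u tend to 1 (Abel) gives colored multiple zeta values.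
   The equality of the two iterated integrals is checked by differentiation.
   The form 2m-1 is reduced to 2m+1 by shifting the index; for the other
   relations, equal consecutive indices are removed by partial fractions, and
   the divergent pieces this creates at the outermost index are handled by
   summation by parts. *)

(* The obstacle to passing from the series to the integrals is the endpoint u = 1: the limit in the
   number of terms and the limit u -> 1 have to be exchanged without absolute convergence in u. The
   x-expansions have nonnegative coefficients, so monotonicity gives two one-sided estimates instead
   of a dominated exchange. In (c) and (d), a sum with 2m directly over 2m-1 is not a word in the
   three forms. Splitting denominators repairs this but can leave one denominator under b_n, and b_n
   grows like sqrt(pi n). So the partial-fraction induction is proved for an abstract weight-indexed
   family [G] with a threshold [t] on the number of denominators. It runs once with t = 1, to
   rewrite sequences as words and shifted words, and once with t = 2, to sum them; the second run
   relies on the first. The extra weight nu(l_1) is the term 1/(2n+1) in b_(n+1) = b_n (1 +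
   1/(2n+1)). It appears only when the outermost index is shifted, since b depends on no other
   index. *)
From HB Require Import structures.
Require Import Defs.
From mathcomp Require Import all_boot all_order all_algebra.
From mathcomp Require Import all_classical all_reals all_analysis.
From mathcomp Require Import complex ring lra zify.
Set Implicit Arguments.
Unset Strict Implicit.
Unset Printing Implicit Defensive.
Import Order.TTheory GRing.Theory Num.Theory.
Import numFieldNormedType.Exports.
Local Open Scope classical_set_scope.
Local Open Scope ring_scope.

(** * Integration of power series against a form *)

Section Sequences.
Variable K : numFieldType.
Implicit Types (e f g : nat -> K).

Definition conv e f N : K := \sum_(k < N.+1) e (N - k)%N * f k.

(* Coefficients of the primitive of [(\sum_k e k x^k) (\sum_k f k x^k) dx/x];
   the constant term is [0] because [0^-1 = 0]. *)
Definition iform e f N : K := N%:R^-1 * conv e f N.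

Definition delta0 N : K := (N == 0%N)%:R.

Definition shiftS f N : K := if N is n.+1 then f n else 0.

Lemma conv_delta0 f N : conv delta0 f N = f N.
Proof.
rewrite /conv big_ord_recr /= subnn /delta0 eqxx mul1r big1 ?add0r// => i _.
by rewrite subn_eq0 leqNgt ltn_ord mul0r.
Qed.

Lemma conv_shiftS e f N : conv (shiftS e) f N = shiftS (conv e f) N.
Proof.
case: N => [|N]; rewrite /conv /=.
  by rewrite big_ord_recr big_ord0 /= mul0r addr0.
rewrite big_ord_recr /= subnn /= mul0r addr0; apply: eq_bigr => i _.
by rewrite subSn // -ltnS.
Qed.

Lemma eq_conv e1 e2 f1 f2 N :
  (forall n, e1 n = e2 n) -> (forall n, f1 n = f2 n) ->
  conv e1 f1 N = conv e2 f2 N.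
Proof. by move=> he hf; apply: eq_bigr => i _; rewrite he hf. Qed.

Lemma conv_linl a e1 e2 f N :
  conv (fun n => a * e1 n + e2 n) f N = a * conv e1 f N + conv e2 f N.
Proof.
rewrite /conv mulr_sumr -big_split /=; apply: eq_bigr => i _.
by rewrite mulrDl mulrA.
Qed.

Lemma conv_linr a e f1 f2 N :
  conv e (fun n => a * f1 n + f2 n) N = a * conv e f1 N + conv e f2 N.
Proof.
rewrite /conv mulr_sumr -big_split /=; apply: eq_bigr => i _.
by rewrite mulrDr mulrCA.
Qed.

Lemma iform0 e f : iform e f 0 = 0.
Proof. by rewrite /iform invr0 mul0r. Qed.

Lemma eq_iform e1 e2 f1 f2 N :
  (forall n, e1 n = e2 n) -> (forall n, f1 n = f2 n) ->
  iform e1 f1 N = iform e2 f2 N.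
Proof. by move=> he hf; rewrite /iform (eq_conv _ he hf). Qed.

Lemma iform_linl a e1 e2 f N :
  iform (fun n => a * e1 n + e2 n) f N = a * iform e1 f N + iform e2 f N.
Proof. by rewrite /iform conv_linl mulrDr mulrCA. Qed.

Lemma iform_linr a e f1 f2 N :
  iform e (fun n => a * f1 n + f2 n) N = a * iform e f1 N + iform e f2 N.
Proof. by rewrite /iform conv_linr mulrDr mulrCA. Qed.

(** The Cauchy product has N+1 <= 2N terms and the factor 1/N absorbs them. Boundedness of
    coefficients thus passes along words, which makes every series below converge for |x| < 1. *)
Lemma iform_bounded e f (E F : K) : (forall n, `|e n| <= E) ->
  (forall n, `|f n| <= F) -> forall n, `|iform e f n| <= 2 * (E * F).
Proof.
move=> he hf [|n].
  rewrite iform0 normr0 mulr_ge0 ?mulr_ge0 ?ler0n//.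
    exact: le_trans (he 0%N).
  exact: le_trans (hf 0%N).
rewrite /iform normrM normfV normr_nat ler_pdivrMl ?ltr0n//.
apply: (le_trans (ler_norm_sum _ _ _)).
apply: (@le_trans _ _ (\sum_(k < n.+2) E * F)).
  by apply: ler_sum => i _; rewrite normrM ler_pM.
rewrite sumr_const card_ord -[_ *+ _]mulr_natl [leRHS]mulrA.
rewrite ler_wpM2r ?mulr_ge0//; first exact: le_trans (he 0%N).
  exact: le_trans (hf 0%N).
by rewrite -natrM ler_nat muln2 -addnn addSn addnS !ltnS leq_addr.
Qed.

End Sequences.
Arguments delta0 {K}.

(** * Power series on the open unit interval and their derivatives *)

Section PowerSeries.
Variable R : realType.
Implicit Types (f g e : nat -> R) (x : R).

Definition unit_cvg f := forall x, `|x| < 1 -> cvgn (pseries f x).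

Definition psum f x : R := limn (pseries f x).

Lemma unit_cvg_le f g : (forall n, `|f n| <= g n) -> unit_cvg g -> unit_cvg f.
Proof.
move=> fg cg x x1; apply: normed_cvg.
apply: (@series_le_cvg _ _ (fun n => g n * `|x| ^+ n)) => //= [n|n|].
- by rewrite mulr_ge0 ?exprn_ge0// (le_trans _ (fg n)).
- by rewrite normrM normrX ler_wpM2r ?exprn_ge0.
- by apply: cg; rewrite normr_id.
Qed.

Lemma unit_cvg_cst (C : R) : unit_cvg (fun=> C).
Proof. by move=> x x1; exact: is_cvg_geometric_series. Qed.

Lemma unit_cvg_bounded f (C : R) : (forall n, `|f n| <= C) -> unit_cvg f.
Proof. by move=> fC; apply: (unit_cvg_le fC); exact: unit_cvg_cst. Qed.

(** Write 1/q = 1 + h. Bernoulli's inequality bounds q^(-n) below by 1 + nh, and (1 + 1/h)(1 + nh)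
    already exceeds n + 1. *)
Lemma bernoulli_bound (q : R) : 0 <= q < 1 ->
  exists C, forall n, n.+1%:R * q ^+ n <= C.
Proof.
move=> /andP[q0 q1].
have [->|qn0] := eqVneq q 0.
  by exists 1 => -[|n]; rewrite ?expr0 ?mulr1// expr0n mulr0.
have {}q0 : 0 < q by rewrite lt_neqAle eq_sym qn0.
pose h := q^-1 - 1.
have h0 : 0 < h by rewrite subr_gt0 invf_gt1.
have B n : 1 + n%:R * h <= (1 + h) ^+ n.
  elim: n => [|n IH]; first by rewrite mul0r addr0 expr0.
  rewrite exprS -natr1; apply: (@le_trans _ _ ((1 + h) * (1 + n%:R * h))).
    have : 0 <= n%:R * h * h by rewrite !mulr_ge0// ltW.
    by move: (n%:R : R) => m; nra.
  by rewrite ler_wpM2l// ltW// addr_gt0.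
exists (1 + h^-1) => n.
have -> : q = (1 + h)^-1 by rewrite /h addrC subrK invrK.
have h1 : 0 < 1 + h by rewrite addr_gt0.
rewrite exprVn ler_pdivrMr ?exprn_gt0//.
apply: (@le_trans _ _ ((1 + h^-1) * (1 + n%:R * h))); last first.
  by rewrite ler_wpM2l// addr_ge0// invr_ge0; exact: ltW.
rewrite -natr1.
have -> : (1 + h^-1) * (1 + n%:R * h) = n%:R + 1 + (n%:R * h + h^-1).
  by field; rewrite gt_eqF.
by rewrite lerDl addr_ge0 ?invr_ge0 ?mulr_ge0//; exact: ltW.
Qed.

(** Between |x| and 1 there is a radius y at which the series converges absolutely; the factor n+1
    is absorbed by (|x|/y)^n. *)
Lemma unit_cvg_diffs f : unit_cvg f -> unit_cvg (pseries_diffs f).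
Proof.
move=> cf x x1.
pose y := (1 + `|x|) / 2.
have y1 : y < 1 by rewrite /y; lra.
have xy : `|x| < y by rewrite /y; lra.
have y0 : 0 < y by rewrite (le_lt_trans _ xy).
pose q := `|x| / y.
have q01 : 0 <= q < 1.
  by rewrite divr_ge0//= ?ltr_pdivrMr ?mul1r// ltW.
have [C HC] := bernoulli_bound q01.
have z1 : `|(1 + y) / 2| < 1.
  by rewrite ger0_norm; lra.
have yz : `|y| < `|(1 + y) / 2|.
  by rewrite !ger0_norm; lra.
have cy := is_cvg_pseries_inside_norm (cf _ z1) yz.
apply: normed_cvg.
apply: (@series_le_cvg _ _ (fun n => (C / y) * (`|f n.+1| * y ^+ n.+1))) => [n|n|n|].
- exact: normr_ge0.
- rewrite !mulr_ge0 ?exprn_ge0 ?invr_ge0//; try exact: ltW.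
  by apply: le_trans (HC 0%N); rewrite mulr1.
- rewrite /= /pseries_diffs normrM normrM normrX normr_nat.
  have -> : `|x| = q * y by rewrite /q divfK// gt_eqF.
  have -> : C / y * (`|f n.+1| * y ^+ n.+1) = C * (`|f n.+1| * y ^+ n).
    by rewrite exprS; field; rewrite gt_eqF.
  rewrite exprMn.
  have -> : n.+1%:R * `|f n.+1| * (q ^+ n * y ^+ n) =
            n.+1%:R * q ^+ n * (`|f n.+1| * y ^+ n) by ring.
  by rewrite ler_wpM2r ?mulr_ge0 ?exprn_ge0//; exact: ltW.
- apply: is_cvg_seriesZ.
  have /cvg_ex[l hl] := cy.
  apply/cvg_ex; exists (l - `|f 0%N|).
  have -> : series (fun n => `|f n.+1| * y ^+ n.+1) =
      fun n => pseries (fun i => `|f i|) y n.+1 - `|f 0%N|.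
    apply/funext => n; rewrite /pseries /series /= [X in _ = X - _]big_nat_recl//=.
    by rewrite expr0 mulr1 addrAC subrr add0r.
  by apply: cvgB; [rewrite cvg_shiftS | exact: cvg_cst].
Qed.

Lemma unit_cvg_lin (a : R) f g : unit_cvg f -> unit_cvg g -> unit_cvg (fun n => a * f n + g n).
Proof.
move=> cf cg x x1; have -> : pseries (fun n => a * f n + g n) x =
    (fun n => a * pseries f x n + pseries g x n).
  apply/funext => n; rewrite /pseries /series /= mulr_sumr -big_split /=.
  by apply: eq_bigr => i _; rewrite mulrDl mulrA.
by apply: is_cvgD; [apply: is_cvgM; [exact: is_cvg_cst|exact: cf] | exact: cg].
Qed.

Lemma psum_lin (a : R) f g x : unit_cvg f -> unit_cvg g -> `|x| < 1 ->
  psum (fun n => a * f n + g n) x = a * psum f x + psum g x.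
Proof.
move=> cf cg x1; apply: cvg_lim => //.
have -> : pseries (fun n => a * f n + g n) x =
    (fun n => a * pseries f x n + pseries g x n).
  apply/funext => n; rewrite /pseries /series /= mulr_sumr -big_split /=.
  by apply: eq_bigr => i _; rewrite mulrDl mulrA.
by apply: cvgD; [apply: cvgMr; exact: cf | exact: cg].
Qed.

Lemma psum_shift_cvg f x : `|x| < 1 -> unit_cvg f ->
  pseries (shiftS f) x @ \oo --> x * psum f x.
Proof.
move=> x1 cf; rewrite -cvg_shiftS.
have -> : [sequence pseries (shiftS f) x n.+1]_n = (fun n => x * pseries f x n).
  apply/funext => n; rewrite /pseries /series /= big_nat_recl//= mul0r add0r.
  by rewrite mulr_sumr; apply: eq_bigr => i _; rewrite exprS mulrCA.
by apply: cvgMr; exact: cf.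
Qed.

Lemma unit_cvg_shift f : unit_cvg f -> unit_cvg (shiftS f).
Proof. by move=> cf x x1; apply/cvg_ex; eexists; exact: psum_shift_cvg. Qed.

Lemma psum_shift f x : `|x| < 1 -> unit_cvg f -> psum (shiftS f) x = x * psum f x.
Proof. by move=> x1 cf; apply: cvg_lim => //; exact: psum_shift_cvg. Qed.

Lemma eq_psum f g x : (forall n, f n = g n) -> psum f x = psum g x.
Proof. by move=> fg; congr psum; apply/funext. Qed.

Lemma eq_unit_cvg f g : (forall n, f n = g n) -> unit_cvg f -> unit_cvg g.
Proof. by move=> fg; have -> : f = g by apply/funext. Qed.

Lemma psum_at0 f : psum f 0 = f 0%N.
Proof.
apply: cvg_lim => //; rewrite -cvg_shiftS.
rewrite [X in X @ _](_ : _ = fun=> f 0%N); first exact: cvg_cst.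
apply/funext => n; rewrite /pseries /series /= big_nat_recl//= expr0 mulr1.
by rewrite big1 ?addr0// => i _; rewrite exprS mul0r mulr0.
Qed.

Lemma is_derive_psum f x : unit_cvg f -> `|x| < 1 ->
  is_derive x (1 : R) (psum f) (psum (pseries_diffs f) x).
Proof.
move=> cf x1; pose K := (1 + `|x|) / 2.
have x0 := normr_ge0 x.
have K0 : `|K| = K by rewrite ger0_norm// /K; lra.
have K1 : `|K| < 1 by rewrite K0 /K; lra.
have xK : `|x| < `|K| by rewrite K0 /K; lra.
have c1 := unit_cvg_diffs cf; have c2 := unit_cvg_diffs c1.
exact: pseries_snd_diffs (cf _ K1) (c1 _ K1) (c2 _ K1) xK.
Qed.

(** The coefficients grow at most like (n+1) E F, which are those of the derivative of a geometric
    series. *)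
Lemma unit_cvg_conv e f (E F : R) : (forall n, `|e n| <= E) -> (forall n, `|f n| <= F) ->
  unit_cvg (conv e f).
Proof.
move=> he hf; apply: (@unit_cvg_le _ (pseries_diffs (fun=> E * F))); last first.
  exact/unit_cvg_diffs/unit_cvg_cst.
move=> n; rewrite /pseries_diffs; apply: (le_trans (ler_norm_sum _ _ _)).
apply: (@le_trans _ _ (\sum_(k < n.+1) E * F)).
  by apply: ler_sum => i _; rewrite normrM ler_pM.
by rewrite sumr_const card_ord -[_ *+ _]mulr_natl.
Qed.

(* [Ex] is the value at [x] of the generating function of [e], expressed through
   Cauchy products so that no product theorem for series is needed. *)
Definition genfun_at e x (Ex : R) := forall f, (exists F : R, forall n, `|f n| <= F) ->
  psum (conv e f) x = Ex * psum f x.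

(** Applying x d/dx undoes the factor 1/N and returns the Cauchy product, except for its constant
    term, which [iform] has lost; hence the condition that this term be 0. *)
Lemma is_derive_psum_iform e f (E F : R) x Ex :
  (forall n, `|e n| <= E) -> (forall n, `|f n| <= F) -> e 0%N * f 0%N = 0 ->
  `|x| < 1 -> x != 0 -> genfun_at e x Ex ->
  is_derive x (1 : R) (psum (iform e f)) (Ex * psum f x / x).
Proof.
move=> he hf ef0 x1 x0 gE.
have cT : unit_cvg (iform e f) := unit_cvg_bounded (iform_bounded he hf).
have -> : Ex * psum f x / x = psum (pseries_diffs (iform e f)) x.
  rewrite -gE; last by exists F.
  rewrite (@eq_psum _ (shiftS (pseries_diffs (iform e f)))).
    by rewrite psum_shift//; [rewrite mulrC mulKf | exact: unit_cvg_diffs].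
  case=> [|n] /=; first by rewrite /conv big_ord_recl big_ord0 addr0.
  by rewrite /pseries_diffs /iform mulVKf// pnatr_eq0.
exact: is_derive_psum.
Qed.

Lemma cvgn_le (u : nat -> R) l c : u @ \oo --> l -> (forall n, u n <= c) -> l <= c.
Proof. by move=> ul uc; apply: (cvgr_to_le ul); apply: nearW. Qed.

Lemma psum_sub_partial f (C : R) x M : 0 <= x < 1 -> (forall n, `|f n| <= C) ->
  `|psum f x - \sum_(0 <= k < M) f k * x ^+ k| <= C * x ^+ M / (1 - x).
Proof.
move=> /andP[x0 x1] fC.
have ax : `|x| < 1 by rewrite ger0_norm.
have cf : unit_cvg f := unit_cvg_bounded fC.
have C0 : 0 <= C by rewrite (le_trans _ (fC 0%N)).
pose u n := `|pseries f x (n + M)%N - \sum_(0 <= k < M) f k * x ^+ k|.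
apply: (@cvgn_le u).
  apply: cvg_norm; apply: cvgB; last exact: cvg_cst.
  by rewrite (cvg_shiftn M); exact: cf.
move=> n; rewrite /u /pseries /series /= addnC.
rewrite (big_cat_nat (n := M))//= ?leq_addr// addrAC subrr add0r.
apply: (le_trans (ler_norm_sum _ _ _)).
rewrite -{1}[M]add0n big_addn addKn.
apply: (@le_trans _ _ (\sum_(0 <= i < n) C * x ^+ M * x ^+ i)).
  apply: ler_sum => i _; rewrite normrM normrX (ger0_norm x0) exprD mulrCA.
  by rewrite [leLHS]mulrC ler_wpM2r ?exprn_ge0// ler_wpM2r ?exprn_ge0.
rewrite -mulr_sumr ler_wpM2l ?mulr_ge0 ?exprn_ge0//.
have xn1 : x != 1 by rewrite lt_eqF.
have := geometric_seriesE 1 xn1 => /(congr1 (fun u => u n)) /=.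
rewrite /series /= (eq_bigr (fun i => x ^+ i)) => [->|i _]; last by rewrite mul1r.
rewrite mul1r -[leRHS]mul1r ler_wpM2r//; first by rewrite invr_ge0 subr_ge0 ltW.
by rewrite gerBl exprn_ge0.
Qed.

Section DifferenceRecursions.
Variable x : R.
Hypothesis x1 : `|x| < 1.

Lemma genfun_delta0 : genfun_at delta0 x 1.
Proof. by move=> f _; rewrite mul1r; apply: eq_psum => n; rewrite conv_delta0. Qed.

Lemma genfun_lin (a : R) e1 e2 (E1 E2 : R) c1 c2 :
  (forall n, `|e1 n| <= c1) -> (forall n, `|e2 n| <= c2) ->
  genfun_at e1 x E1 -> genfun_at e2 x E2 ->
  genfun_at (fun n => a * e1 n + e2 n) x (a * E1 + E2).
Proof.
move=> h1 h2 g1 g2 f [F hF].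
rewrite (eq_psum _ (conv_linl a e1 e2 f)) psum_lin//; first 1 last.
- exact: unit_cvg_conv h1 hF.
- exact: unit_cvg_conv h2 hF.
by rewrite g1 ?g2; [rewrite mulrDl mulrA | exists F..].
Qed.

Lemma genfun_shift e (E : R) c : (forall n, `|e n| <= c) ->
  genfun_at e x E -> genfun_at (shiftS e) x (x * E).
Proof.
move=> h1 g1 f [F hF].
rewrite (eq_psum _ (conv_shiftS e f)) psum_shift//; last exact: unit_cvg_conv h1 hF.
by rewrite g1; [rewrite mulrA | exists F].
Qed.

Lemma shiftS_bounded e (c : R) : (forall n, `|e n| <= c) ->
  forall n, `|shiftS e n| <= c.
Proof.
by move=> h [|n] //=; rewrite normr0 (le_trans _ (h 0%N)).
Qed.

Lemma iter_shiftS_bounded k e (c : R) : (forall n, `|e n| <= c) ->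
  forall n, `|iter k (@shiftS R) e n| <= c.
Proof. by elim: k => // k IH h; apply: shiftS_bounded; exact: IH. Qed.

Lemma genfun_iter_shift k e (E : R) c : (forall n, `|e n| <= c) ->
  genfun_at e x E -> genfun_at (iter k (@shiftS R) e) x (x ^+ k * E).
Proof.
move=> h1 g1; elim: k => [|k IH]; first by rewrite mul1r.
rewrite exprS -mulrA; apply: (genfun_shift (c := c)) => //.
exact: iter_shiftS_bounded.
Qed.

(* [e = p + s x^k e] is solved by [e = p / (1 - s x^k)]. *)
Lemma genfun_rec p e (P s : R) k c cp : (forall n, `|e n| <= c) ->
  (forall n, `|p n| <= cp) ->
  (forall n, e n = s * iter k (@shiftS R) e n + p n) -> 1 - s * x ^+ k != 0 ->
  genfun_at p x P -> genfun_at e x (P / (1 - s * x ^+ k)).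
Proof.
move=> he hp hrec nz gp f [F hF].
have hs n : `|iter k (@shiftS R) e n| <= c by exact: iter_shiftS_bounded.
have E : psum (conv e f) x = s * (x ^+ k * psum (conv e f) x) + P * psum f x.
  rewrite {1}(eq_psum _ (fun n => eq_conv n hrec (fun=> erefl))).
  rewrite (eq_psum _ (conv_linl _ _ _ _)) psum_lin//; first 1 last.
  - exact: unit_cvg_conv hs hF.
  - exact: unit_cvg_conv hp hF.
  rewrite gp; last by exists F.
  congr (s * _ + _).
  have g k' : psum (conv (iter k' (@shiftS R) e) f) x = x ^+ k' * psum (conv e f) x.
    elim: k' => [|k' IH]; first by rewrite mul1r.
    rewrite (eq_psum _ (conv_shiftS _ f)) psum_shift ?IH ?exprS ?mulrA//.
    apply: unit_cvg_conv hF; exact: iter_shiftS_bounded.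
  exact: g.
apply: (mulIf nz); rewrite mulrAC divfK// mulrBr mulr1 {1}E.
by ring.
Qed.

End DifferenceRecursions.

End PowerSeries.

(** * The substitution x = 2u/(1+u^2) *)

Section TrigSubstitution.
Variable R : realType.
Implicit Types (u v x : R).

(** Named after x = sin t, where the three forms become cot t dt, tan t dt and sec t dt. *)
Inductive letter := Lcot | Ltan | Lsec.

(* Coefficients of the forms dx/x, x dx/(1-x^2), dx/(1-x^2), divided by dx/x. *)
Definition xcoef (a : letter) (n : nat) : R :=
  match a with
  | Lcot => (n == 0%N)%:R
  | Ltan => ((0 < n)%N && ~~ odd n)%:R
  | Lsec => (odd n)%:R
  end.

(* The same forms after x = 2u/(1+u^2), divided by du/u; they are
   (1-u^2)/(1+u^2), 4u^2/(1-u^4) and 2u/(1-u^2). *)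
Definition ucoef (a : letter) (n : nat) : R :=
  match a with
  | Lcot => if odd n then 0 else if n == 0%N then 1 else 2 * (-1) ^+ n./2
  | Ltan => if (n %% 4 == 2)%N then 4 else 0
  | Lsec => if odd n then 2 else 0
  end.

(* 2 du/(1+u^2), divided by du/u. *)
Definition dtcoef (n : nat) : R := if odd n then 2 * (-1) ^+ n./2 else 0.

(** This is sin t for u = tan(t/2), which makes cos t rational in u as well. *)
Definition xu u : R := 2 * u / (1 + u ^+ 2).

Lemma den_gt0 u : 0 < 1 + u ^+ 2.
Proof. by rewrite ltr_pwDl// sqr_ge0. Qed.

Lemma den_neq0 u : 1 + u ^+ 2 != 0. Proof. by rewrite gt_eqF// den_gt0. Qed.

Lemma xu_lt1 u : 0 <= u < 1 -> 0 <= xu u < 1.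
Proof.
move=> /andP[u0 u1]; have d := den_gt0 u.
rewrite /xu divr_ge0 ?mulr_ge0//=; last exact: ltW.
by rewrite ltr_pdivrMr//; nra.
Qed.

Lemma xu_gt0 u : 0 < u -> 0 < xu u.
Proof. by move=> u0; rewrite /xu divr_gt0 ?den_gt0// mulr_gt0. Qed.

Lemma xu_le u v : 0 <= u -> u <= v -> v <= 1 -> xu u <= xu v.
Proof.
move=> u0 uv v1; rewrite /xu ler_pdivrMr ?den_gt0// mulrAC ler_pdivlMr ?den_gt0//.
have h1 : 0 <= v - u by rewrite subr_ge0.
have h2 : u * v <= 1 by rewrite mulr_ile1//; [exact: le_trans uv|exact: le_trans v1].
have h3 : 0 <= (v - u) * (1 - u * v) by rewrite mulr_ge0// subr_ge0.
nra.
Qed.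

Lemma xcoef_bounded a n : `|xcoef a n| <= 1.
Proof. by case: a => /=; rewrite normr_nat; case: (X in (nat_of_bool X)%:R). Qed.

Lemma norm_sgn2 k : `|2 * (-1) ^+ k| = 2 :> R.
Proof. by rewrite normrM normrX normrN1 expr1n mulr1 normr_nat. Qed.

Lemma ucoef_bounded a n : `|ucoef a n| <= 4.
Proof.
by case: a => /=; do ?[case: ifP => _]; rewrite ?norm_sgn2 ?normr0 ?normr1 ?normr_nat ?ler_nat ?(ler_nat _ 1).
Qed.

Lemma dtcoef_bounded n : `|dtcoef n| <= 4.
Proof. by rewrite /dtcoef; case: ifP => _; rewrite ?norm_sgn2 ?normr0 ?ler_nat. Qed.

Definition xgen (a : letter) x : R :=
  match a with
  | Lcot => 1
  | Ltan => x ^+ 2 / (1 - x ^+ 2)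
  | Lsec => x / (1 - x ^+ 2)
  end.

Definition ugen (a : letter) u : R :=
  match a with
  | Lcot => (1 - u ^+ 2) / (1 + u ^+ 2)
  | Ltan => 4 * u ^+ 2 / (1 - u ^+ 4)
  | Lsec => 2 * u / (1 - u ^+ 2)
  end.

Lemma sqr_lt1 x : `|x| < 1 -> 0 < 1 - x ^+ 2.
Proof. by move=> x1; rewrite subr_gt0 -real_normK ?num_real// exprn_ilt1. Qed.

Lemma monom_bounded k (n : nat) :
  `|iter k (@shiftS R) delta0 n| <= 1.
Proof.
by apply: iter_shiftS_bounded => m; rewrite /delta0 normr_nat; case: (m == _).
Qed.

Lemma genfun_monom x k : `|x| < 1 ->
  genfun_at (iter k (@shiftS R) delta0) x (x ^+ k).
Proof.
move=> x1; rewrite -[x ^+ k]mulr1; apply: (genfun_iter_shift x1 _ (monom_bounded 0)).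
exact: genfun_delta0.
Qed.

Lemma lin_bounded (a : R) (e1 e2 : nat -> R) (c1 c2 : R) :
  (forall n, `|e1 n| <= c1) -> (forall n, `|e2 n| <= c2) ->
  forall n, `|a * e1 n + e2 n| <= `|a| * c1 + c2.
Proof.
move=> h1 h2 n; rewrite (le_trans (ler_normD _ _))// lerD// normrM.
by rewrite ler_wpM2l.
Qed.

Lemma iter_shiftE k n : iter k (@shiftS R) delta0 n = (n == k)%:R.
Proof. by elim: k n => [|k IH] [|n] //=; rewrite IH. Qed.

Lemma genfun_zero x : genfun_at (fun=> 0) x (0 : R).
Proof.
move=> f _; rewrite mul0r; apply: cvg_lim => //.
rewrite [X in X @ _](_ : _ = fun=> 0); first exact: cvg_cst.
apply/funext => n; rewrite /pseries /series /= big1// => i _.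
by rewrite /conv big1 ?mul0r// => j _; rewrite mul0r.
Qed.

Lemma xgenP a x : `|x| < 1 -> genfun_at (xcoef a) x (xgen a x).
Proof.
move=> x1; have nz := sqr_lt1 x1.
have nz1 : 1 - 1 * x ^+ 2 != 0 by rewrite mul1r gt_eqF.
case: a => /=.
- exact: genfun_delta0.
- rewrite (_ : 1 - x ^+ 2 = 1 - 1 * x ^+ 2); last by rewrite mul1r.
  apply: (genfun_rec x1 (xcoef_bounded Ltan) (monom_bounded 2) _ nz1).
    by case=> [|[|[|n]]] //=; rewrite ?mul1r ?addr0 ?add0r//= negbK.
  exact: genfun_monom.
- rewrite (_ : 1 - x ^+ 2 = 1 - 1 * x ^+ 2); last by rewrite mul1r.
  apply: (genfun_rec x1 (xcoef_bounded Lsec) (monom_bounded 1) _ nz1).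
    by case=> [|[|n]] //=; rewrite ?iter_shiftE ?mul1r ?addr0 ?add0r ?negbK.
  by have := genfun_monom 1 x1; rewrite expr1.
Qed.

Lemma pm4 n : (n.+4 %% 4 = n %% 4)%N.
Proof. by rewrite -[n.+4]addn4 modnDr. Qed.

Lemma ugenP a u : `|u| < 1 -> genfun_at (ucoef a) u (ugen a u).
Proof.
move=> u1; have nz := sqr_lt1 u1.
have n0 : forall n : nat, `|(0 : R)| <= 0 by move=> _; rewrite normr0.
have gz c m := genfun_lin u1 c (monom_bounded m) n0
   (genfun_monom m u1) (genfun_zero u).
case: a => /=.
- rewrite (_ : (1 - _) / _ = (-1 * u ^+ 2 + 1) / (1 - -1 * u ^+ 2)); last first.
    by congr (_ / _); ring.
  have b1 := lin_bounded (-1) (monom_bounded 2) (monom_bounded 0).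
  apply: (genfun_rec u1 (ucoef_bounded Lcot) b1).
  + case=> [|[|[|[|n]]]]; rewrite /= /delta0 /=; try ring.
    by rewrite negbK; case: ifP => _; [ring|rewrite exprS; ring].
  + by rewrite mulN1r opprK den_neq0.
  + exact: (genfun_lin u1 (-1) (monom_bounded 2) (monom_bounded 0) (genfun_monom 2 u1) (genfun_delta0 _)).
- rewrite (_ : _ / _ = (4 * u ^+ 2 + 0) / (1 - 1 * u ^+ 4)); last by congr (_ / _); ring.
  apply: (genfun_rec u1 (ucoef_bounded Ltan) (lin_bounded 4 (monom_bounded 2) n0)).
  + case=> [|[|[|[|n]]]]; rewrite /ucoef /= ?pm4 /delta0 /=; try ring.
  + by rewrite mul1r (_ : 1 - u ^+ 4 = (1 - u ^+ 2) * (1 + u ^+ 2)) ?mulf_neq0 ?den_neq0 ?gt_eqF//; ring.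
  + exact: gz.
- rewrite (_ : _ / _ = (2 * u ^+ 1 + 0) / (1 - 1 * u ^+ 2)); last by congr (_ / _); ring.
  apply: (genfun_rec u1 (ucoef_bounded Lsec) (lin_bounded 2 (monom_bounded 1) n0)).
  + case=> [|[|n]]; rewrite /= /delta0 /= ?negbK; ring.
  + by rewrite mul1r gt_eqF.
  + exact: gz.
Qed.

Lemma dtgenP u : `|u| < 1 -> genfun_at dtcoef u (2 * u / (1 + u ^+ 2)).
Proof.
move=> u1.
have n0 : forall n : nat, `|(0 : R)| <= 0 by move=> _; rewrite normr0.
rewrite (_ : _ / _ = (2 * u ^+ 1 + 0) / (1 - -1 * u ^+ 2)); last by congr (_ / _); ring.
apply: (genfun_rec u1 dtcoef_bounded (lin_bounded 2 (monom_bounded 1) n0)).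
- case=> [|[|n]]; rewrite /dtcoef /= /delta0 /= ?negbK; try ring.
  by case: ifP => _; rewrite ?exprS; ring.
- by rewrite mulN1r opprK den_neq0.
- exact: (genfun_lin u1 2 (monom_bounded 1) n0 (genfun_monom 1 u1) (genfun_zero u)).
Qed.

Lemma is_derive_xu u : is_derive u (1 : R) xu (2 * (1 - u ^+ 2) / (1 + u ^+ 2) ^+ 2).
Proof.
have d := den_neq0 u.
have D1 : is_derive u (1 : R) (fun v => 2 * v) 2.
  by apply: is_derive_eq; rewrite ?scaler0 ?addr0 ?add0r // /GRing.scale /= mulr1.
have D2 : is_derive u (1 : R) (fun v => 1 + v ^+ 2) (2 * u).
  apply: is_derive_eq; rewrite /GRing.scale /= ?scaler0 ?add0r; ring.
have D3 := @is_deriveV R (fun v => 1 + v ^+ 2) u _ 1 d D2.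
have := is_deriveM D1 D3.
rewrite (_ : (_ * _ : R -> R) = xu); last first.
  by apply/funext => v; rewrite /xu.
move=> D; apply: is_derive_eq D _; rewrite /GRing.scale /=; field.
by rewrite d.
Qed.

Lemma subst_form a u : 0 < u < 1 ->
  xgen a (xu u) / xu u * (2 * (1 - u ^+ 2) / (1 + u ^+ 2) ^+ 2) = ugen a u / u.
Proof.
move=> /andP[u0 u1].
have d := den_neq0 u.
have h1 : 1 - u ^+ 2 != 0 by rewrite gt_eqF// subr_gt0 exprn_ilt1// ltW.
have h2 : u != 0 by rewrite gt_eqF.
have h3 : 1 - u ^+ 4 != 0.
  by rewrite (_ : 1 - u ^+ 4 = (1 - u ^+ 2) * (1 + u ^+ 2)) ?mulf_neq0//; ring.
have h4 : 1 - xu u ^+ 2 = (1 - u ^+ 2) ^+ 2 / (1 + u ^+ 2) ^+ 2.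
  by rewrite /xu; field.
case: a; rewrite /xgen ?h4 /xu /=; field; rewrite ?d ?h1 ?h2 ?h3//.
Qed.

Lemma is_derive_psum_comp f u C : (forall n, `|f n| <= C) -> 0 <= u < 1 ->
  is_derive u (1 : R) (psum f \o xu)
   (psum (pseries_diffs f) (xu u) * (2 * (1 - u ^+ 2) / (1 + u ^+ 2) ^+ 2)).
Proof.
move=> hf u01; have /andP[x0 x1] := xu_lt1 u01.
apply: is_derive1_comp; last exact: is_derive_xu.
by apply: is_derive_psum; [exact: unit_cvg_bounded hf|rewrite ger0_norm].
Qed.

(** Both sides vanish at u = 0, and by the chain rule and [subst_form] they have the same derivative
    on the open interval; the mean value theorem does the rest. *)
Lemma psum_subst a f g (F G : R) :
  (forall n, `|f n| <= F) -> (forall n, `|g n| <= G) ->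
  xcoef a 0 * f 0%N = 0 -> ucoef a 0 * g 0%N = 0 ->
  (forall u, 0 <= u < 1 -> psum f (xu u) = psum g u) ->
  forall u, 0 <= u < 1 ->
    psum (iform (xcoef a) f) (xu u) = psum (iform (ucoef a) g) u.
Proof.
move=> hf hg f0 g0 fg u u01.
have Bx := iform_bounded (xcoef_bounded a) hf.
have Bu := iform_bounded (ucoef_bounded a) hg.
pose h v := psum (iform (xcoef a) f) (xu v) - psum (iform (ucoef a) g) v.
suff : h u = 0 by move/eqP; rewrite subr_eq0 => /eqP.
have h0 : h 0 = 0.
  by rewrite /h /xu mulr0 mul0r !psum_at0 !iform0 subrr.
have [->|un0] := eqVneq u 0; first exact: h0.
have /andP[u0 u1] := u01.
have {}u0 : 0 < u by rewrite lt_neqAle eq_sym un0.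
(* The explicit derivative divides by v, so at 0 only differentiability is recorded, for the sake of
   continuity on the closed interval. *)
have dh v : 0 <= v < 1 -> {d | is_derive v (1 : R) h d}.
  move=> v01; eexists; apply: is_deriveB.
    exact: (is_derive_psum_comp Bx).
  apply: is_derive_psum; [exact: unit_cvg_bounded Bu|].
  by case/andP: v01 => ? ?; rewrite ger0_norm.
have dh0 v : 0 < v < 1 -> is_derive v (1 : R) h 0.
  move=> /andP[v0 v1]; have v01 : 0 <= v < 1 by rewrite ltW.
  have /andP[x0 x1] := xu_lt1 v01.
  have xv : `|xu v| < 1 by rewrite ger0_norm.
  have vv : `|v| < 1 by rewrite ger0_norm// ltW.
  have D1 := is_derive_psum_iform (xcoef_bounded a) hf f0 xv
     (lt0r_neq0 (xu_gt0 v0)) (xgenP a xv).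
  have D2 := is_derive_psum_iform (ucoef_bounded a) hg g0 vv
     (lt0r_neq0 v0) (ugenP a vv).
  have D3 := is_derive1_comp D1 (is_derive_xu v).
  apply: is_derive_eq (is_deriveB D3 D2) _.
  rewrite -fg// [X in X - _](_ : _ = psum f (xu v) *
    (xgen a (xu v) / xu v * (2 * (1 - v ^+ 2) / (1 + v ^+ 2) ^+ 2))); last by ring.
  by rewrite subst_form ?v0//; ring.
have [||c cu] := @MVT _ h (fun=> 0) 0 u u0.
- by move=> v; rewrite in_itv /= => /andP[v0 vu]; apply: dh0; rewrite v0 (lt_trans vu).
- apply: derivable_within_continuous => v; rewrite in_itv /= => /andP[v0 vu].
  by have [|d []] := dh v; first by rewrite v0 (le_lt_trans vu).
- by rewrite mul0r h0 subr0.
Qed.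

End TrigSubstitution.

(** * Iterated integrals and central binomial coefficients *)

Section Words.
Variable R : realType.

Definition xword (w : seq letter) : nat -> R :=
  foldr (fun a => iform (xcoef R a)) delta0 w.

Definition uword (w : seq letter) : nat -> R :=
  foldr (fun a => iform (ucoef R a)) delta0 w.

(* The innermost form dx/x would have to be integrated from [0] against the
   constant [1]. *)
Definition regular (w : seq letter) : bool :=
  if last Ltan w is Lcot then false else true.

(** Only [Lsec] has odd exponents, so this is the common parity of all exponents in the x-expansion
    of the word. *)
Definition parity (w : seq letter) : bool :=
  foldr (fun a b => if a is Lsec then ~~ b else b) false w.

Lemma regular_behead a w : regular (a :: w) -> regular w.
Proof. by case: w. Qed.

Lemma xcoef_ge0 a n : 0 <= xcoef R a n.
Proof. by case: a => /=; exact: ler0n. Qed.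

Lemma xword_ge0 w n : 0 <= xword w n.
Proof.
elim: w n => [|a w IH] n /=; first exact: ler0n.
rewrite /iform mulr_ge0 ?invr_ge0//; apply: sumr_ge0 => i _.
by rewrite mulr_ge0// xcoef_ge0.
Qed.

Lemma delta0_bounded n : `|delta0 n| <= 1 :> R.
Proof. by rewrite /delta0 normr_nat; case: (n == _). Qed.

Lemma xword_bounded w : exists F : R, forall n, `|xword w n| <= F.
Proof.
elim: w => [|a w [F IH]]; first by exists 1; exact: delta0_bounded.
by eexists => n; exact: (iform_bounded (xcoef_bounded R a) IH).
Qed.

Lemma uword_bounded w : exists F : R, forall n, `|uword w n| <= F.
Proof.
elim: w => [|a w [F IH]]; first by exists 1; exact: delta0_bounded.
by eexists => n; exact: (iform_bounded (ucoef_bounded R a) IH).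
Qed.

Lemma xcoef_parity a n : xcoef R a n != 0 -> odd n = if a is Lsec then true else false.
Proof.
case: a => /=; rewrite pnatr_eq0 eqb0 negbK.
- by move/eqP->.
- by case/andP=> _ /negbTE.
- by [].
Qed.

Lemma xword_parity w n : odd n != parity w -> xword w n = 0.
Proof.
elim: w n => [|a w IH] n /=; first by rewrite /delta0; case: n.
move=> hn; rewrite /iform /conv big1 ?mulr0// => i _.
have [->|/xcoef_parity ha] := eqVneq (xcoef R a (n - i)) 0; first by rewrite mul0r.
rewrite IH ?mulr0//; apply: contraNneq hn => hi.
have -> : odd n = odd (n - i) (+) odd i.
  by rewrite -oddD subnK// -ltnS.
by rewrite ha hi; case: a {ha}; case: (parity w).
Qed.

Lemma psum_delta0 (x : R) : psum delta0 x = 1.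
Proof.
apply: cvg_lim => //; rewrite -cvg_shiftS [X in X @ _](_ : _ = fun=> 1).
  exact: cvg_cst.
apply/funext => n; rewrite /pseries /series /= big_nat_recl//= big1 ?addr0 ?expr0 ?mulr1//.
by move=> i _; rewrite mul0r.
Qed.

Lemma psum_xword w u : regular w -> 0 <= u < 1 ->
  psum (xword w) (xu u) = psum (uword w) u.
Proof.
elim: w u => [|a w IH] u rw u01; first by rewrite !psum_delta0.
have [F hF] := xword_bounded w; have [G hG] := uword_bounded w.
apply: (psum_subst hF hG) => //; last first.
- by move=> v v01; apply: IH => //; exact: regular_behead rw.
(* The product of constant terms vanishes: either the letter has none, or it is [Lcot] and
   regularity makes the tail nonempty, hence with constant term 0. *)
- case: a w {IH hF hG} rw => -[|b w] //= rw; rewrite ?mul0r//.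
  by rewrite iform0 mulr0.
- case: a w {IH hF hG} rw => -[|b w] //= rw; rewrite ?mul0r//.
  by rewrite iform0 mulr0.
Qed.

(* [sinint j] is the antiderivative of [sin^(2j+1) t dt] that vanishes at
   [t = 0], where [sin t = xu u] and [cos t = yu u]. *)
Definition yu (u : R) : R := (1 - u ^+ 2) / (1 + u ^+ 2).

Fixpoint sinint (j : nat) (u : R) : R :=
  if j is i.+1 then
    ((2 * i + 2)%:R * sinint i u - yu u * xu u ^+ (2 * i + 2)) / (2 * i + 3)%:R
  else 1 - yu u.

Lemma is_derive_yu (u : R) : is_derive u (1 : R) yu (- xu u * (2 / (1 + u ^+ 2))).
Proof.
have d := den_neq0 u.
have D1 : is_derive u (1 : R) (fun v => 1 - v ^+ 2) (- (2 * u)).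
  by apply: is_derive_eq; rewrite /GRing.scale /= ?scaler0 ?add0r; ring.
have D2 : is_derive u (1 : R) (fun v => 1 + v ^+ 2) (2 * u).
  by apply: is_derive_eq; rewrite /GRing.scale /= ?scaler0 ?add0r; ring.
have D3 := @is_deriveV R (fun v => 1 + v ^+ 2) u _ 1 d D2.
have := is_deriveM D1 D3.
rewrite (_ : (_ * _ : R -> R) = yu); last by apply/funext.
by move=> D; apply: is_derive_eq D _; rewrite /xu /GRing.scale /=; field.
Qed.

(** The recursion defining [sinint] is the reduction formula for sin^(2j+3), obtained by parts; dt
    is 2 du/(1+u^2). *)
Lemma is_derive_sinint j (u : R) :
  is_derive u (1 : R) (sinint j) (xu u ^+ (2 * j + 1) * (2 / (1 + u ^+ 2))).
Proof.
have d := den_neq0 u.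
have Dy := is_derive_yu u; have Dx := is_derive_xu u.
elim: j => [|j IH].
  have D0 := is_deriveB (is_derive_cst (1 : R) u 1) Dy.
  rewrite (_ : sinint 0 = cst 1 - yu)//.
  by apply: is_derive_eq D0 _; rewrite muln0 add0n expr1; ring.
have D1 := is_deriveZ (2 * j + 2)%:R IH.
have D2 := is_deriveM Dy (is_deriveX (2 * j + 1).+1 Dx).
have D3 := is_deriveZ (2 * j + 3)%:R^-1 (is_deriveB D1 D2).
rewrite (_ : sinint j.+1 = (2 * j + 3)%:R^-1 \*:
  ((2 * j + 2)%:R \*: sinint j - yu * xu (R:=R) ^+ (2 * j + 1).+1)); last first.
  apply/funext => v /=; rewrite mulrC; congr (_ * (_ - _ * _)).
  by rewrite -addnS; elim: (2 * j + 2)%N => // k IHk; rewrite !exprS IHk.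
apply: is_derive_eq D3 _; rewrite /GRing.scale /=.
have n3 : (2 * j + 3)%:R != 0 :> R by rewrite addn3 pnatr_eq0.
have e : (2 * j.+1 + 1 = (2 * j + 1) + 2)%N by rewrite mulnS -addnA addnC -addnA.
have p : (xu (R:=R) ^+ (2 * j + 1).+1) u = xu u ^+ (2 * j + 1) * xu u.
  by rewrite -exprSr; elim: (2 * j + 1).+1 => // k IHk; rewrite !exprS -IHk.
rewrite p e [_ ^+ (_ + 2)]exprD.
have yx : yu u ^+ 2 = 1 - xu u ^+ 2 by rewrite /yu /xu; field.
have dx : 2 * (1 - u ^+ 2) / (1 + u ^+ 2) ^+ 2 = yu u * (2 / (1 + u ^+ 2)).
  by rewrite /yu; field.
rewrite dx.
set X := xu u ^+ (2 * j + 1).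
have -> : (2 * j + 2)%:R = (2 * j + 1)%:R + 1 :> R by rewrite natr1 addn1 addn2.
have -> : (2 * j + 1).+1%:R = (2 * j + 1)%:R + 1 :> R by rewrite -natr1.
move: n3; rewrite (_ : (2 * j + 3)%:R = (2 * j + 1)%:R + 2 :> R); last first.
  by rewrite -natrD -addnA.
move: ((2 * j + 1)%:R : R) => k n3; set D := 2 / _.
apply: (mulIf n3); rewrite mulrAC mulVf// mul1r.
have -> : (k + 1) * (X * D) -
   (yu u * ((k + 1) * X * (yu u * D)) + X * xu u * (- xu u * D)) =
   X * D * ((k + 1) * (1 - yu u ^+ 2) + xu u ^+ 2) by ring.
by rewrite yx; ring.
Qed.

Lemma sinint_at0 j : sinint j 0 = 0.
Proof.
elim: j => [|j IH] /=; first by rewrite /yu expr0n /= subr0 addr0 divr1 subrr.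
by rewrite IH /xu !mulr0 mul0r expr0n addn2 /= mulr0 subrr mul0r.
Qed.

Definition bcoefR (n : nat) : R := 4 ^+ n / 'C(2 * n, n)%:R.

Lemma bcoefR_gt0 n : 0 < bcoefR n.
Proof. by rewrite /bcoefR divr_gt0 ?exprn_gt0// ltr0n bin_gt0 leq_pmull. Qed.

Lemma bcoefR0 : bcoefR 0 = 1.
Proof. by rewrite /bcoefR muln0 bin0 expr0 divr1. Qed.

Lemma bcoefRS n : bcoefR n.+1 = bcoefR n * (2 * n + 2)%:R / (2 * n + 1)%:R.
Proof.
have H : ((n.+1 * 'C(2 * n.+1, n.+1) = 2 * (2 * n + 1) * 'C(2 * n, n)))%N.
  have e : (2 * n.+1 = (2 * n).+2)%N by rewrite mulnS.
  have h1 : (n.+1 * 'C((2 * n).+2, n.+1) = (2 * n).+2 * 'C((2 * n).+1, n))%N.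
    by rewrite mul_bin_diag.
  have h2 : (n.+1 * 'C((2 * n).+1, n) = (2 * n).+1 * 'C(2 * n, n))%N.
    rewrite (mul_bin_diag (2 * n).+1 n); congr (_ * _)%N.
    by rewrite -[RHS]bin_sub; [congr 'C(_, _)|]; lia.
  apply/eqP; rewrite -(eqn_pmul2l (ltn0Sn n)) e h1 mulnCA h2; apply/eqP; nia.
have b0 k : ('C(2 * k, k))%:R != 0 :> R.
  by rewrite pnatr_eq0 -lt0n bin_gt0 leq_pmull.
have := congr1 (fun k => k%:R : R) H; rewrite !natrM /bcoefR exprS => HR.
have n1 : n.+1%:R != 0 :> R by rewrite pnatr_eq0.
have n2 : (2 * n + 1)%:R != 0 :> R by rewrite addn1 pnatr_eq0.
have -> : 'C(2 * n.+1, n.+1)%:R = 2 * (2 * n + 1)%:R * 'C(2 * n, n)%:R / n.+1%:R :> R.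
  by rewrite -HR mulrC mulKf.
have -> : (2 * n + 2)%:R = 2 * n.+1%:R :> R by rewrite -natrM mulnS addnC.
move: n1 n2 (b0 n); move: (n.+1%:R : R) ((2 * n + 1)%:R : R) ('C(2 * n, n)%:R : R).
by move=> p q r p0 q0 r0; field; rewrite p0 q0 r0.
Qed.

(** Wallis integrals: u = 1 is t = pi/2, where the boundary term of the reduction formula vanishes
    and the recursion becomes that of b_j. *)
Lemma sinint_at1 j : sinint j 1 = bcoefR j / (2 * j + 1)%:R.
Proof.
have y1 : yu 1 = 0 by rewrite /yu expr1n subrr mul0r.
elim: j => [|j IH] /=; first by rewrite y1 subr0 bcoefR0 divr1.
rewrite IH y1 mul0r subr0 bcoefRS.
rewrite (_ : (2 * j.+1 + 1 = 2 * j + 3)%N); last by lia.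
by rewrite mulrCA mulrA.
Qed.


(* The outermost form, divided by du/u: du/u or 2 du/(1+u^2). *)
Definition topcoef (odd_top : bool) : nat -> R :=
  if odd_top then @dtcoef R else delta0.

(** The outermost form follows the parity so that each monomial turns into an odd power of sin t
    times dt: x^(2j+1) is taken with dt, and x^(2j+2) with du/u = dt/x. *)
Definition topword (w : seq letter) : nat -> R :=
  iform (topcoef (parity w)) (uword w).

Definition topgen (odd_top : bool) (u : R) : R :=
  if odd_top then 2 * u / (1 + u ^+ 2) else 1.

Lemma topcoef_bounded b n : `|topcoef b n| <= 4.
Proof.
by case: b; [exact: dtcoef_bounded|rewrite (le_trans (delta0_bounded n))// ler1n].
Qed.

(** A partial sum of the x-expansion, integrated term by term against the outermost form; at u = 1
    it is a partial sum of the series with b_j/(2j+1). *)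
Definition sinsum w M (u : R) : R :=
  \sum_(0 <= j < M) xword w (2 * j + 1 + ~~ parity w) * sinint j u.

Lemma is_derive_sinsum w M (u : R) :
  is_derive u (1 : R) (sinsum w M)
   (\sum_(0 <= j < M) xword w (2 * j + 1 + ~~ parity w) *
     (xu u ^+ (2 * j + 1) * (2 / (1 + u ^+ 2)))).
Proof.
elim: M => [|M IH].
  rewrite big_nil (_ : sinsum w 0 = cst 0); last first.
    by apply/funext => v; rewrite /sinsum big_nil.
  exact: is_derive_cst.
rewrite big_nat_recr//= (_ : sinsum w M.+1 =
  sinsum w M + xword w (2 * M + 1 + ~~ parity w) \*: sinint M); last first.
  by apply/funext => v; rewrite /sinsum big_nat_recr.
by apply: is_deriveD; apply: is_deriveZ; exact: is_derive_sinint.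
Qed.

Lemma partial_parity w M (x : R) : (0 < size w)%N ->
  \sum_(0 <= k < 2 * M + 1 + ~~ parity w) xword w k * x ^+ k =
  \sum_(0 <= j < M) xword w (2 * j + 1 + ~~ parity w) * x ^+ (2 * j + 1 + ~~ parity w).
Proof.
case: w => // a w _; set v := a :: w.
elim: M => [|M IH].
  rewrite [RHS]big_nil; case E : (parity v); rewrite [LHS]/=.
    by rewrite big_nat1 iform0 mul0r.
  rewrite big_nat_recr//= big_nat1 iform0 mul0r add0r.
  by have := @xword_parity v 1%N; rewrite E => /(_ isT) /= ->; rewrite mul0r.
rewrite [RHS]big_nat_recr//= -IH.
have -> : (2 * M.+1 + 1 + ~~ parity v = (2 * M + 1 + ~~ parity v).+2)%N by lia.
rewrite !big_nat_recr//= -addrA; congr (_ + _).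
rewrite -[RHS]addr0; congr (_ + _).
apply/eqP; rewrite mulf_eq0; apply/orP; left; apply/eqP.
apply: (@xword_parity v).
change (is_true (odd (2 * M + 1 + ~~ parity v).+1 != parity v)).
by rewrite -addSn addn1 mul2n -doubleS oddD odd_double; case: (parity v).
Qed.

Lemma top_derive w (u : R) : regular w -> (0 < size w)%N -> 0 < u < 1 ->
  is_derive u (1 : R) (psum (topword w)) (topgen (parity w) u * psum (xword w) (xu u) / u).
Proof.
move=> rw wn /andP[u0 u1].
have uu : `|u| < 1 by rewrite ger0_norm// ltW.
have [G hG] := uword_bounded w.
rewrite psum_xword//; last by rewrite ltW.
apply: (is_derive_psum_iform (topcoef_bounded _) hG) => //.
- case: w wn {rw hG} => // a w _ /=; by rewrite iform0 mulr0.
- by rewrite gt_eqF.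
- rewrite /topcoef /topgen; case: (parity w); first exact: dtgenP.
  exact: genfun_delta0.
Qed.

Lemma xu_top b (u : R) j : 0 < u ->
  topgen b u * xu u ^+ (2 * j + 1 + ~~ b) / u = xu u ^+ (2 * j + 1) * (2 / (1 + u ^+ 2)).
Proof.
move=> u0; have d := den_neq0 u; have h2 : u != 0 by rewrite gt_eqF.
by case: b; rewrite /topgen /= ?addn0 ?addn1 ?exprS /xu; field; rewrite d h2.
Qed.

Lemma psum_ge_partial (f : nat -> R) x C M : (forall n, 0 <= f n <= C) -> 0 <= x < 1 ->
  \sum_(0 <= k < M) f k * x ^+ k <= psum f x.
Proof.
move=> hf /andP[x0 x1].
apply: (@nondecreasing_cvgn_le _ (pseries f x) _ _ M).
  apply/nondecreasing_seqP => n; rewrite /pseries /series /= big_nat_recr//= lerDl.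
  by rewrite mulr_ge0 ?exprn_ge0//; case/andP: (hf n).
apply: (@unit_cvg_bounded _ _ C); last by rewrite ger0_norm.
by move=> n; case/andP: (hf n) => f0 fC; rewrite ger0_norm.
Qed.

Lemma topgen_bounds b (v : R) : 0 <= v <= 1 -> 0 <= topgen b v <= 1.
Proof.
move=> /andP[v0 v1]; case: b; rewrite /topgen ?ler01 ?lexx//.
rewrite divr_ge0 ?mulr_ge0//=; last exact/ltW/den_gt0.
by rewrite ler_pdivrMr ?den_gt0//; nra.
Qed.

(* The derivative of the difference is the tail of the nonnegative series of the
   x-word, times the outermost form. *)
Lemma top_bounds w : regular w -> (0 < size w)%N -> exists C, forall M (u : R),
  0 <= u < 1 ->
  0 <= psum (topword w) u - sinsum w M u <= C * (xu u ^+ (2 * M) / (1 - xu u)).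
Proof.
move=> rw wn; have [C hC] := xword_bounded w.
have C0 : 0 <= C := le_trans (normr_ge0 _) (hC 0%N).
have [G hG] := uword_bounded w.
have bT := iform_bounded (topcoef_bounded (parity w)) hG.
exists (2 * C) => M u u01.
pose h v := psum (topword w) v - sinsum w M v.
have h0 : h 0 = 0.
  rewrite /h psum_at0 /topword iform0 /sinsum big1 ?subr0// => j _.
  by rewrite sinint_at0 mulr0.
have /andP[x0 x1] := xu_lt1 u01.
have [u0'|un0] := eqVneq u 0.
  have hu : h u = 0 by rewrite u0' h0.
  rewrite -/(h u) hu lexx /= !mulr_ge0 ?exprn_ge0//.
  by rewrite invr_ge0 subr_ge0 ltW.
have /andP[u0 u1] := u01.
have {}u0 : 0 < u by rewrite lt_neqAle eq_sym un0.
have dh (v : R) : 0 <= v < 1 -> {d | is_derive v (1 : R) h d}.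
  move=> v01; eexists; apply: is_deriveB; last exact: is_derive_sinsum.
  apply: is_derive_psum; [exact: unit_cvg_bounded bT|].
  by case/andP: v01 => ? ?; rewrite ger0_norm.
pose K := (2 * M + 1 + ~~ parity w)%N.
pose dh' (v : R) := topgen (parity w) v / v *
  (psum (xword w) (xu v) - \sum_(0 <= k < K) xword w k * xu v ^+ k).
have dhE (v : R) : 0 < v < 1 -> is_derive v (1 : R) h (dh' v).
  move=> v01; have /andP[v0 v1] := v01.
  apply: is_derive_eq (is_deriveB (top_derive rw wn v01) (is_derive_sinsum w M v)) _.
  rewrite /dh' partial_parity// mulrBr mulrAC; congr (_ - _).
  rewrite mulr_sumr; apply: eq_bigr => j _; rewrite -(xu_top (parity w) j v0).
  by ring.
have [||c] := @MVT _ h dh' 0 u u0.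
- by move=> v; rewrite in_itv /= => /andP[v0 vu]; apply: dhE; rewrite v0 (lt_trans vu).
- apply: derivable_within_continuous => v; rewrite in_itv /= => /andP[v0 vu].
  by have [|d []] := dh v; first by rewrite v0 (le_lt_trans vu).
rewrite in_itv /= h0 !subr0 => /andP[c0 cu] hu.
have c1 : c < 1 := lt_trans cu u1.
have c01 : 0 <= c < 1 by rewrite ltW.
have /andP[y0 y1] := xu_lt1 c01.
have /andP[t0 t1] : 0 <= topgen (parity w) c <= 1.
  by rewrite topgen_bounds// !ltW.
have d0 : 0 <= psum (xword w) (xu c) - \sum_(0 <= k < K) xword w k * xu c ^+ k.
  rewrite subr_ge0 (@psum_ge_partial _ _ C) ?y0 ?y1// => n.
  by rewrite xword_ge0 (le_trans (ler_norm _)).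
have dc0 : 0 <= dh' c by rewrite /dh' mulr_ge0// divr_ge0// ltW.
rewrite -/(h u) hu; apply/andP; split; first by rewrite mulr_ge0// ltW.
apply: (@le_trans _ _ (dh' c)).
  by rewrite -[leRHS]mulr1 ler_wpM2l// ltW.
have := @psum_sub_partial _ (xword w) C (xu c) K; rewrite y0 y1 => /(_ isT hC).
move=> /(le_trans (ler_norm _)) B.
apply: (@le_trans _ _ (1 / c * (C * xu c ^+ K / (1 - xu c)))).
  by apply: ler_pM => //; [rewrite divr_ge0// ltW | rewrite ler_wpM2r// invr_ge0 ltW].
(* One factor [xu c] pays for the division by c, at the price of the 2 in the constant [2 * C]. *)
have K1 : K = ((2 * M + ~~ parity w).+1)%N by rewrite /K addn1 addSn.
have xc : xu c / c <= 2.
  rewrite /xu ler_pdivrMr// ler_pdivrMr ?den_gt0//; nra.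
rewrite K1 exprS.
have -> : 1 / c * (C * (xu c * xu c ^+ (2 * M + ~~ parity w)) / (1 - xu c)) =
  (xu c / c) * C * (xu c ^+ (2 * M + ~~ parity w) / (1 - xu c)) by ring.
have xcu : xu c <= xu u by apply: xu_le; exact: ltW.
apply: ler_pM.
- by rewrite mulr_ge0// divr_ge0// ltW.
- by rewrite divr_ge0 ?exprn_ge0// subr_ge0 ltW.
- by rewrite ler_wpM2r.
- apply: ler_pM.
  + exact: exprn_ge0.
  + by rewrite invr_ge0 subr_ge0 ltW.
  + rewrite exprD (@le_trans _ _ (xu c ^+ (2 * M)))//.
      rewrite -[leRHS]mulr1 ler_wpM2l ?exprn_ge0//.
      by rewrite exprn_ile1// ltW.
    by rewrite lerXn2r.
  + by rewrite lef_pV2 ?posrE ?subr_gt0// lerB.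
Qed.

Lemma sinint_le1 j (u : R) : 0 <= u <= 1 -> sinint j u <= sinint j 1.
Proof.
move=> /andP[u0 u1]; have [->//|un1] := eqVneq u 1.
have {}u1 : u < 1 by rewrite lt_neqAle un1.
have [||c] := @MVT _ (sinint j) (fun v => xu v ^+ (2 * j + 1) * (2 / (1 + v ^+ 2))) u 1 u1.
- by move=> v _; exact: is_derive_sinint.
- by apply: derivable_within_continuous => v _; case: (is_derive_sinint j v).
rewrite in_itv /= => /andP[uc c1] E; rewrite -subr_ge0 E.
have c0 : 0 < c by rewrite (le_lt_trans u0).
by rewrite !mulr_ge0 ?exprn_ge0 ?invr_ge0 ?subr_ge0 ?(ltW (den_gt0 _)) ?(ltW (xu_gt0 _))// ltW.
Qed.

Lemma psum_norm_le (r : nat -> R) (u D eps : R) N : 0 <= u < 1 -> unit_cvg r ->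
  D = \sum_(0 <= k < N) `|r k| -> 0 <= eps -> (forall n, (N <= n)%N -> `|r n| <= eps) ->
  `|psum r u| <= D + eps / (1 - u).
Proof.
move=> /andP[u0 u1] cr -> e0 hr.
have uu : `|u| < 1 by rewrite ger0_norm.
apply: (@cvgn_le _ (fun n => `|pseries r u n|)).
  by apply: cvg_norm; exact: cr.
move=> n; apply: (le_trans (ler_norm_sum _ _ _)).
apply: (@le_trans _ _ (\sum_(0 <= k < n) ((if (k < N)%N then `|r k| else 0) + eps * u ^+ k))).
  apply: ler_sum => k _; rewrite normrM normrX (ger0_norm u0).
  case: ltnP => kN.
    rewrite -[leLHS]addr0 lerD ?mulr_ge0 ?exprn_ge0//.
    by rewrite -[leRHS]mulr1 ler_wpM2l// exprn_ile1// ltW.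
  by rewrite add0r ler_wpM2r ?exprn_ge0// hr.
rewrite big_split /=; apply: lerD.
  rewrite -big_mkcond /= (big_nat_widen _ _ (maxn n N))/= ?leq_maxl//.
  rewrite (big_nat_widen _ _ (maxn n N) xpredT) ?leq_maxr//.
  rewrite [leLHS]big_mkcond [leRHS]big_mkcond /=.
  by apply: ler_sum => k _; case: ifP => [/andP[-> _]|_]//; case: ifP.
rewrite -mulr_sumr ler_wpM2l//.
have un1 : u != 1 by rewrite lt_eqF.
have := geometric_seriesE 1 un1 => /(congr1 (fun u => u n)) /=.
rewrite /series /= (eq_bigr (fun i => u ^+ i)) => [->|i _]; last by rewrite mul1r.
rewrite mul1r -[leRHS]mul1r ler_wpM2r//; first by rewrite invr_ge0 subr_ge0 ltW.
by rewrite gerBl exprn_ge0.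
Qed.

Lemma psum_cst (a u : R) : `|u| < 1 -> (1 - u) * psum (fun=> a) u = a.
Proof.
move=> uu; have c1 := @unit_cvg_cst R a.
have cd : unit_cvg (fun n => a * delta0 n : R).
  apply: (@unit_cvg_bounded _ _ `|a|) => n; rewrite normrM ler_piMr//.
  exact: delta0_bounded.
have E : psum (fun=> a) u = 1 * psum (shiftS (fun=> a)) u + psum (fun n => a * delta0 n) u.
  rewrite -psum_lin//; last exact: unit_cvg_shift.
  by apply: eq_psum => -[|n] /=; rewrite /delta0 /=; ring.
have E2 : psum (fun n => a * delta0 n) u = a.
  have c0 := @unit_cvg_cst R 0.
  rewrite (@eq_psum _ _ (fun n => a * delta0 n + 0)); last by move=> n; rewrite addr0.
  rewrite psum_lin// ?psum_delta0; last exact: (unit_cvg_bounded delta0_bounded).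
  rewrite mulr1 -[RHS]addr0; congr (_ + _); apply: cvg_lim => //.
  rewrite [X in X @ _](_ : _ = fun=> 0); first exact: cvg_cst.
  by apply/funext => n; rewrite /pseries /series /= big1// => i _; rewrite mul0r.
by rewrite mulrBl mul1r {1}E E2 psum_shift//; ring.
Qed.

(** Abel's theorem. Summation by parts gives psum c u - S = (1-u) times the power series of s_n - S;
    its first terms are killed by 1-u as u -> 1, the others are small from the start. *)
Lemma abel_limit (c : nat -> R) (S : R) : series c @ \oo --> S ->
  psum c u @[u --> 1^'-] --> S.
Proof.
move=> cS.
pose s n := series c n.+1.
have sS : s @ \oo --> S by rewrite cvg_shiftS.
have [B [_ hB]] := cvg_seq_bounded (cvgP _ sS).
have sB n : `|s n| <= B + 1 by apply: hB => //; rewrite ltrDl.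
have cs := unit_cvg_bounded sB.
have bc n : `|c n| <= 2 * (B + 1).
  have -> : c n = s n - shiftS s n.
    by case: n => [|n]; rewrite /s /series /= ?big_nat1 ?subr0// big_nat_recr//= addrAC subrr add0r.
  rewrite (le_trans (ler_normB _ _))// mulr_natl mulr2n lerD//.
  exact: shiftS_bounded.
have cc := unit_cvg_bounded bc.
have E u : `|u| < 1 -> psum c u - S = (1 - u) * psum (fun n => s n - S) u.
  move=> uu.
  have -> : psum (fun n => s n - S) u = 1 * psum s u + psum (fun=> - S) u.
    rewrite -psum_lin//; last exact: unit_cvg_cst.
    by apply: eq_psum => n; rewrite mul1r.
  rewrite mulrDr psum_cst// mul1r; congr (_ - _).
  have -> : psum c u = -1 * psum (shiftS s) u + psum s u.
    rewrite -psum_lin//; last exact: unit_cvg_shift.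
    by apply: eq_psum => -[|n]; rewrite /s /series /= ?big_nat1 ?big_nat_recr//=; ring.
  by rewrite psum_shift//; ring.
have cr : unit_cvg (fun n => s n - S).
  have := @unit_cvg_lin R 1 _ _ cs (@unit_cvg_cst R (- S)); apply: eq_unit_cvg => n.
  by rewrite mul1r.
apply/cvgrPdist_le => e e0.
have e2 : 0 < e / 2 by rewrite divr_gt0.
have /cvgrPdist_le/(_ _ e2)[N _ hN] := sS.
pose D := \sum_(0 <= k < N) `|s k - S|.
have D0 : 0 <= D by apply: sumr_ge0.
near=> u.
have u1 : u < 1 by near: u; exact: nbhs_left_lt.
have u0 : 0 <= u by near: u; apply: nbhs_left_ge.
have uD : 1 - u <= e / 2 / (D + 1).
  rewrite lerBlDr -lerBlDl; near: u; apply: nbhs_left_ge.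
  by rewrite ltrBlDr ltrDl divr_gt0// ltr_pwDr.
have uu : `|u| < 1 by rewrite ger0_norm.
rewrite distrC (E _ uu) normrM [X in X * _]ger0_norm ?subr_ge0 ?(ltW u1)//.
have := @psum_norm_le (fun n => s n - S) u D (e / 2) N.
rewrite u0 u1 => /(_ isT cr erefl (ltW e2)) H.
apply: (@le_trans _ _ ((1 - u) * (D + e / 2 / (1 - u)))).
  rewrite ler_wpM2l ?subr_ge0 ?(ltW u1)//; apply: H => n hn.
  by rewrite distrC; apply: hN.
rewrite mulrDr [_ * (e / 2 / _)]mulrC divfK ?subr_eq0 ?gt_eqF//.
rewrite [leRHS](splitr e) lerD2r.
apply: (@le_trans _ _ (e / 2 / (D + 1) * (D + 1))).
  by apply: ler_pM => //; [rewrite subr_ge0 ltW|rewrite lerDl].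
by rewrite divfK// gt_eqF// ltr_pwDr.
Unshelve. all: by end_near. Qed.

(** The two limits are never exchanged. The lower half of [top_bounds], with u -> 1 at fixed M,
    bounds the partial sums by S; its upper half, with M -> oo at fixed u, bounds the integral at u
    by the limit of the partial sums, and then Abel's theorem lets u -> 1. *)
Theorem apery_word_sum w (S : R) : regular w -> (0 < size w)%N ->
  series (topword w) @ \oo --> S ->
  (fun M => \sum_(0 <= j < M) xword w (2 * j + 1 + ~~ parity w) *
     (bcoefR j / (2 * j + 1)%:R)) @ \oo --> S.
Proof.
move=> rw wn cS.
have [C hC] := top_bounds rw wn.
have L := abel_limit cS.
pose B M := sinsum w M 1.
have -> : (fun M => \sum_(0 <= j < M) xword w (2 * j + 1 + ~~ parity w) *
     (bcoefR j / (2 * j + 1)%:R)) = B.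
  by apply/funext => M; apply: eq_bigr => j _; rewrite sinint_at1.
have BS M : B M <= S.
  have cont : sinsum w M u @[u --> 1^'-] --> B M.
    apply: cvg_at_left_filter.
    have [/derivable1_diffP /differentiable_continuous + _] := is_derive_sinsum w M 1.
    exact.
  apply: ler_cvg_to cont L _; near=> u.
  have u1 : u < 1 by near: u; exact: nbhs_left_lt.
  have u0 : 0 <= u by near: u; exact: nbhs_left_ge.
  have /(_ M u) := hC; rewrite u0 u1 => /(_ isT)/andP[+ _].
  by rewrite subr_ge0.
have Bnd : nondecreasing_seq B.
  apply/nondecreasing_seqP => M; rewrite /B /sinsum big_nat_recr//= lerDl.
  by rewrite mulr_ge0 ?xword_ge0// sinint_at1 divr_ge0// ltW// bcoefR_gt0.
have Bc : cvgn B.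
  by apply: nondecreasing_is_cvgn => //; exists S => _ [M _ <-].
have BT M : B M <= limn B by exact: nondecreasing_cvgn_le.
suff -> : S = limn B by [].
apply/eqP; rewrite eq_le; apply/andP; split; last first.
  by apply: (cvgn_le Bc).
apply: (cvgr_to_le L); near=> u.
have u1 : u < 1 by near: u; exact: nbhs_left_lt.
have u0 : 0 <= u by near: u; exact: nbhs_left_ge.
have u01 : 0 <= u < 1 by rewrite u0.
have /andP[x0 x1] := xu_lt1 u01.
(* At fixed u < 1 the error is geometric in M, since 0 <= [xu u] < 1. *)
have G : (fun M => limn B + C * (xu u ^+ (2 * M) / (1 - xu u))) @ \oo --> limn B + C * (0 / (1 - xu u)).
  apply: cvgD; first exact: cvg_cst.
  apply: cvgMr; apply: cvgMl.
  rewrite [X in X @ _](_ : _ = fun M => (xu u ^+ 2) ^+ M); last first.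
    by apply/funext => M; rewrite exprM.
  by apply: cvg_expr; rewrite ger0_norm ?exprn_ge0// exprn_ilt1.
rewrite mul0r mulr0 addr0 in G.
apply: (cvgr_to_ge G); near=> M.
have /andP[_] := hC M u u01; rewrite lerBlDr => /le_trans; apply.
rewrite addrC lerD2r; apply: le_trans (BT M).
apply: ler_sum => j _; rewrite ler_wpM2l ?xword_ge0// sinint_le1//.
by rewrite u0 ltW.
Unshelve. all: by end_near. Qed.

End Words.

(** * Limits of complex series *)

Section ComplexLimits.
Variable R : realType.
Implicit Types (u v : nat -> R[i]) (l z : R[i]) (e : R).

Local Notation nrm := (@Normc.normc R).

Definition ccvg u l : Prop := (u : nat -> R[i]^o) @ \oo --> (l : R[i]^o).

Lemma ReB z1 z2 : complex.Re (z1 - z2) = complex.Re z1 - complex.Re z2.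
Proof. by case: z1 z2 => ? ? [? ?]. Qed.

Lemma ImB z1 z2 : complex.Im (z1 - z2) = complex.Im z1 - complex.Im z2.
Proof. by case: z1 z2 => ? ? [? ?]. Qed.

Lemma Re_sum (I : Type) (r : seq I) (P : pred I) (F : I -> R[i]) :
  complex.Re (\sum_(i <- r | P i) F i) = \sum_(i <- r | P i) complex.Re (F i).
Proof. by apply: (big_morph (@complex.Re R)) => // -[? ?] [? ?]. Qed.

Lemma Im_sum (I : Type) (r : seq I) (P : pred I) (F : I -> R[i]) :
  complex.Im (\sum_(i <- r | P i) F i) = \sum_(i <- r | P i) complex.Im (F i).
Proof. by apply: (big_morph (@complex.Im R)) => // -[? ?] [? ?]. Qed.

Lemma nrm_ge0 z : 0 <= nrm z.
Proof. by rewrite -(@lecR R) -[(nrm z)%:C%C]/(`|z|) normr_ge0. Qed.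

Lemma nrmD z1 z2 : nrm (z1 + z2) <= nrm z1 + nrm z2.
Proof. exact: le_normcD. Qed.

Lemma nrmN z : nrm (- z) = nrm z.
Proof. exact: normcN. Qed.

Lemma nrmM z1 z2 : nrm (z1 * z2) = nrm z1 * nrm z2.
Proof. exact: Normc.normcM. Qed.

Lemma nrmV z : nrm z^-1 = (nrm z)^-1.
Proof. exact: Normc.normcV. Qed.

Lemma nrm1 : nrm 1 = 1. Proof. exact: Normc.normc1. Qed.
Lemma nrm0 : nrm 0 = 0. Proof. exact: Normc.normc0. Qed.

Lemma nrmX z n : nrm (z ^+ n) = nrm z ^+ n.
Proof. by elim: n => [|n IH]; rewrite ?nrm1// !exprS nrmM IH. Qed.

Lemma nrm_real (x : R) : nrm x%:C%C = `|x|.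
Proof. by rewrite /= expr0n addr0 sqrtr_sqr. Qed.

Lemma nrm_nat n : nrm n%:R = n%:R.
Proof. by rewrite -[n%:R](rmorph_nat (real_complex R)) nrm_real normr_nat. Qed.

Lemma nrm_sum (I : Type) (r : seq I) (P : pred I) (F : I -> R[i]) :
  nrm (\sum_(i <- r | P i) F i) <= \sum_(i <- r | P i) nrm (F i).
Proof.
elim/big_rec2: _ => [|i y1 y2 _ IH]; first by rewrite nrm0.
by apply: le_trans (nrmD _ _) _; rewrite lerD2l.
Qed.

Lemma nrm_root4 z : z ^+ 4 = 1 -> nrm z = 1.
Proof.
move=> /(congr1 nrm); rewrite nrmX nrm1 => /eqP.
by rewrite pexpr_eq1// ?nrm_ge0// => /eqP.
Qed.

Lemma abs_Re_le z : `|complex.Re z| <= nrm z.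
Proof.
case: z => a b /=; rewrite -sqrtr_sqr ler_sqrt ?addr_ge0 ?sqr_ge0//.
by rewrite lerDl sqr_ge0.
Qed.

Lemma abs_Im_le z : `|complex.Im z| <= nrm z.
Proof.
case: z => a b /=; rewrite -sqrtr_sqr ler_sqrt ?addr_ge0 ?sqr_ge0//.
by rewrite lerDr sqr_ge0.
Qed.

Lemma nrm_le_ReIm z : nrm z <= `|complex.Re z| + `|complex.Im z|.
Proof.
rewrite {1}[z]complexE; apply: le_trans (nrmD _ _) _.
rewrite nrmM !nrm_real; have -> : nrm 'i%C = 1.
  by rewrite /= expr0n expr1n add0r sqrtr1.
by rewrite mul1r.
Qed.

Lemma ccvgP u l : ccvg u l <->
  forall e, 0 < e -> \forall n \near \oo, nrm (l - u n) <= e.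
Proof.
rewrite /ccvg; split.
  move=> /cvgrPdist_le H e e0.
  have e0' : 0 < e%:C%C by rewrite (@ltcR R 0 e).
  by apply: filterS (H _ e0') => n; rewrite -(@lecR R).
move=> H; apply/cvgrPdist_le => e e0.
have eR : e = (complex.Re e)%:C%C by rewrite RRe_real// gtr0_real.
have {}e0 : 0 < complex.Re e by rewrite -(@ltcR R) -eR.
by apply: filterS (H _ e0) => n; rewrite -(@lecR R) -eR.
Qed.

Lemma ccvg_ReIm u l : (fun n => complex.Re (u n)) @ \oo --> complex.Re l ->
  (fun n => complex.Im (u n)) @ \oo --> complex.Im l -> ccvg u l.
Proof.
move=> /cvgrPdist_le hr /cvgrPdist_le hi; apply/ccvgP => e e0.
have e2 : 0 < e / 2 by rewrite divr_gt0.
near=> n.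
apply: le_trans (nrm_le_ReIm _) _; rewrite [e]splitr; apply: lerD.
  rewrite ReB; near: n; exact: hr.
rewrite ImB; near: n; exact: hi.
Unshelve. all: by end_near. Qed.

Lemma ccvg_Re u l : ccvg u l -> (fun n => complex.Re (u n)) @ \oo --> complex.Re l.
Proof.
move=> /ccvgP h; apply/cvgrPdist_le => e e0; apply: filterS (h e e0) => n.
by apply: le_trans; rewrite -ReB; exact: abs_Re_le.
Qed.

Lemma ccvg_Im u l : ccvg u l -> (fun n => complex.Im (u n)) @ \oo --> complex.Im l.
Proof.
move=> /ccvgP h; apply/cvgrPdist_le => e e0; apply: filterS (h e e0) => n.
by apply: le_trans; rewrite -ImB; exact: abs_Im_le.
Qed.

Lemma ccvg_real (u : nat -> R) (l : R) : u @ \oo --> l ->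
  ccvg (fun n => (u n)%:C%C) l%:C%C.
Proof. by move=> ul; apply: ccvg_ReIm => //=; exact: cvg_cst. Qed.

Lemma ccvg_real_inv (u : nat -> R) l : ccvg (fun n => (u n)%:C%C) l ->
  u @ \oo --> complex.Re l /\ l = (complex.Re l)%:C%C.
Proof.
move=> ul; split; first exact: (ccvg_Re ul).
have := ccvg_Im ul => /= /(cvg_lim (@Rhausdorff R)).
have -> : limn (fun=> 0 : R) = 0 by apply: cvg_lim => //; exact: cvg_cst.
by case: l ul => a b _ /= <-.
Qed.

Lemma eq_ccvg u v l : (forall n, u n = v n) -> ccvg u l -> ccvg v l.
Proof. by move=> uv; have -> : u = v by apply/funext. Qed.

Lemma ccvg_lin (q : R[i]) u v l m : ccvg u l -> ccvg v m ->
  ccvg (fun n => q * u n + v n) (q * l + m).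
Proof.
move=> ul vm; apply: (@cvgD _ R[i]^o); last exact: vm.
by apply: cvgMr; exact: ul.
Qed.

Lemma ccvg_cst l : ccvg (fun=> l) l.
Proof. exact: cvg_cst. Qed.

Lemma ccvg_shiftS u l : ccvg (fun n => u n.+1) l <-> ccvg u l.
Proof. by rewrite /ccvg -(@cvg_shiftS R[i]^o u). Qed.

Lemma cseries_dom (a : nat -> R[i]) (v : nat -> R) :
  (forall n, nrm (a n) <= v n) -> cvgn (series v) ->
  exists l, ccvg (series a) l.
Proof.
move=> av cv.
have v0 n : 0 <= v n := le_trans (nrm_ge0 _) (av n).
have cR : cvgn (series (fun n => complex.Re (a n))).
  apply: normed_cvg; apply: series_le_cvg cv => // n.
    exact: normr_ge0.
  exact: le_trans (abs_Re_le _) (av n).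
have cI : cvgn (series (fun n => complex.Im (a n))).
  apply: normed_cvg; apply: series_le_cvg cv => // n.
    exact: normr_ge0.
  exact: le_trans (abs_Im_le _) (av n).
exists (Complex (limn (series (fun n => complex.Re (a n)))) (limn (series (fun n => complex.Im (a n))))).
apply: ccvg_ReIm.
  rewrite (_ : (fun n => _) = series (fun n => complex.Re (a n)))//.
  by apply/funext => n; rewrite /series /= Re_sum.
rewrite (_ : (fun n => _) = series (fun n => complex.Im (a n)))//.
by apply/funext => n; rewrite /series /= Im_sum.
Qed.

(** * The scale of powers of n^(1/4), and Dirichlet's test *)

Definition root4 (n : nat) : R := Num.sqrt (Num.sqrt n%:R).

Lemma root4_ge0 n : 0 <= root4 n. Proof. exact: sqrtr_ge0. Qed.

Lemma root4X n : root4 n ^+ 4 = n%:R.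
Proof.
rewrite /root4 (_ : 4 = 2 * 2)%N// exprM !sqr_sqrtr//; exact: sqrtr_ge0.
Qed.

Lemma root4_gt0 n : 0 < root4 n.+1.
Proof. by rewrite /root4 !sqrtr_gt0. Qed.

Lemma root4_0 : root4 0 = 0. Proof. by rewrite /root4 !sqrtr0. Qed.

Lemma root4_1 : root4 1 = 1. Proof. by rewrite /root4 !sqrtr1. Qed.

Lemma root4_le m n : (m <= n)%N -> root4 m <= root4 n.
Proof. by move=> mn; rewrite /root4 !ler_sqrt// ?ler_nat. Qed.

(** The fourth powers differ by 1, and q^4 - p^4 is (q - p) times four monomials, each at most
    q^3. *)
Lemma root4_step n : 1 / root4 n.+1 ^+ 3 <= 4 * (root4 n.+1 - root4 n).
Proof.
have h0 := root4_gt0 n; have h1 := root4_ge0 n; have h2 := root4_le (leqnSn n).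
have : root4 n.+1 ^+ 4 - root4 n ^+ 4 = 1.
  by rewrite !root4X -natr1; ring.
move: h0 h1 h2; move: (root4 n) (root4 n.+1) => p q q0 p0 pq E.
rewrite ler_pdivrMr ?exprn_gt0// -[leLHS]E.
have -> : q ^+ 4 - p ^+ 4 = (q - p) * (q ^+ 3 + q ^+ 2 * p + q * p ^+ 2 + p ^+ 3) by ring.
rewrite (_ : 4 * (q - p) * q ^+ 3 = (q - p) * (4 * q ^+ 3)); last by ring.
rewrite ler_wpM2l ?subr_ge0//.
have a1 : q ^+ 2 * p <= q ^+ 3.
  by rewrite [q ^+ 3](exprSr q 2) ler_wpM2l// exprn_ge0// ltW.
have a2 : q * p ^+ 2 <= q ^+ 3.
  by rewrite [q ^+ 3](exprS q 2) ler_wpM2l ?(ltW q0)// lerXn2r// ?nnegrE ltW.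
have a3 : p ^+ 3 <= q ^+ 3 by rewrite lerXn2r// ?nnegrE ltW.
by move: a1 a2 a3; lra.
Qed.

Lemma sum_root4 m : \sum_(0 <= k < m) 1 / root4 k.+1 ^+ 3 <= 4 * root4 m.
Proof.
elim: m => [|m IH]; first by rewrite big_nil mulr_ge0// root4_ge0.
rewrite big_nat_recr//=; have := root4_step m; move: IH; lra.
Qed.

(** The sum of n^(-5/4) telescopes: with x^4 = n and y^4 = n+1, 1/y^5 <= 4/x - 4/y. The bound 5 is
    the first term plus 4. *)
Lemma cvg_root4_5 : cvgn (series (fun k => 1 / root4 k.+1 ^+ 5)).
Proof.
have p k := root4_gt0 k.
apply: nondecreasing_is_cvgn.
  apply/nondecreasing_seqP => n; rewrite /series /= big_nat_recr//= lerDl.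
  by rewrite divr_ge0// exprn_ge0// ltW.
exists 5 => _ [n _ <-].
case: n => [|n]; first by rewrite /series /= big_nil.
suff : series (fun k => 1 / root4 k.+1 ^+ 5) n.+1 <= 5 - 4 / root4 n.+1.
  by move/le_trans; apply; rewrite gerBl divr_ge0// ltW.
elim: n => [|n IH].
  by rewrite /series /= big_nat1 root4_1 expr1n; lra.
rewrite /series /= big_nat_recr//=; apply: le_trans (lerD IH (lexx _)) _.
have h1 := root4_step n.+1; have h2 := root4_le (leqnSn n.+1).
move: (p n) (p n.+1) h1 h2; move: (root4 n.+1) (root4 n.+2) => x y x0 y0 h1 h2.
suff : 1 / y ^+ 5 <= 4 / x - 4 / y by lra.
have -> : 4 / x - 4 / y = 4 * (y - x) / (x * y).
  by field; rewrite !gt_eqF.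
apply: le_trans (_ : (1 / y ^+ 3) / (x * y) <= _); last first.
  by rewrite ler_wpM2r// invr_ge0 mulr_ge0// ltW.
rewrite -mulrA -invfM !mul1r lef_pV2 ?posrE ?mulr_gt0 ?exprn_gt0//.
rewrite [y ^+ 5](_ : _ = y ^+ 3 * (y * y)); last by ring.
by rewrite ler_wpM2l ?exprn_ge0 ?(ltW y0)// ler_wpM2r// ltW.
Qed.

Lemma root4_double n : (0 < n)%N -> root4 n.+1 <= 2 * root4 n.
Proof.
move=> n0; rewrite -(@ler_pXn2r _ 4)// ?nnegrE ?mulr_ge0 ?root4_ge0//.
by rewrite exprMn !root4X -natrX -natrM ler_nat; lia.
Qed.

(* z^m = (z^(m+1) - z^m) / (z - 1), and summation by parts. *)
Lemma cseries_dirichlet (z : R[i]) (g : nat -> R[i]) (v : nat -> R) :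
  z ^+ 4 = 1 -> z != 1 ->
  ccvg g 0 -> (forall n, nrm (g n.+1 - g n) <= v n) -> cvgn (series v) ->
  exists l, ccvg (series (fun m => z ^+ m * g m)) l.
Proof.
move=> z4 z1 g0 gv cv.
have nz : nrm z = 1 := nrm_root4 z4.
have [L hL] : exists l, ccvg (series (fun m => z ^+ m.+1 * (g m.+1 - g m))) l.
  by apply: (cseries_dom _ cv) => n; rewrite nrmM nrmX nz expr1n mul1r.
pose r := (z - 1)^-1.
have zr : (z - 1) * r = 1 by rewrite divff// subr_eq0.
exists (- r * L + (r * 0 + - r * g 0%N)).
have E n : series (fun m => z ^+ m * g m) n =
   - r * series (fun m => z ^+ m.+1 * (g m.+1 - g m)) n +
   (r * (z ^+ n * g n) + - r * g 0%N).
  elim: n => [|n IH].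
    by rewrite /series /= !big_nil expr0; ring.
  move: IH; rewrite /series /= !big_nat_recr//= => ->.
  rewrite exprS.
  move: (\sum_(0 <= k < n) _) (z ^+ n) (g n) (g n.+1) (g 0%N) => A B C D E.
  transitivity (- r * A + (r * (B * C) + - r * E) + ((z - 1) * r) * (B * C)).
    by rewrite zr mul1r.
  by ring.
apply: (eq_ccvg (fun n => esym (E n))).
have G0 : ccvg (fun n => z ^+ n * g n) 0.
  apply/ccvgP => e e0; move/ccvgP: g0 => /(_ e e0); apply: filterS => n.
  by rewrite !sub0r !nrmN nrmM nrmX nz expr1n mul1r.
have H1 := @ccvg_lin r _ _ _ _ G0 (@ccvg_cst (- r * g 0%N)).
have H2 := @ccvg_lin (- r) _ _ _ _ hL H1.
exact: H2.
Qed.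

End ComplexLimits.

(** * Rational spans and nested sums *)

Section RationalSpans.
Variable K : numFieldType.
Implicit Types (P : (nat -> K) -> Prop) (f g c : nat -> K).

(** Inductive rather than given by a finite list, so that a property stable under rational
    combinations is proved one generator at a time. *)
Inductive qspan P : (nat -> K) -> Prop :=
  | qspan_nil c of (forall n, c n = 0) : qspan P c
  | qspan_cons q f g c of P f & qspan P g & (forall n, c n = ratr q * f n + g n) :
      qspan P c.

Lemma qspan_ext P c c' : (forall n, c n = c' n) -> qspan P c -> qspan P c'.
Proof. by move=> cc'; have -> : c = c' by apply/funext. Qed.

Lemma qspan_lin P q c c' : qspan P c -> qspan P c' ->
  qspan P (fun n => ratr q * c n + c' n).
Proof.
move=> Pc Pc'; elim: {c} Pc => [c c0|q' f g c Pf _ IH hc].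
  by apply: qspan_ext Pc' => n; rewrite c0 mulr0 add0r.
apply: (qspan_cons (q := q * q') Pf IH) => n.
by rewrite hc mulrDr rmorphM mulrA addrA.
Qed.

Lemma qspan_gen P f : P f -> qspan P f.
Proof.
move=> Pf; apply: (qspan_cons (q := 1) Pf (qspan_nil _ (fun=> erefl))) => n.
by rewrite rmorph1 mul1r addr0.
Qed.

Lemma qspanD P c c' : qspan P c -> qspan P c' -> qspan P (fun n => c n + c' n).
Proof.
move=> Pc Pc'; apply: qspan_ext (qspan_lin 1 Pc Pc') => n.
by rewrite rmorph1 mul1r.
Qed.

Lemma qspanB P c c' : qspan P c -> qspan P c' -> qspan P (fun n => c n - c' n).
Proof.
move=> Pc Pc'; apply: qspan_ext (qspan_lin (-1) Pc' Pc) => n.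
by rewrite rmorphN1 mulN1r addrC.
Qed.

Lemma qspan_map P P' (T : (nat -> K) -> nat -> K) :
  (forall q f g n, T (fun k => ratr q * f k + g k) n = ratr q * T f n + T g n) ->
  (forall f, P f -> qspan P' (T f)) -> forall c, qspan P c -> qspan P' (T c).
Proof.
move=> Tl PT c; elim=> {c} [c c0|q f g c Pf _ IH hc].
  apply: qspan_nil => n.
  have -> : c = fun=> 0 by apply/funext.
  have := Tl (-1) (fun=> 0) (fun=> 0) n.
  rewrite (_ : (fun k => _) = fun=> 0); last by apply/funext => k; rewrite mulr0 addr0.
  by rewrite rmorphN1 mulN1r addNr.
apply: qspan_ext (qspan_lin q (PT _ Pf) IH) => n; rewrite -Tl.
by congr (T _ n); apply/funext.
Qed.

Lemma qspan_sub P P' : (forall f, P f -> qspan P' f) ->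
  forall c, qspan P c -> qspan P' c.
Proof. exact: (@qspan_map P P' id). Qed.

End RationalSpans.

Section NestedSums.
Variable K : numFieldType.

(* Coefficients of [eta x / (1 - eta x)]. *)
Definition geomcoef (eta : K) (n : nat) : K := if n is 0 then 0 else eta ^+ n.

Definition dcoef (o : option K) : nat -> K :=
  if o is Some eta then geomcoef eta else delta0.

Definition dword (w : seq (option K)) : nat -> K :=
  foldr (fun o => iform (dcoef o)) delta0 w.

(** The part of the multiple polylogarithm sum with largest index m. The bottom [delta0] says that
    the index after the last one is 0. *)
Fixpoint nestz (l : seq (nat * K)) : nat -> K :=
  if l is (a, z) :: l' then
    fun m => z ^+ m / m%:R ^+ a * \sum_(0 <= k < m) nestz l' k
  else delta0.

Lemma nestz_cons0 x l : nestz (x :: l) 0 = 0.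
Proof. by case: x => a z /=; rewrite big_nil mulr0. Qed.

Lemma iform_delta_nestz a z l m :
  iform delta0 (nestz ((a, z) :: l)) m = nestz ((a.+1, z) :: l) m.
Proof.
rewrite /iform conv_delta0 /= exprS; case: m => [|m].
  by rewrite !big_nil !mulr0.
by rewrite mulrA; congr (_ * _); rewrite invfM; ring.
Qed.

Lemma iform_geom_delta eta m : iform (geomcoef eta) delta0 m = nestz [:: (1%N, eta)] m.
Proof.
case: m => [|m]; first by rewrite iform0 nestz_cons0.
rewrite /iform /conv big_ord_recl /= subn0 big1 ?addr0; last first.
  by move=> i _; rewrite mulr0.
rewrite big_nat_recl//= big1 ?addr0; last by move=> i _; rewrite /delta0.
by rewrite /delta0 /= !mulr1 mulrC expr1.
Qed.

(** Writing eta^(m-k) as eta^m / eta^k sends the numerator to a new entry of exponent 1 and the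
    denominator to the next root of unity. With [iform_delta_nestz], which raises the first
    exponent, this is the dictionary from iterated integrals to nested sums. *)
Lemma iform_geom_nestz eta a z l m : eta != 0 ->
  iform (geomcoef eta) (nestz ((a, z) :: l)) m =
  nestz ((1%N, eta) :: (a, z / eta) :: l) m.
Proof.
move=> e0; case: m => [|m]; first by rewrite iform0 nestz_cons0.
rewrite /iform /conv big_ord_recr /= subnn /= mul0r addr0.
rewrite expr1 [eta ^+ _ / _]mulrC -mulrA; congr (_ * _).
rewrite mulr_sumr big_mkord; apply: eq_bigr => i _ /=.
have -> : geomcoef eta (m.+1 - i) = eta ^+ m.+1 / eta ^+ i.
  have im : (i <= m.+1)%N := ltnW (ltn_ord i).
  have -> : geomcoef eta (m.+1 - i) = eta ^+ (m.+1 - i).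
    by have := ltn_ord i; rewrite -subn_gt0; case: (m.+1 - i)%N.
  rewrite (_ : eta ^+ m.+1 = eta ^+ (m.+1 - i) * eta ^+ i).
    by rewrite mulfK// expf_neq0.
  by rewrite -exprD subnK.
by rewrite expr_div_n; ring.
Qed.

Definition roots4 (l : seq (nat * K)) : Prop :=
  forall x, x \in l -> (0 < x.1)%N /\ x.2 ^+ 4 = 1.

Definition letter4 (o : option K) : Prop :=
  if o is Some eta then eta ^+ 4 = 1 else True.

Lemma root4_neq0 (z : K) : z ^+ 4 = 1 -> z != 0.
Proof. by move=> h; apply/eqP => z0; move/eqP: h; rewrite z0 expr0n /= eq_sym oner_eq0. Qed.

(** A word whose innermost form is du/u gives 0, because [iform] drops the constant term; any other
    word is one nested sum of weight its length. An outermost du/u raises the first exponent above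
    1, so a divergent head (1, 1) can come only from the outermost letter [Some 1]. *)
Lemma dword_nestz o w : (forall x, x \in o :: w -> letter4 x) ->
  (forall m, dword (o :: w) m = 0) \/
  exists a z l, [/\ roots4 ((a, z) :: l), (\sum_(x <- (a, z) :: l) x.1 = (size w).+1)%N,
    forall m, dword (o :: w) m = nestz ((a, z) :: l) m &
    o <> Some 1 -> (a, z) <> (1%N, 1)].
Proof.
elim: w o => [|o' w IH] o ho.
  case: o ho => [eta|] ho; last first.
    left => m /=; rewrite /iform conv_delta0; case: m => [|m].
      by rewrite invr0 mul0r.
    by rewrite mulr0.
  right; exists 1%N, eta, [::]; split.
  - by move=> x; rewrite inE => /eqP -> /=; split => //; exact: (ho (Some eta) (mem_head _ _)).
  - by rewrite big_seq1.
  - by move=> m; exact: iform_geom_delta.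
  - by move=> h [e]; apply: h; rewrite e.
have [|z0|[a [z [l [hl hs hw _]]]]] := IH o'.
- by move=> x wordseq; apply: ho; rewrite inE wordseq orbT.
- left => m; rewrite [LHS](_ : _ = iform (dcoef o) (dword (o' :: w)) m)//.
  by rewrite /iform /conv big1 ?mulr0// => i _; rewrite z0 mulr0.
right; case: o ho => [eta|] ho.
  have e4 : eta ^+ 4 = 1 := ho (Some eta) (mem_head _ _).
  exists 1%N, eta, ((a, z / eta) :: l); split.
  - move=> x; rewrite !inE => /orP[/eqP ->//|/orP[/eqP ->|xl]].
      have [a0 z4] := hl _ (mem_head _ _); split => //=.
      by rewrite expr_div_n e4 divr1.
    by apply: hl; rewrite inE xl orbT.
  - by rewrite !big_cons /= in hs *; rewrite hs add1n.
  - move=> m; rewrite -iform_geom_nestz ?root4_neq0//=.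
    by apply: eq_iform => // n; rewrite -hw.
  - by move=> h [e]; apply: h; rewrite e.
exists a.+1, z, l; split.
- move=> x; rewrite inE => /orP[/eqP ->|xl].
    by have [a0 z4] := hl _ (mem_head _ _); split.
  by apply: hl; rewrite inE xl orbT.
- by rewrite !big_cons /= in hs *; rewrite addSn hs.
- move=> m; rewrite -iform_delta_nestz /=.
  by apply: eq_iform => // n; rewrite -hw.
- by have [a0 _] := hl _ (mem_head _ _); move=> _ [e]; move: a0; rewrite e.
Qed.

End NestedSums.

(** * Sums over index chains as nested sums in one variable *)

Section ChainSums.
Variable K : numFieldType.

(** Summed from the outermost index inwards: a weak relation extends the range by the term k = n,
    and the chain ends at index 0, hence [delta0]. *)
Fixpoint nest (d : nat) : ('I_d -> bool) -> ('I_d -> nat -> K) -> nat -> K :=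
  if d is d'.+1 return ('I_d -> bool) -> ('I_d -> nat -> K) -> nat -> K then
    fun w phi n => phi ord0 n *
      \sum_(0 <= k < n + w ord0) nest (fun j => w (lift ord0 j)) (fun j => phi (lift ord0 j)) k
  else fun _ _ => delta0.

Definition head_index d : ('I_d -> nat) -> nat :=
  if d is d'.+1 return ('I_d -> nat) -> nat then fun n => n ord0 else fun=> 0%N.

Lemma next_index0 d (n : 'I_d.+1 -> nat) :
  next_index n ord0 = head_index (fun j => n (lift ord0 j)).
Proof.
rewrite /next_index; case: d n => [|d] n /=.
  by case: insubP => // k; rewrite ltnn.
case: insubP => [k _ hk|]; last by rewrite ltnS.
by congr n; apply: val_inj; rewrite /= hk.
Qed.

Lemma next_index_lift d (n : 'I_d.+1 -> nat) (j : 'I_d) :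
  next_index n (lift ord0 j) = next_index (fun j => n (lift ord0 j)) j.
Proof.
rewrite /next_index /= /bump /= add1n.
case: insubP => [k|]; case: insubP => [k'|] //=.
- move=> _ hk' _ hk; congr n; apply: val_inj; rewrite /= hk /bump /= hk'.
  by [].
- by move=> /negP h h' hk; case: h; rewrite -ltnS.
- by move=> h _ /negP; rewrite ltnS h.
Qed.

Lemma chain_split d (w : 'I_d.+1 -> bool) (n : 'I_d.+1 -> nat) :
  chain w n = (head_index (fun j => n (lift ord0 j)) < n ord0 + w ord0)%N &&
     chain (fun j => w (lift ord0 j)) (fun j => n (lift ord0 j)).
Proof.
rewrite /chain; apply/forallP/andP => [h|[h0 /forallP h] j].
  split.
    have := h ord0; rewrite next_index0; case: (w ord0).
      by rewrite addn1 ltnS.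
    by rewrite addn0.
  apply/forallP => j; have := h (lift ord0 j); by rewrite next_index_lift.
case: (unliftP ord0 j) => [k ->|->]; first by rewrite next_index_lift; exact: h.
rewrite next_index0; move: h0; case: (w ord0); first by rewrite addn1 ltnS.
by rewrite addn0.
Qed.

Definition ffcons d (N : nat) (x : 'I_N) (f : {ffun 'I_d -> 'I_N}) : {ffun 'I_d.+1 -> 'I_N} :=
  [ffun j => if unlift ord0 j is Some k then f k else x].

Lemma sum_ffcons d N (F : {ffun 'I_d.+1 -> 'I_N} -> K) :
  \sum_(n : {ffun 'I_d.+1 -> 'I_N}) F n =
  \sum_(x : 'I_N) \sum_(f : {ffun 'I_d -> 'I_N}) F (ffcons x f).
Proof.
rewrite pair_bigA /=.
pose h (n : {ffun 'I_d.+1 -> 'I_N}) := (n ord0, [ffun j => n (lift ord0 j)]).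
rewrite (reindex (fun p => ffcons p.1 p.2))//=.
exists h => [[x f] _|n _]; rewrite /h /ffcons /=.
  congr pair; first by rewrite ffunE unlift_none.
  by apply/ffunP => j; rewrite !ffunE liftK.
apply/ffunP => j; rewrite !ffunE.
by case: (unliftP ord0 j) => [k ->|->]; rewrite ?ffunE.
Qed.

(** The condition [P] on the head index is what the induction carries: fixing the outer index leaves
    a chain whose head is constrained by it. *)
Lemma sum_chain d N (w : 'I_d -> bool) (phi : 'I_d -> nat -> K) (P : pred nat) :
  (0 < N)%N ->
  \sum_(n : {ffun 'I_d -> 'I_N} | chain w (fun j => n j : nat) && P (head_index (fun j => n j : nat)))
     \prod_(j < d) phi j (n j) =
  \sum_(0 <= k < N | P k) nest w phi k.
Proof.
move=> N0; elim: d w phi P => [|d IH] w phi P.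
  rewrite (eq_bigl (fun=> P 0%N)); last first.
    by move=> n; rewrite /chain (_ : [forall j, _] = true)//; apply/forallP; case.
  rewrite big_mkcond /= (eq_bigr (fun=> (P 0%N)%:R)); last first.
    by move=> n _; rewrite big_ord0; case: (P _).
  rewrite sumr_const card_ffun !card_ord expn0 mulr1n.
  case: N N0 => // N _; rewrite big_mkcond big_nat_recl//= big1 ?addr0; last first.
    by move=> i _; rewrite /delta0 /=; case: (P _).
  by case: (P _).
rewrite big_mkcond sum_ffcons [RHS]big_mkcond big_mkord; apply: eq_bigr => x _.
have E (f : {ffun 'I_d -> 'I_N}) : (fun j => (ffcons x f (lift ord0 j) : nat)) = (fun j => (f j : nat)).
  by apply/funext => j; rewrite ffunE liftK.
have E0 (f : {ffun 'I_d -> 'I_N}) : ffcons x f ord0 = x.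
  by rewrite ffunE unlift_none.
have hE (f : {ffun 'I_d -> 'I_N}) : head_index (fun j : 'I_d.+1 => ffcons x f j : nat) = x.
  by rewrite /= E0.
case Px: (P x); last first.
  by rewrite big1// => f _; rewrite hE Px andbF.
rewrite -big_mkcond /= (eq_bigl (fun f : {ffun 'I_d -> 'I_N} =>
   chain (fun j => w (lift ord0 j)) (fun j => f j : nat) &&
   (head_index (fun j => f j : nat) < x + w ord0)%N)); last first.
  by move=> f; rewrite E0 Px andbT chain_split E E0 andbC.
rewrite (eq_bigr (fun f : {ffun 'I_d -> 'I_N} => phi ord0 x * \prod_(j < d) phi (lift ord0 j) (f j))); last first.
  move=> f _; rewrite big_ord_recl E0; congr (_ * _).
  by apply: eq_bigr => j _; rewrite ffunE liftK.
rewrite -mulr_sumr; congr (_ * _).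
rewrite (IH _ (fun j => phi (lift ord0 j)) (fun k => (k < x + w ord0)%N)).
have le : (x + w ord0 <= N)%N by have := ltn_ord x; case: (w ord0); lia.
rewrite [RHS](big_nat_widen _ _ N)//=.
Qed.

Lemma nestz_nest (l : seq (nat * K)) m :
  nestz l m = nest (fun=> false)
    (fun (j : 'I_(size l)) n => let x := nth (0%N, 0) l j in x.2 ^+ n / n%:R ^+ x.1) m.
Proof.
elim: l m => [|[a z] l IH] m //=.
rewrite addn0; congr (_ * _); apply: eq_bigr => k _; rewrite IH.
by congr (nest _ _ _).
Qed.

End ChainSums.

(** * Iterated integrals at u = 1 as colored multiple zeta values *)

Section CMZVSums.
Variable R : realType.
Local Notation C := R[i].
Local Notation nrm := (@Normc.normc R).

(* The exponent 3/4 makes this decay rate stable under [iform]. *)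
Definition quarter_bound (c : nat -> C) (B : R) : Prop :=
  forall n, nrm (c n) <= B / root4 R n.+1 ^+ 3.

Lemma quarter_bound_sum c B m : quarter_bound c B ->
  nrm (\sum_(0 <= k < m) c k) <= 4 * B * root4 R m.
Proof.
move=> h; apply: le_trans (nrm_sum _ _ _) _.
apply: (@le_trans _ _ (\sum_(0 <= k < m) B * (1 / root4 R k.+1 ^+ 3))).
  by apply: ler_sum => k _; rewrite mulrA mulr1.
rewrite -mulr_sumr [4 * B]mulrC -mulrA ler_wpM2l ?sum_root4//.
have := le_trans (nrm_ge0 _) (h 0%N); rewrite root4_1 expr1n divr1.
exact.
Qed.

Lemma quarter_bound_ge0 c B : quarter_bound c B -> 0 <= B.
Proof. by move=> h; have := le_trans (nrm_ge0 _) (h 0%N); rewrite root4_1 expr1n divr1. Qed.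

Lemma root4_inv3 m : root4 R m / m%:R <= 8 / root4 R m.+1 ^+ 3.
Proof.
case: m => [|m]; first by rewrite root4_0 mul0r divr_ge0// exprn_ge0// root4_ge0.
have p := root4_gt0 R m; have q := root4_gt0 R m.+1.
rewrite -{1}(root4X R m.+1) ler_pdivlMr ?exprn_gt0//.
have h := @root4_double R m.+1 isT.
move: p q h; move: (root4 R m.+1) (root4 R m.+2) => x y x0 y0 h.
rewrite mulrAC ler_pdivrMr ?exprn_gt0//.
have : y ^+ 3 <= (2 * x) ^+ 3 by rewrite lerXn2r// ?nnegrE ?mulr_ge0// ltW.
have -> : (2 * x) ^+ 3 = 8 * x ^+ 3 by ring.
move=> h3; rewrite [8 * _](_ : _ = x * (8 * x ^+ 3)); last by ring.
by rewrite ler_wpM2l// ltW.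
Qed.

(** 32 is 4 * 8: the 4 from summing k^(-3/4) up to m, the 8 = 2^3 from replacing m by m+1 in the
    decay. *)
Lemma quarter_bound_step (c g : nat -> C) B : quarter_bound c B ->
  (forall m, nrm (g m) <= nrm (\sum_(0 <= k < m) c k) / m%:R) ->
  quarter_bound g (32 * B).
Proof.
move=> h hg m; apply: le_trans (hg m) _.
have B0 := quarter_bound_ge0 h.
apply: (@le_trans _ _ (4 * B * root4 R m / m%:R)).
  by rewrite ler_wpM2r ?invr_ge0// quarter_bound_sum.
rewrite -mulrA (_ : 32 * B / _ = 4 * B * (8 / root4 R m.+1 ^+ 3)); last by ring.
by rewrite ler_wpM2l ?root4_inv3// mulr_ge0.
Qed.

Lemma quarter_bound_delta0 : quarter_bound delta0 1.
Proof.
case=> [|n]; rewrite /delta0; first by rewrite (@nrm1 R) root4_1 expr1n divr1.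
by rewrite (@nrm0 R) divr_ge0// exprn_ge0// root4_ge0.
Qed.

Lemma nestz_norm a z (l : seq (nat * C)) m : z ^+ 4 = 1 ->
  nrm (nestz ((a, z) :: l) m) = nrm (\sum_(0 <= k < m) nestz l k) / m%:R ^+ a.
Proof.
move=> z4 /=; rewrite !nrmM nrmX (nrm_root4 z4) expr1n mul1r nrmV nrmX nrm_nat.
by rewrite mulrC.
Qed.

Lemma nestz_bound (l : seq (nat * C)) : roots4 l -> exists B, quarter_bound (nestz l) B.
Proof.
elim: l => [|[a z] l IH] hl; first by exists 1; exact: quarter_bound_delta0.
have [|B hB] := IH; first by move=> x xl; apply: hl; rewrite inE xl orbT.
have [/= a0 z4] := hl _ (mem_head _ _).
exists (32 * B); apply: (quarter_bound_step hB) => m; rewrite nestz_norm//.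
case: m => [|m]; first by rewrite big_nil (@nrm0 R) !mul0r.
rewrite ler_wpM2l ?nrm_ge0// lef_pV2 ?posrE ?exprn_gt0 ?ltr0n//.
by rewrite -{1}[m.+1%:R]expr1 ler_weXn2l// ler1n.
Qed.

Lemma root4_quot5 m : root4 R m / (m%:R * m%:R) <= 32 / root4 R m.+1 ^+ 5.
Proof.
case: m => [|m]; first by rewrite root4_0 mul0r divr_ge0// exprn_ge0// root4_ge0.
have q := root4_gt0 R m.+1.
have q1 : 1 <= root4 R m.+1 by rewrite -{1}(root4_1 R) root4_le.
have h := @root4_double R m.+1 isT.
rewrite -{1 2}(root4X R m.+1).
move: q1 q h; move: (root4 R m.+1) (root4 R m.+2) => x y x1 y0 h.
have x0 : 0 < x by rewrite (lt_le_trans _ x1).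
rewrite (_ : x / (x ^+ 4 * x ^+ 4) = 1 / x ^+ 7); last by field; rewrite gt_eqF.
rewrite ler_pdivrMr ?exprn_gt0// mulrAC ler_pdivlMr ?exprn_gt0// mul1r.
have : y ^+ 5 <= (2 * x) ^+ 5 by rewrite lerXn2r// ?nnegrE ?mulr_ge0// ltW.
have -> : (2 * x) ^+ 5 = 32 * x ^+ 5 by ring.
move/le_trans; apply; rewrite ler_wpM2l// ler_weXn2l//.
Qed.

Lemma cvg_dom5 (B : R) : cvgn (series (fun k => B * (1 / root4 R k.+1 ^+ 5))).
Proof. by apply: is_cvg_seriesZ; exact: cvg_root4_5. Qed.

Lemma root4V_cvg : (fun n => (root4 R n.+1)^-1) @ \oo --> 0.
Proof.
have -> : (fun n => (root4 R n.+1)^-1) = (fun n => Num.sqrt (Num.sqrt (harmonic n))).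
  by apply/funext => n; rewrite /root4 /harmonic /= -!sqrtrV.
have c0 : Num.sqrt (Num.sqrt (0 : R)) = 0 by rewrite !sqrtr0.
rewrite -[X in _ --> X]c0; apply: (@continuous_cvg _ _ _ _ _ _ Num.sqrt).
  exact: sqrt_continuous.
apply: (@continuous_cvg _ _ _ _ _ _ Num.sqrt); first exact: sqrt_continuous.
exact: cvg_harmonic.
Qed.

Lemma root4_ge1 n : 1 <= root4 R n.+1.
Proof. by rewrite -{1}(root4_1 R) root4_le. Qed.

(** The inner sum is O(m^(1/4)). For a >= 2 the terms are O(m^(-7/4)), hence dominated by m^(-5/4);
    for a = 1 the root is not 1 and Dirichlet's test applies. *)
Lemma nestz_cvg a z (l : seq (nat * C)) : roots4 ((a, z) :: l) ->
  (a, z) <> (1%N, 1) -> exists v, ccvg (series (nestz ((a, z) :: l))) v.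
Proof.
move=> hl az1.
have [/= a0 z4] := hl _ (mem_head _ _).
have [|B hB] := @nestz_bound l; first by move=> x xl; apply: hl; rewrite inE xl orbT.
have B0 := quarter_bound_ge0 hB.
pose h m := \sum_(0 <= k < m) nestz l k.
have hh m : nrm (h m) <= 4 * B * root4 R m by exact: quarter_bound_sum.
have [a1|a1] := leqP 2 a.
  apply: (@cseries_dom _ _ (fun k => 4 * B * 32 * (1 / root4 R k.+1 ^+ 5)) _ (@cvg_dom5 _)) => m.
  rewrite nestz_norm//; case: m => [|m].
    rewrite big_nil (@nrm0 R) mul0r; apply: mulr_ge0; first by rewrite !mulr_ge0.
    by rewrite divr_ge0// exprn_ge0// root4_ge0.
  apply: (@le_trans _ _ (4 * B * root4 R m.+1 / (m.+1%:R * m.+1%:R))).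
    apply: ler_pM; rewrite ?nrm_ge0 ?invr_ge0 ?exprn_ge0//; first exact: hh.
    rewrite lef_pV2 ?posrE ?mulr_gt0 ?exprn_gt0 ?ltr0n// -expr2.
    by rewrite ler_weXn2l// ler1n.
  rewrite -mulrA -[leRHS]mulrA ler_wpM2l ?mulr_ge0// mulrA mulr1.
  exact: root4_quot5.
have {a0 a1} a1 : a = 1%N by lia.
subst a.
have z1 : z != 1 by apply/eqP => e; apply: az1; rewrite e.
have E m : nestz ((1%N, z) :: l) m = z ^+ m * (h m / m%:R).
  by rewrite /= expr1 /h; ring.
have [|||v hv] := cseries_dirichlet (g := fun m => h m / m%:R)
   (v := fun k => (B + 4 * B * 32) * (1 / root4 R k.+1 ^+ 5)) z4 z1.
- apply/ccvg_shiftS/ccvgP => e e0.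
  have e1 : 0 < e / (4 * B + 1) by rewrite divr_gt0// ltr_wpDl// mulr_ge0.
  have /cvgrPdist_le/(_ _ e1) H := root4V_cvg.
  apply: filterS H => m; rewrite !sub0r normrN nrmN nrmM nrmV nrm_nat.
  rewrite ger0_norm ?invr_ge0 ?root4_ge0// ler_pdivlMr ?ltr_wpDl ?mulr_ge0//.
  apply: le_trans; apply: (@le_trans _ _ (4 * B * root4 R m.+1 / m.+1%:R)).
    by rewrite ler_wpM2r ?invr_ge0.
  have q := root4_gt0 R m; have q1 := root4_ge1 m.
  rewrite -(root4X R m.+1).
  move: (root4 R m.+1) q q1 => x x0 x1.
  rewrite (_ : 4 * B * x / x ^+ 4 = 4 * B / x ^+ 3); last by field; rewrite gt_eqF.
  rewrite mulrC; apply: ler_pM; rewrite ?invr_ge0 ?mulr_ge0 ?exprn_ge0 ?lerDl ?(ltW x0)//.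
  by rewrite lef_pV2 ?posrE ?exprn_gt0// -{1}[x]expr1 ler_weXn2l.
- move=> m.
  (* The new term of [h] and the change of denominator are both O(m^(-7/4)). The formula also holds
     at m = 0, where [h] is 0. *)
  have -> : h m.+1 / m.+1%:R - h m / m%:R =
      nestz l m / m.+1%:R - h m / (m%:R * m.+1%:R).
    rewrite {1}/h big_nat_recr//= -/(h m).
    have n1 : m.+1%:R != 0 :> C by rewrite pnatr_eq0.
    case: m n1 => [|m] n1.
      by rewrite /h big_nil !mul0r !subr0 add0r.
    have n0 : m.+1%:R != 0 :> C by rewrite pnatr_eq0.
    rewrite -[m.+2%:R]natr1 in n1 *.
    by move: (h m.+1) (nestz l m.+1) (m.+1%:R : C) n1 n0 => p q r r1 r0; field; rewrite r1 r0.
  apply: le_trans (nrmD _ _) _; rewrite nrmN mulrDl; apply: lerD.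
    rewrite nrmM nrmV nrm_nat.
    apply: (@le_trans _ _ (B / root4 R m.+1 ^+ 3 / m.+1%:R)).
      by rewrite ler_wpM2r ?invr_ge0.
    have q := root4_gt0 R m; have q1 := root4_ge1 m.
    rewrite -(root4X R m.+1).
    move: (root4 R m.+1) q q1 => x x0 x1.
    rewrite -mulrA -invfM mul1r ler_wpM2l// lef_pV2 ?posrE ?mulr_gt0 ?exprn_gt0//.
    by rewrite -exprD ler_weXn2l.
  rewrite nrmM nrmV nrmM !nrm_nat.
  apply: (@le_trans _ _ (4 * B * root4 R m / (m%:R * m%:R))).
    apply: ler_pM; rewrite ?nrm_ge0 ?invr_ge0 ?mulr_ge0//.
    case: m => [|m]; first by rewrite !mul0r invr0.
    by rewrite lef_pV2 ?posrE ?mulr_gt0 ?ltr0n// ler_wpM2l// ler_nat.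
  rewrite -mulrA -[leRHS]mulrA ler_wpM2l ?mulr_ge0// mulrA mulr1.
  exact: root4_quot5.
- exact: cvg_dom5.
by exists v; apply: eq_ccvg hv => n; apply: eq_bigr => m _; exact/esym/E.
Qed.

Lemma Li_partial_nestz (l : seq (nat * C)) N : (0 < N)%N ->
  Li_partial (fun j : 'I_(size l) => (nth (0%N, 0) l j).1)
    (fun j : 'I_(size l) => (nth (0%N, 0) l j).2) N = series (nestz l) N.
Proof.
move=> N0; rewrite /series /= /Li_partial.
rewrite (eq_bigr _ (fun k _ => nestz_nest l k)) -(sum_chain _ _ xpredT N0).
by apply: eq_bigl => n; rewrite andbT.
Qed.

Lemma nestz_CMZV a z (l : seq (nat * C)) : roots4 ((a, z) :: l) ->
  (a, z) <> (1%N, 1) ->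
  exists2 v, ccvg (series (nestz ((a, z) :: l))) v &
    is_CMZV4_value (\sum_(x <- (a, z) :: l) x.1)%N v.
Proof.
move=> hl az1; have [v hv] := nestz_cvg hl az1; exists v => //.
set L := (a, z) :: l in hl hv *.
exists (size L), isT, (fun j : 'I_(size L) => (nth (0%N, 0) L j).1),
  (fun j : 'I_(size L) => (nth (0%N, 0) L j).2); split.
- by move=> j; have [] := hl _ (mem_nth (0%N, 0) (ltn_ord j)).
- by move=> j; have [] := hl _ (mem_nth (0%N, 0) (ltn_ord j)).
- exact: az1.
- by rewrite (big_nth (0%N, 0)) big_mkord.
- apply/ccvg_shiftS; apply: eq_ccvg (fun n => esym (Li_partial_nestz L (ltn0Sn n))) _.
  by apply/ccvg_shiftS.
Qed.

Lemma span_over_lin (V : set C) q x y : span_over (Qset R) V x ->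
  span_over (Qset R) V y -> span_over (Qset R) V (ratr q * x + y).
Proof.
move=> [t ht ->] [t' ht' ->].
exists ([seq (ratr q * p.1, p.2) | p <- t] ++ t').
  move=> p; rewrite mem_cat => /orP[/mapP[p' p't ->]|/ht'//].
  have [[r _ hr] hV] := ht _ p't; split => //=.
  by exists (q * r) => //; rewrite -hr rmorphM.
rewrite big_cat big_map /= mulr_sumr; congr (_ + _).
by apply: eq_bigr => p _; rewrite mulrA.
Qed.

Lemma span_over0 (K V : set C) : span_over K V 0.
Proof. by exists [::] => //; rewrite big_nil. Qed.

Lemma CMZV4_lin k q x y : CMZV4 R k x -> CMZV4 R k y -> CMZV4 R k (ratr q * x + y).
Proof.
case: k => [|k]; last exact: span_over_lin.
move=> [r _ <-] [s _ <-]; exists (q * r + s) => //.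
by rewrite rmorphD rmorphM.
Qed.

Lemma CMZV4_0 k : CMZV4 R k 0.
Proof.
case: k => [|k]; last exact: span_over0.
by exists 0 => //; rewrite rmorph0.
Qed.

Lemma CMZV4_gen k x : is_CMZV4_value k.+1 x -> CMZV4 R k.+1 x.
Proof.
move=> hx; exists [:: (1, x)].
  by move=> p; rewrite inE => /eqP -> /=; split => //; exists 1 => //; rewrite rmorph1.
by rewrite big_seq1 mul1r.
Qed.

Definition dword4 (k : nat) (c : nat -> C) : Prop :=
  exists w, [/\ size w = k, (forall x, x \in w -> letter4 x) & forall n, c n = dword w n].

Lemma series_lin (q : C) (f g : nat -> C) n :
  series (fun k => q * f k + g k) n = q * series f n + series g n.
Proof. by rewrite /series /= mulr_sumr -big_split. Qed.

(** Convergence depends on the outermost letter alone, so once this is not [Some 1] a rational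
    combination of inner words can be summed term by term. *)
Lemma dword_top_CMZV k o c : letter4 o -> o <> Some 1 -> qspan (dword4 k) c ->
  exists2 v, ccvg (series (iform (dcoef o) c)) v & CMZV4 R k.+1 v.
Proof.
move=> o4 o1; elim=> {c} [c c0|q f g c [w [sw w4 hw]] _ [v hv Vv] hc].
  exists 0; last exact: CMZV4_0.
  apply: eq_ccvg (@ccvg_cst R 0) => n; rewrite /series /= big1// => m _.
  by rewrite /iform /conv big1 ?mulr0// => i _; rewrite c0 mulr0.
have E n : series (iform (dcoef o) c) n =
    ratr q * series (dword (o :: w)) n + series (iform (dcoef o) g) n.
  rewrite -series_lin; apply: eq_bigr => m _ /=; rewrite -iform_linr.
  by apply: eq_iform => // i; rewrite hc hw.
have [|z0|[a [z [l [hl hs hd /(_ o1) az]]]]] := @dword_nestz _ o w.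
- by move=> x; rewrite inE => /orP[/eqP ->|/w4].
- exists v => //; apply: eq_ccvg hv => n; rewrite E.
  by rewrite [series (dword _) n]big1 ?mulr0 ?add0r.
have [v' hv' V'] := nestz_CMZV hl az.
rewrite hs sw in V'.
exists (ratr q * v' + v); last by apply: CMZV4_lin => //; exact: CMZV4_gen.
have hw' : ccvg (series (dword (o :: w))) v'.
  by apply: eq_ccvg hv' => n; apply: eq_bigr => m _; rewrite hd.
exact: eq_ccvg (fun n => esym (E n)) (@ccvg_lin R (ratr q) _ _ _ _ hw' hv).
Qed.

Lemma dword4_step k o c : letter4 o -> qspan (dword4 k) c ->
  qspan (dword4 k.+1) (iform (dcoef o) c).
Proof.
move=> o4; apply: qspan_map => [q f g n|f [w [sw w4 hw]]]; first exact: iform_linr.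
apply: qspan_gen; exists (o :: w); split => /=; first by rewrite sw.
  by move=> x; rewrite inE => /orP[/eqP ->|/w4].
by move=> n; apply: eq_iform.
Qed.

Lemma sqr_iX m : 'i%C ^+ (m.*2) = (-1) ^+ m :> C.
Proof. by rewrite -mul2n exprM sqr_i. Qed.

Lemma geomcoef_i n : geomcoef ('i%C : C) n =
  if n == 0%N then 0 else (if odd n then 'i%C else 1) * (-1) ^+ n./2.
Proof.
case: n => // n; rewrite /geomcoef -{1}(odd_double_half n.+1) exprD sqr_iX.
by case: (odd n.+1); rewrite ?expr1 ?expr0.
Qed.

Lemma geomcoef_Ni n : geomcoef (- 'i%C : C) n =
  if n == 0%N then 0 else (if odd n then - 'i%C else 1) * (-1) ^+ n./2.
Proof.
case: n => // n; rewrite /geomcoef -{1}(odd_double_half n.+1) exprD.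
have -> : (- 'i%C : C) ^+ (n.+1)./2.*2 = (-1) ^+ (n.+1)./2.
  by rewrite -mul2n exprM sqrrN sqr_i.
by case: (odd n.+1); rewrite ?expr1 ?expr0.
Qed.

Lemma geomcoef_1 n : geomcoef (1 : C) n = (n != 0%N)%:R.
Proof. by case: n => // n; rewrite /geomcoef expr1n. Qed.

Lemma geomcoef_N1 n : geomcoef (-1 : C) n =
  if n == 0%N then 0 else if odd n then -1 else 1.
Proof. by case: n => // n; rewrite /geomcoef -signr_odd; case: (odd _). Qed.

Lemma mod4_half n : (n %% 4 == 2)%N = ~~ odd n && odd n./2.
Proof.
have := odd_double_half n; have := odd_double_half n./2.
by case: (odd n); case: (odd n./2) => /=; rewrite -!mul2n; lia.
Qed.

Lemma ucoefE a n : (ucoef R a n)%:C%C =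
  match a with
  | Lcot => delta0 n + (geomcoef 'i%C n + geomcoef (- 'i%C) n)
  | Ltan => geomcoef 1 n + (geomcoef (-1) n - (geomcoef 'i%C n + geomcoef (- 'i%C) n))
  | Lsec => geomcoef 1 n - geomcoef (-1) n
  end.
Proof.
rewrite geomcoef_i geomcoef_Ni geomcoef_1 geomcoef_N1 /delta0.
case: n => [|n].
  by case: a; rewrite /= ?rmorph1 ?rmorph0; ring.
have sg : (-1) ^+ (n.+1)./2 = if odd (n.+1)./2 then -1 else 1 :> C.
  by rewrite -signr_odd; case: (odd _).
have sgR : (-1) ^+ (n.+1)./2 = if odd (n.+1)./2 then -1 else 1 :> R.
  by rewrite -signr_odd; case: (odd _).
have e0 : (n.+1 == 0%N) = false by [].
case: a; rewrite /ucoef ?mod4_half ?e0 ?sg ?sgR;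
  case: (odd n.+1); case: (odd (n.+1)./2) => /=;
  rewrite ?rmorph0 ?rmorphM ?rmorphN ?rmorph1 ?rmorph_nat; ring.
Qed.

Lemma dtcoefE n : (dtcoef R n)%:C%C = - 'i%C * (geomcoef 'i%C n - geomcoef (- 'i%C) n).
Proof.
rewrite geomcoef_i geomcoef_Ni /dtcoef.
case: n => [|n]; first by rewrite subrr mulr0.
rewrite /=; case: (odd n) => /=; first by rewrite subrr mulr0.
rewrite rmorphM rmorphXn rmorphN rmorph1 rmorph_nat.
set s := (-1) ^+ _.
have -> : 2 * s = - ('i%C ^+ 2) * (2 * s) :> C by rewrite sqr_i opprK mul1r.
by ring.
Qed.

Lemma root4_letters : [/\ letter4 (Some (1 : C)), letter4 (Some (-1 : C)),
  letter4 (Some ('i%C : C)) & letter4 (Some (- 'i%C : C))].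
Proof.
have i4 : 'i%C ^+ 4 = 1 :> C by rewrite (exprM _ 2 2) sqr_i sqrrN expr1n.
split; rewrite /letter4 ?expr1n//; first by rewrite -signr_odd.
by rewrite exprNn i4 -signr_odd mulr1.
Qed.

Lemma uword_qspan w : qspan (dword4 (size w)) (fun n => (uword R w n)%:C%C).
Proof.
have [l1 l2 l3 l4] := root4_letters.
elim: w => [|a w IH].
  apply: qspan_gen; exists [::]; split => // n; rewrite /= /delta0.
  by rewrite rmorph_nat.
have E n : (uword R (a :: w) n)%:C%C =
   iform (fun n => (ucoef R a n)%:C%C) (fun n => (uword R w n)%:C%C) n.
  rewrite /= /iform rmorphM fmorphV rmorph_nat /conv rmorph_sum; congr (_ * _).
  by apply: eq_bigr => i _; rewrite rmorphM.
apply: qspan_ext (fun n => esym (E n)) _.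
pose D o := iform (dcoef o) (fun n => (uword R w n)%:C%C).
have hD o : letter4 o -> qspan (dword4 (size w).+1) (D o).
  by move=> ho; exact: dword4_step.
have DD o1 o2 e1 e2 n : (forall k, e1 k = dcoef o1 k + e2 k) ->
    iform e1 o2 n = iform (dcoef o1) o2 n + iform e2 o2 n :> C.
  move=> he; rewrite -[iform (dcoef o1) _ _]mul1r -iform_linl.
  by apply: eq_iform => // k; rewrite mul1r he.
have DB o1 o2 e1 e2 n : (forall k, e1 k = e2 k - dcoef o1 k) ->
    iform e1 o2 n = iform e2 o2 n - iform (dcoef o1) o2 n :> C.
  move=> he; rewrite addrC -[- iform _ _ _]mulN1r -iform_linl.
  by apply: eq_iform => // k; rewrite mulN1r he addrC.
case: a {E}.
- apply: (@qspan_ext _ _ (fun n => D None n + (D (Some 'i%C) n + D (Some (- 'i%C)) n))).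
    move=> n; rewrite (@DD None _ _ (fun k => geomcoef 'i%C k + geomcoef (- 'i%C) k)); last first.
      by move=> k; rewrite ucoefE.
    by rewrite (@DD (Some 'i%C) _ (fun k => geomcoef 'i%C k + geomcoef (- 'i%C) k) (geomcoef (- 'i%C))).
  by apply: qspanD; [|apply: qspanD]; apply: hD.
- apply: (@qspan_ext _ _ (fun n => (D (Some 1) n + D (Some (-1)) n - D (Some 'i%C) n) - D (Some (- 'i%C)) n)).
    move=> n; rewrite (@DB (Some (- 'i%C)) _ _ (fun k => geomcoef 1 k + geomcoef (-1) k - geomcoef 'i%C k)); last first.
      by move=> k; rewrite ucoefE /=; ring.
    rewrite (@DB (Some 'i%C) _ _ (fun k => geomcoef 1 k + geomcoef (-1) k))//.
    by rewrite (@DD (Some 1) _ _ (geomcoef (-1))).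
  by apply: qspanB; [apply: qspanB; [apply: qspanD|]|]; apply: hD.
- apply: (@qspan_ext _ _ (fun n => D (Some 1) n - D (Some (-1)) n)).
    move=> n; rewrite (@DB (Some (-1)) _ _ (geomcoef 1))//.
    by move=> k; rewrite ucoefE.
  by apply: qspanB; apply: hD.
Qed.

(** The outermost letters that occur are du/u and those with eta = i, -i, never eta = 1, so the sums
    converge at u = 1. *)
Lemma topword_CMZV w :
  exists2 v, ccvg (series (fun n => (topword R w n)%:C%C)) ('i%C ^+ parity w * v) & CMZV4 R (size w).+1 v.
Proof.
have [l1 l2 l3 l4] := root4_letters.
have E n : (topword R w n)%:C%C =
   iform (fun n => (topcoef R (parity w) n)%:C%C) (fun n => (uword R w n)%:C%C) n.
  rewrite /topword /iform rmorphM fmorphV rmorph_nat /conv rmorph_sum; congr (_ * _).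
  by apply: eq_bigr => i _; rewrite rmorphM.
have i1 : Some ('i%C : C) <> Some 1.
  by move=> /(congr1 (fun o => complex.Im (odflt 0 o))) /= /eqP; rewrite oner_eq0.
have i2 : Some (- 'i%C : C) <> Some 1.
  by move=> /(congr1 (fun o => complex.Im (odflt 0 o))) /= /eqP; rewrite oppr_eq0 oner_eq0.
have Q := uword_qspan w.
case Ep : (parity w) E => E.
  have [v1 h1 V1] := dword_top_CMZV l3 i1 Q.
  have [v2 h2 V2] := dword_top_CMZV l4 i2 Q.
  (* By [dtcoefE] the value is -i v1 + i v2 = i (v2 - v1), which is where the factor i of odd words
     comes from. *)
  exists (ratr (-1) * v1 + v2); last exact: CMZV4_lin.
  have -> : 'i%C ^+ true * (ratr (-1) * v1 + v2) = - 'i%C * v1 + ('i%C * v2 + 0).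
    by rewrite expr1 rmorphN1; ring.
  pose D o := iform (dcoef o) (fun n => (uword R w n)%:C%C).
  have E3 m : (topword R w m)%:C%C =
      - 'i%C * D (Some 'i%C) m + ('i%C * D (Some (- 'i%C)) m + 0).
    rewrite E (eq_iform (e2 := fun k => - 'i%C * geomcoef 'i%C k + ('i%C * geomcoef (- 'i%C) k + 0)) _ _ (fun=> erefl)); last first.
      by move=> k; rewrite /topcoef dtcoefE; ring.
    rewrite iform_linl; congr (_ + _).
    rewrite iform_linl; congr (_ + _).
    by rewrite /iform /conv big1 ?mulr0// => i _; rewrite mul0r.
  have E4 n : - 'i%C * series (D (Some 'i%C)) n + ('i%C * series (D (Some (- 'i%C))) n + 0) =
      series (fun n => (topword R w n)%:C%C) n.
    rewrite (_ : (fun n => _) = fun n => - 'i%C * D (Some 'i%C) n + ('i%C * D (Some (- 'i%C)) n + 0)); last exact/funext.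
    rewrite (series_lin (- 'i%C) (D (Some 'i%C)) (fun n => 'i%C * D (Some (- 'i%C)) n + 0)).
    rewrite (series_lin 'i%C (D (Some (- 'i%C))) (fun=> 0)).
    by congr (_ + (_ + _)); rewrite /series /= big1.
  exact: eq_ccvg E4 (@ccvg_lin R _ _ _ _ _ h1 (@ccvg_lin R 'i%C _ _ _ _ h2 (@ccvg_cst R 0))).
have [v h V] := dword_top_CMZV (o := None) I (fun e : None = Some 1 => False_ind _ (eq_ind None (fun x => if x is None then True else False) I _ e)) Q.
exists v; last exact: V.
have -> : 'i%C ^+ false * v = v by rewrite expr0 mul1r.
have E5 n : series (iform (dcoef None) (fun n => (uword R w n)%:C%C)) n =
    series (fun n => (topword R w n)%:C%C) n.
  apply: eq_bigr => m _; rewrite E; apply: eq_iform => // k.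
  by rewrite /topcoef /dcoef /delta0 rmorph_nat.
exact: eq_ccvg E5 h.
Qed.

End CMZVSums.

(** * Parts (a) and (b) *)

Section AperySequences.
Variable R : realType.
Implicit Types (a c f g : nat -> R).

Definition den (l : linform) (n : nat) : R := (lval l n)%:~R.

Lemma denE n : den Even n = (2 * n)%:R.
Proof. by rewrite /den /lval -[2 * _]/((2 * n)%N%:Z) -pmulrn. Qed.

Lemma denO n : den OddSucc n = (2 * n + 1)%:R.
Proof. by rewrite /den /lval intrD -/(den Even n) denE natrD. Qed.

Lemma denP n : den OddPred n = (2 * n)%:R - 1.
Proof. by rewrite /den /lval intrB -/(den Even n) denE. Qed.

Lemma denPS n : den OddPred n.+1 = den OddSucc n.
Proof. by rewrite denP denO mulnS natrD natrD; ring. Qed.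

Definition divden l s a n : R := a n / den l n ^+ s.

Definition sum_lt a n : R := \sum_(0 <= k < n) a k.
Definition sum_le a n : R := \sum_(0 <= k < n.+1) a k.

Lemma divden_lin l s (q : R) f g n :
  divden l s (fun k => q * f k + g k) n = q * divden l s f n + divden l s g n.
Proof. by rewrite /divden mulrDl mulrA. Qed.

Lemma sum_lt_lin (q : R) f g n :
  sum_lt (fun k => q * f k + g k) n = q * sum_lt f n + sum_lt g n.
Proof. by rewrite /sum_lt mulr_sumr -big_split. Qed.

Lemma sum_le_lin (q : R) f g n :
  sum_le (fun k => q * f k + g k) n = q * sum_le f n + sum_le g n.
Proof. by rewrite /sum_le mulr_sumr -big_split. Qed.

Lemma shiftS_lin (q : R) f g n :
  shiftS (fun k => q * f k + g k) n = q * shiftS f n + shiftS g n.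
Proof. by case: n => [|n] //=; rewrite mulr0 addr0. Qed.

Lemma sum_leE a n : sum_le a n = sum_lt a n + a n.
Proof. by rewrite /sum_le /sum_lt big_nat_recr. Qed.

Lemma sum_lt0 a : sum_lt a 0 = 0. Proof. by rewrite /sum_lt big_nil. Qed.

Lemma sum_ltS a n : sum_lt a n.+1 = sum_le a n. Proof. by []. Qed.

Lemma sum_lt_shift a n : sum_lt (shiftS a) n = shiftS (sum_lt a) n.
Proof.
case: n => [|n]; first by rewrite sum_lt0.
by rewrite /sum_lt big_nat_recl//= add0r.
Qed.

Lemma sum_le_shift a n : sum_le (shiftS a) n = sum_lt a n.
Proof. by rewrite /sum_le /sum_lt big_nat_recl//= add0r. Qed.

Lemma divden_add l s t a n : divden l s (divden l t a) n = divden l (s + t) a n.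
Proof. by rewrite /divden exprD invfM; ring. Qed.

Lemma divdenP_shift s a n : divden OddPred s (shiftS a) n = shiftS (divden OddSucc s a) n.
Proof. by case: n => [|n]; rewrite /divden /= ?mul0r// denPS. Qed.

(** The coefficients of x^(2n+p) in a word of parity p; those of the other parity are 0, so the
    sequence determines the word's expansion. *)
Definition xbase (p : bool) (k : nat) a : Prop :=
  exists w, [/\ regular w, size w = k, parity w = p & forall n, a n = xword R w (2 * n + p)].

Definition word_span p k := qspan (xbase p k).

Lemma sum_parity (F : nat -> R) (p : bool) n : (forall k, odd k != p -> F k = 0) ->
  \sum_(0 <= k < 2 * n + p) F k = \sum_(0 <= j < n) F (2 * j + p)%N.
Proof.
move=> hF; elim: n => [|n IH].
  rewrite [RHS]big_nil; case: p hF => hF; last by rewrite big_nil.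
  by rewrite big_nat1 hF.
have -> : (2 * n.+1 + p = (2 * n + p).+2)%N by rewrite mulnS.
rewrite !big_nat_recr//= IH; case: p hF {IH} => hF.
  by rewrite (hF (2 * n + 1).+1) ?addr0// addn1 mul2n /= odd_double.
by rewrite (hF (2 * n + 0).+1) ?addr0// addn0 mul2n /= odd_double.
Qed.

Lemma xword_cot w p n : xword R (Lcot :: w) (2 * n + p) = xword R w (2 * n + p) / (2 * n + p)%:R.
Proof. by rewrite /= /iform conv_delta0 mulrC. Qed.

Lemma xword_tan w n : xword R (Ltan :: w) (2 * n + parity w) =
  sum_lt (fun j => xword R w (2 * j + parity w)) n / (2 * n + parity w)%:R.
Proof.
set p := parity w; rewrite [LHS]/= /iform mulrC; congr (_ / _).
rewrite /conv big_ord_recr /= subnn mul0r addr0.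
rewrite -(big_mkord xpredT (fun k => ((0 < 2 * n + p - k)%N && ~~ odd (2 * n + p - k))%:R * xword R w k)).
rewrite sum_parity; last by move=> k hk; rewrite xword_parity ?mulr0.
rewrite [LHS]big_nat_cond [RHS]big_nat_cond; apply: eq_bigr => j /andP[/andP[_ jn] _].
have -> : (2 * n + p - (2 * j + p) = (n - j).*2)%N by lia.
by rewrite odd_double double_gt0 subn_gt0 jn mul1r.
Qed.

(** The even exponents below 2n+1 are 2j with j <= n, whereas the odd ones below 2n are 2j+1 with j
    < n. This is why the relation is weak exactly at 2m+1. *)
Lemma xword_sec0 w n : parity w = false ->
  xword R (Lsec :: w) (2 * n + 1) = sum_le (fun j => xword R w (2 * j + 0)) n / (2 * n + 1)%:R.
Proof.
move=> pw; rewrite [LHS]/= /iform mulrC; congr (_ / _).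
rewrite /conv -(big_mkord xpredT (fun k => (odd (2 * n + 1 - k))%:R * xword R w k)).
have -> : ((2 * n + 1).+1 = 2 * n.+1 + false)%N by lia.
rewrite (sum_parity (p := false)); last by move=> k hk; rewrite xword_parity ?mulr0 ?pw.
rewrite /sum_le [LHS]big_nat_cond [RHS]big_nat_cond; apply: eq_bigr => j /andP[/andP[_ jn] _].
have -> : (2 * n + 1 - (2 * j + 0) = (n - j).*2.+1)%N by lia.
by rewrite /= odd_double mul1r.
Qed.

Lemma xword_sec1 w n : parity w = true ->
  xword R (Lsec :: w) (2 * n + 0) = sum_lt (fun j => xword R w (2 * j + 1)) n / (2 * n + 0)%:R.
Proof.
move=> pw; rewrite [LHS]/= /iform mulrC; congr (_ / _).
rewrite /conv -(big_mkord xpredT (fun k => (odd (2 * n + 0 - k))%:R * xword R w k)).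
have -> : ((2 * n + 0).+1 = 2 * n + true)%N by lia.
rewrite (sum_parity (p := true)); last by move=> k hk; rewrite xword_parity ?mulr0 ?pw.
rewrite /sum_lt [LHS]big_nat_cond [RHS]big_nat_cond; apply: eq_bigr => j /andP[/andP[_ jn] _].
have -> : (2 * n + 0 - (2 * j + true) = (n - j.+1).*2.+1)%N by lia.
by rewrite /= odd_double mul1r.
Qed.

Definition form_of (p : bool) := if p then OddSucc else Even.

Lemma den_form p n : den (form_of p) n = (2 * n + p)%:R.
Proof. by case: p; rewrite ?denO ?denE ?addn0. Qed.

Lemma word_span_delta0 : word_span false 0 delta0.
Proof.
apply: qspan_gen; exists [::]; split => // n.
by rewrite /= /delta0 addn0 muln_eq0.
Qed.

Lemma word_span_div p k a : word_span p k a -> word_span p k.+1 (divden (form_of p) 1 a).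
Proof.
apply: qspan_map => [q f g n|f [w [rw sw pw hf]]]; first exact: divden_lin.
have E n : divden (form_of p) 1 f n = xword R (Lcot :: w) (2 * n + p).
  by rewrite xword_cot /divden expr1 den_form hf.
(* The word [Lcot] alone is not regular, but then the sequence is [delta0] divided by 2n, which is 0
   because [0^-1 = 0]. *)
have [wn|wn] := posnP (size w).
  apply: qspan_nil => n; rewrite E; case: w {E rw sw hf} wn pw => // _ /= <-.
  rewrite /iform conv_delta0 /delta0; case: n => [|n] /=; first by rewrite invr0 mul0r.
  by rewrite mulr0.
apply: qspan_gen; exists (Lcot :: w); split => //=; last by rewrite sw.
by case: w wn rw {sw pw hf E}.
Qed.

Lemma Cs_divden p k s a : word_span p k a -> word_span p (s + k) (divden (form_of p) s a).
Proof.
move=> Ca; elim: s => [|s IH].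
  by apply: qspan_ext Ca => n; rewrite /divden expr0 divr1.
by apply: qspan_ext (word_span_div IH) => n; rewrite divden_add add1n.
Qed.

Lemma Cs_sum_lt p k a : word_span p k a -> word_span false k.+1 (divden Even 1 (sum_lt a)).
Proof.
apply: (@qspan_map _ _ _ (fun a => divden Even 1 (sum_lt a))) => [q f g n|f [w [rw sw pw hf]]].
  by rewrite -divden_lin /divden sum_lt_lin.
have E n : sum_lt f n = sum_lt (fun j => xword R w (2 * j + p)) n.
  by apply: eq_bigr => j _; rewrite hf.
have rw' x : x <> Lcot -> regular (x :: w) by case: w rw {sw pw hf E} => [|b w]//; case: x.
apply: qspan_gen; case: p pw hf E => pw hf E.
  exists (Lsec :: w); split => //=; [exact: rw'|by rewrite sw|by rewrite pw|].
  by move=> n; rewrite -[RHS]/(xword R (Lsec :: w) (2 * n + 0)) xword_sec1// /divden expr1 E denE addn0.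
exists (Ltan :: w); split; [exact: rw'|by rewrite /= sw|by []|].
move=> n; have := xword_tan w n; rewrite pw => ->.
by rewrite /divden expr1 E denE addn0.
Qed.

(** With 2m+1 over 2m+1 the weak sum splits into the strict sum, given by [Ltan], and the diagonal
    term, given by [Lcot]. Over 2m it is a single [Lsec]. *)
Lemma Cs_sum_le p k a : word_span p k a -> word_span true k.+1 (divden OddSucc 1 (sum_le a)).
Proof.
case: p => Ca.
  apply: (@qspan_ext _ _ (fun n => divden OddSucc 1 (sum_lt a) n + divden OddSucc 1 a n)).
    by move=> n; rewrite /divden sum_leE mulrDl.
  apply: qspanD; last exact: word_span_div Ca.
  move: Ca; apply: (@qspan_map _ _ _ (fun a => divden OddSucc 1 (sum_lt a))) => [q f g n|f [w [rw sw pw hf]]].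
    by rewrite -divden_lin /divden sum_lt_lin.
  apply: qspan_gen; exists (Ltan :: w); split; [|by rewrite /= sw|by []|].
    by case: w rw {sw pw hf}.
  move=> n; have := xword_tan w n; rewrite pw => ->.
  rewrite /divden expr1 denO; congr (_ / _).
  by apply: eq_bigr => j _; rewrite hf.
move: Ca; apply: (@qspan_map _ _ _ (fun a => divden OddSucc 1 (sum_le a))) => [q f g n|f [w [rw sw pw hf]]].
  by rewrite -divden_lin /divden sum_le_lin.
apply: qspan_gen; exists (Lsec :: w); split; [|by rewrite /= sw|by rewrite /= pw|].
  by case: w rw {sw pw hf}.
move=> n; rewrite xword_sec0// /divden expr1 denO; congr (_ / _).
by apply: eq_bigr => j _; rewrite hf.
Qed.

Lemma Cs_sum_lt_s p k s a : word_span p k a -> word_span false (s.+1 + k) (divden Even s.+1 (sum_lt a)).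
Proof.
move=> Ca; rewrite addSnnS.
by apply: qspan_ext (@Cs_divden false _ s _ (Cs_sum_lt Ca)) => n; rewrite divden_add addn1.
Qed.

Lemma Cs_sum_le_s p k s a : word_span p k a -> word_span true (s.+1 + k) (divden OddSucc s.+1 (sum_le a)).
Proof.
move=> Ca; rewrite addSnnS.
by apply: qspan_ext (@Cs_divden true _ s _ (Cs_sum_le Ca)) => n; rewrite divden_add addn1.
Qed.

Definition rsum a N : R := \sum_(0 <= n < N) bcoefR R n * a n.

Definition summable_in (V : set R[i]) a : Prop :=
  exists2 S : R, rsum a @ \oo --> S & V S%:C%C.

Lemma eq_summable_in V a c : (forall n, a n = c n) -> summable_in V a -> summable_in V c.
Proof. by move=> e; have -> : a = c by apply/funext. Qed.

Lemma summable_in_sub V W a : V `<=` W -> summable_in V a -> summable_in W a.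
Proof. by move=> VW [S h VS]; exists S => //; exact: VW. Qed.

Lemma rsum_lin (q : R) a c N : rsum (fun n => q * a n + c n) N = q * rsum a N + rsum c N.
Proof.
rewrite /rsum mulr_sumr -big_split; apply: eq_bigr => n _ /=.
by rewrite mulrDr mulrCA.
Qed.

Lemma summable_in_lin V (q : rat) a c : (forall x y, V x -> V y -> V (ratr q * x + y)) ->
  summable_in V a -> summable_in V c -> summable_in V (fun n => ratr q * a n + c n).
Proof.
move=> Vl [S hS VS] [T hT VT]; exists (ratr q * S + T).
  rewrite (_ : rsum _ = fun N => ratr q * rsum a N + rsum c N); last first.
    by apply/funext => N; rewrite rsum_lin.
  by apply: cvgD => //; apply: cvgMr.
by rewrite rmorphD rmorphM /= fmorph_rat; exact: Vl.
Qed.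

Lemma Good0 V a : V 0 -> (forall n, a n = 0) -> summable_in V a.
Proof.
move=> V0 a0; exists 0; last by rewrite rmorph0.
rewrite (_ : rsum a = fun=> 0); first exact: cvg_cst.
by apply/funext => N; rewrite /rsum big1// => i _; rewrite a0 mulr0.
Qed.

Lemma scale_CMZV4_lin k (z : R[i]) (q : rat) x y :
  scale_set z (CMZV4 R k) x -> scale_set z (CMZV4 R k) y ->
  scale_set z (CMZV4 R k) (ratr q * x + y).
Proof.
move=> [v V1 <-] [v' V2 <-]; exists (ratr q * v + v'); first exact: CMZV4_lin.
by rewrite mulrDr mulrCA.
Qed.

(** The factor b_n/(2n+p) is the integral against the outermost form, so the weight is the length of
    the word plus one. *)
Lemma summable_in_Cs p k a : word_span p k a ->
  summable_in (scale_set ('i%C ^+ p) (CMZV4 R k.+1)) (divden (form_of p) 1 a).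
Proof.
have V0 : scale_set ('i%C ^+ p) (CMZV4 R k.+1) 0.
  by exists 0; [exact: CMZV4_0|rewrite mulr0].
elim=> {a} [a a0|q f g a [w [rw sw pw hf]] _ IH ha].
  by apply: Good0 => // n; rewrite /divden a0 mul0r.
apply: (@eq_summable_in _ (fun n => ratr q * divden (form_of p) 1 f n + divden (form_of p) 1 g n)).
  by move=> n; rewrite -divden_lin /divden ha.
apply: summable_in_lin => //; first by move=> x y; exact: scale_CMZV4_lin.
have [wn|wn] := posnP (size w).
  apply: Good0 => // n; rewrite /divden hf den_form; case: w {rw sw hf} wn pw => // _ /= <-.
  by case: n => [|n]; rewrite ?expr1 ?invr0 ?mulr0// /delta0 mul0r.
have [v hv V] := topword_CMZV R w.
rewrite pw sw in hv V.
have [] := @ccvg_real_inv R (series (topword R w)) ('i%C ^+ p * v).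
  by apply: eq_ccvg hv => n; rewrite /series /= rmorph_sum.
move=> /(apery_word_sum rw wn) hS E.
exists (complex.Re ('i%C ^+ p * v)); last by rewrite -E; exists v.
rewrite pw in hS; case: p hf {pw hv V E V0 IH ha} hS => hf hS.
  rewrite (_ : rsum _ = fun M => \sum_(0 <= j < M) xword R w (2 * j + 1 + ~~ true) *
     (bcoefR R j / (2 * j + 1)%:R))//.
  apply/funext => M; apply: eq_bigr => j _; rewrite /divden expr1 hf denO addn0.
  by ring.
(* For even words the term n = 0 vanishes as [0^-1 = 0], and b_(j+1)/(2j+2) = b_j/(2j+1) brings the
   rest to the form of [apery_word_sum]. *)
rewrite -cvg_shiftS (_ : [sequence rsum _ n.+1]_n = fun M => \sum_(0 <= j < M) xword R w (2 * j + 1 + ~~ false) *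
     (bcoefR R j / (2 * j + 1)%:R))//.
apply/funext => M; rewrite /rsum /= big_nat_recl// {1}/divden denE muln0 expr1 invr0 !mulr0 add0r.
apply: eq_bigr => j _; rewrite /divden expr1 hf denE bcoefRS.
rewrite (_ : 2 * j.+1 + false = 2 * j + 2)%N; last by lia.
rewrite (_ : 2 * j.+1 = 2 * j + 2)%N; last by lia.
rewrite (_ : 2 * j + 1 + ~~ false = 2 * j + 2)%N; last by lia.
have : (2 * j + 2)%:R != 0 :> R by rewrite pnatr_eq0 addn2.
have : (2 * j + 1)%:R != 0 :> R by rewrite pnatr_eq0 addn1.
move: ((2 * j + 2)%:R : R) ((2 * j + 1)%:R : R) (xword R w _) (bcoefR R j) => x y u v' y0 x0.
by field; rewrite x0 y0.
Qed.

Lemma rsum_shift a N : rsum (shiftS a) N.+1 = rsum (fun n => a n + divden OddSucc 1 a n) N.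
Proof.
rewrite /rsum big_nat_recl//= mulr0 add0r; apply: eq_bigr => n _.
rewrite bcoefRS /divden expr1 denO.
have -> : (2 * n + 2)%:R = (2 * n + 1)%:R + 1 :> R by rewrite natr1 addn1 addn2.
have : (2 * n + 1)%:R != 0 :> R by rewrite pnatr_eq0 addn1.
by move: ((2 * n + 1)%:R : R) => x x0; field.
Qed.

(* b_(n+1) = b_n (1 + 1/(2n+1)). *)
Lemma summable_in_shift V a : summable_in V (fun n => a n + divden OddSucc 1 a n) -> summable_in V (shiftS a).
Proof.
move=> [S hS VS]; exists S => //; rewrite -cvg_shiftS.
rewrite (_ : [sequence _]_n = rsum (fun n => a n + divden OddSucc 1 a n))//.
by apply/funext => N; rewrite /= rsum_shift.
Qed.

Definition apery_seq d (s : 'I_d -> nat) (l : 'I_d -> linform) (w : 'I_d -> bool) : nat -> R :=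
  nest w (fun j n => (den (l j) n ^+ s j)^-1).

Lemma apery_seqS d (s : 'I_d.+1 -> nat) l w n :
  apery_seq s l w n = divden (l ord0) (s ord0)
    (if w ord0 then sum_le (apery_seq (fun j => s (lift ord0 j)) (fun j => l (lift ord0 j)) (fun j => w (lift ord0 j)))
     else sum_lt (apery_seq (fun j => s (lift ord0 j)) (fun j => l (lift ord0 j)) (fun j => w (lift ord0 j)))) n.
Proof.
rewrite /apery_seq /= /divden mulrC; congr (_ * _).
by case: (w ord0); rewrite ?addn1 ?addn0.
Qed.

(* Shifting the index by one turns 2m-1 into 2m+1, hence [shiftS]. *)
Definition class_b (l : linform) (k : nat) (a : nat -> R) : Prop :=
  match l with
  | Even => word_span false k a
  | OddSucc => word_span true k a
  | OddPred => exists2 c, word_span true k c & forall n, a n = shiftS c n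
  end.

(** A strict sum over a shifted sequence is sum_lt c n - c (n-1). Under 2n+1 or 2n-1 this is again a
    class member, but under 2n it puts a shifted sequence over an unshifted denominator; that case
    is excluded here and left to partial fractions. *)
Lemma class_b_step (l l' : linform) s k a : class_b l' k a -> (l' = OddPred -> l <> Even) ->
  class_b l (s.+1 + k) (divden l s.+1 (if l is OddSucc then sum_le a else sum_lt a)).
Proof.
case: l => Ha Hl.
- have {}Ha : exists p, word_span p k a.
    case: l' Ha Hl => // Ha Hl; [by exists false|by exists true|].
    by case: (Hl erefl).
  by case: Ha => p Ha; exact: Cs_sum_lt_s Ha.
- case: l' Ha {Hl} => [Ha|Ha|[c Hc ac]]; try exact: Cs_sum_le_s Ha.
  apply: (@qspan_ext _ _ (fun n => divden OddSucc s.+1 (sum_le c) n - divden OddSucc s.+1 c n)).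
    move=> n; have -> : a = shiftS c by apply/funext.
    by rewrite /divden sum_le_shift sum_leE; ring.
  by apply: qspanB; [exact: Cs_sum_le_s Hc|exact: (@Cs_divden true _ s.+1)].
(* At n = m+1 the strict range k < n becomes k <= m and 2n-1 becomes 2m+1. *)
- have H c p : word_span p k c -> class_b OddPred (s.+1 + k) (divden OddPred s.+1 (sum_lt c)).
    move=> Hc; exists (divden OddSucc s.+1 (sum_le c)); first exact: Cs_sum_le_s Hc.
    move=> n; rewrite -divdenP_shift; congr (_ / _).
    by case: n => [|n]; rewrite ?sum_lt0.
  case: l' Ha {Hl} => [Ha|Ha|[c Hc ac]]; try exact: H Ha.
  exists (fun n => divden OddSucc s.+1 (sum_le c) n - divden OddSucc s.+1 c n).
    by apply: qspanB; [exact: Cs_sum_le_s Hc|exact: (@Cs_divden true _ s.+1)].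
  move=> n; have -> : a = shiftS c by apply/funext.
  have -> : (fun n => divden OddSucc s.+1 (sum_le c) n - divden OddSucc s.+1 c n) = divden OddSucc s.+1 (sum_lt c).
    by apply/funext => m; rewrite /divden sum_leE; ring.
  by rewrite -divdenP_shift /divden sum_lt_shift.
Qed.

(** The empty tail counts as [Even] because its sequence [delta0] is an even word. *)
Definition head_form d : ('I_d -> linform) -> linform :=
  if d is d'.+1 return ('I_d -> linform) -> linform then fun l => l ord0 else fun=> Even.

Lemma apery_seq_class_b d (s : 'I_d -> nat) l : (forall j, (0 < s j)%N) ->
  (forall i j : 'I_d, j = i.+1 :> nat -> l j = OddPred -> l i <> Even) ->
  class_b (head_form l) (\sum_(j < d) s j) (apery_seq s l (std_weak l)).
Proof.
elim: d s l => [|d IH] s l s0 hl; first by rewrite big_ord0; exact: word_span_delta0.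
have IH' := IH (fun j => s (lift ord0 j)) (fun j => l (lift ord0 j)) (fun j => s0 _)
  (fun i j (e : j = i.+1 :> nat) => hl (lift ord0 i) (lift ord0 j) (congr1 S e)).
rewrite big_ord_recl /=.
have s1 : (0 < s ord0)%N := s0 ord0.
rewrite -(prednK s1).
have -> : apery_seq s l (std_weak l) = divden (l ord0) (s ord0).-1.+1
   (if l ord0 is OddSucc then
      sum_le (apery_seq (fun j => s (lift ord0 j)) (fun j => l (lift ord0 j)) (std_weak (fun j => l (lift ord0 j))))
    else sum_lt (apery_seq (fun j => s (lift ord0 j)) (fun j => l (lift ord0 j)) (std_weak (fun j => l (lift ord0 j))))).
  apply/funext => n; rewrite apery_seqS (prednK s1) /std_weak.
  by case: (l ord0).
apply: class_b_step IH' _; case: d l {s s0 IH s1} hl => [|d] l hl //=.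
by apply: hl.
Qed.

End AperySequences.

(** * Partial fractions *)

Section MixedDenominators.
Variable R : realType.
Implicit Types (a c f g : nat -> R).

Definition mixden p q r c n : R :=
  c n / (den R Even n ^+ p * den R OddSucc n ^+ q * den R OddPred n ^+ r).

Lemma mixden_lin p q r (x : R) f g n :
  mixden p q r (fun k => x * f k + g k) n = x * mixden p q r f n + mixden p q r g n.
Proof. by rewrite /mixden mulrDl mulrA. Qed.

Lemma mixdenE s c n : mixden s 0 0 c n = divden Even s c n.
Proof. by rewrite /mixden /divden !mulr1. Qed.

Lemma mixdenO s c n : mixden 0 s 0 c n = divden OddSucc s c n.
Proof. by rewrite /mixden /divden mul1r mulr1. Qed.

Lemma mixdenP s c n : mixden 0 0 s c n = divden OddPred s c n.
Proof. by rewrite /mixden /divden mul1r mul1r. Qed.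

Lemma mixden_mm p q r p' q' r' c n :
  mixden p q r (mixden p' q' r' c) n = mixden (p + p') (q + q') (r + r') c n.
Proof. by rewrite /mixden !exprD !invfM; ring. Qed.

Lemma denE_neq0 n : den R Even n.+1 != 0.
Proof. by rewrite denE pnatr_eq0 mulnS. Qed.

Lemma denO_neq0 n : den R OddSucc n != 0.
Proof. by rewrite denO pnatr_eq0 addn1. Qed.

Lemma denP_neq0 n : den R OddPred n.+1 != 0.
Proof. by rewrite denPS denO_neq0. Qed.

Lemma den_EO n : den R OddSucc n = den R Even n + 1.
Proof. by rewrite denO denE natrD. Qed.

Lemma den_EP n : den R OddPred n = den R Even n - 1.
Proof. by rewrite denP denE. Qed.

(** 1/(x(x+1)) = 1/x - 1/(x+1) with x = 2n. At n = 0 this breaks down, since [0^-1 = 0]; hence the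
    condition on c, which strict sums satisfy. *)
Lemma mixden_EO p q r c n : c 0%N = 0 ->
  mixden p.+1 q.+1 r c n = ratr (-1) * mixden p q.+1 r c n + mixden p.+1 q r c n.
Proof.
move=> c0; rewrite /mixden rmorphN1; case: n => [|n]; first by rewrite c0 !mul0r; ring.
have h1 := denE_neq0 n; have h2 := denO_neq0 n.+1; have h3 := denP_neq0 n.
move: (c n.+1) => y.
move: h2; rewrite den_EO; move: h1 h3; move: (den R Even n.+1) (den R OddPred n.+1) => x z x0 z0 x1.
have A0 := expf_neq0 p x0; have B0 := expf_neq0 q x1; have D0 := expf_neq0 r z0.
rewrite !exprS; move: (x ^+ p) ((x + 1) ^+ q) (z ^+ r) A0 B0 D0 => A B D A0 B0 D0.
by field; rewrite x0 x1 A0 B0 D0.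
Qed.

Lemma mixden_EP p q r c n : c 0%N = 0 ->
  mixden p.+1 q r.+1 c n = ratr (-1) * mixden p.+1 q r c n + mixden p q r.+1 c n.
Proof.
move=> c0; rewrite /mixden rmorphN1; case: n => [|n]; first by rewrite c0 !mul0r; ring.
have h1 := denE_neq0 n; have h2 := denO_neq0 n.+1; have h3 := denP_neq0 n.
move: (c n.+1) => y.
move: h3; rewrite den_EP; move: h1 h2; move: (den R Even n.+1) (den R OddSucc n.+1) => x z x0 z0 x1.
have A0 := expf_neq0 p x0; have B0 := expf_neq0 r x1; have D0 := expf_neq0 q z0.
rewrite !exprS; move: (x ^+ p) ((x - 1) ^+ r) (z ^+ q) A0 B0 D0 => A B D A0 B0 D0.
by field; rewrite x0 x1 A0 B0 D0.
Qed.

Lemma mixden_OP p q r c n : c 0%N = 0 ->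
  mixden p q.+1 r.+1 c n = ratr (- 2^-1) * mixden p q.+1 r c n + (ratr (2^-1) * mixden p q r.+1 c n + 0).
Proof.
move=> c0; rewrite /mixden addr0 rmorphN !fmorphV !rmorph_nat.
case: n => [|n]; first by rewrite c0 !mul0r; ring.
have h1 := denE_neq0 n; have h2 := denO_neq0 n.+1; have h3 := denP_neq0 n.
move: (c n.+1) => y.
move: h3 h2; rewrite den_EP den_EO; move: h1; move: (den R Even n.+1) => x x0 z0 x1.
have A0 := expf_neq0 p x0; have B0 := expf_neq0 r z0; have D0 := expf_neq0 q x1.
rewrite !exprS; move: (x ^+ p) ((x - 1) ^+ r) ((x + 1) ^+ q) A0 B0 D0 => A B D A0 B0 D0.
by field; rewrite z0 x1 A0 B0 D0.
Qed.

(** Unlike [mixden_OP], this keeps two denominators in every term, so summing against b_n creates no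
    divergent piece. *)
Lemma mixden_OP2 c n : c 0%N = 0 ->
  mixden 0 1 1 c n = ratr (2^-1) * mixden 1 0 1 c n + (ratr (2^-1) * mixden 1 1 0 c n + 0).
Proof.
move=> c0; rewrite /mixden addr0 !fmorphV !rmorph_nat.
case: n => [|n]; first by rewrite c0 !mul0r; ring.
have h1 := denE_neq0 n; have h2 := denO_neq0 n.+1; have h3 := denP_neq0 n.
move: (c n.+1) => y.
move: h3 h2; rewrite den_EP den_EO; move: h1; move: (den R Even n.+1) => x x0 z0 x1.
by field; rewrite z0 x1 x0.
Qed.

(* Arbitrary products of 1/(2n), 1/(2n+1), 1/(2n-1), with strict sums only. *)
Inductive mixed_seq : nat -> (nat -> R) -> Prop :=
  | mixed_seq_delta0 : mixed_seq 0 delta0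
  | mixed_seq_div w l a of mixed_seq w a : mixed_seq w.+1 (divden l 1 a)
  | mixed_seq_sum w l a of mixed_seq w a : mixed_seq w.+1 (divden l 1 (sum_lt a)).

Definition mixed_span w := qspan (fun a => exists2 k, (k <= w)%N & mixed_seq k a).

Lemma mixed_span_div w l s a : mixed_span w a -> mixed_span (s + w) (divden l s a).
Proof.
move=> La; elim: s => [|s IH].
  by apply: qspan_ext La => n; rewrite /divden expr0 divr1.
apply: (@qspan_ext _ _ (divden l 1 (divden l s a))).
  by move=> n; rewrite divden_add add1n.
move: IH; apply: qspan_map => [q f g n|f [k kw kf]]; first exact: divden_lin.
by apply: qspan_gen; exists k.+1 => //; exact: mixed_seq_div.
Qed.

Lemma mixed_span_sum1 w l a : mixed_span w a -> mixed_span w.+1 (divden l 1 (sum_lt a)).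
Proof.
apply: (@qspan_map _ _ _ (fun a => divden l 1 (sum_lt a))) => [q f g n|f [k kw kf]].
  by rewrite -divden_lin /divden sum_lt_lin.
by apply: qspan_gen; exists k.+1 => //; exact: mixed_seq_sum.
Qed.

Lemma mixed_span_sum w l s a : mixed_span w a -> mixed_span (s.+1 + w) (divden l s.+1 (sum_lt a)).
Proof.
move=> La; rewrite addSnnS.
by apply: qspan_ext (mixed_span_div l s (mixed_span_sum1 l La)) => n; rewrite divden_add addn1.
Qed.

Lemma mixed_span_sumle w l s a : mixed_span w a -> mixed_span (s.+1 + w) (divden l s.+1 (sum_le a)).
Proof.
move=> La; apply: (@qspan_ext _ _ (fun n => divden l s.+1 (sum_lt a) n + divden l s.+1 a n)).
  by move=> n; rewrite /divden sum_leE mulrDl.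
by apply: qspanD; [exact: mixed_span_sum|exact: mixed_span_div].
Qed.

Definition wordseq w n := xword R w (2 * n + parity w).

Lemma wordseq_cons x w : (forall n, wordseq (x :: w) n = divden (form_of (parity (x :: w))) 1
  (match x with Lcot => wordseq w | Ltan => sum_lt (wordseq w) | Lsec => if parity w then sum_lt (wordseq w) else sum_le (wordseq w) end) n).
Proof.
move=> n; rewrite /divden expr1 den_form /wordseq; case: x.
- by rewrite [parity (_ :: _)]/= xword_cot.
- by rewrite [parity (_ :: _)]/= xword_tan.
- rewrite [parity (_ :: _)]/=; case E: (parity w).
    by rewrite xword_sec1.
  by rewrite xword_sec0.
Qed.

Lemma wordseq_nil n : wordseq [::] n = delta0 n.
Proof. by rewrite /wordseq /= /delta0 addn0 muln_eq0. Qed.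

Lemma mixed_span_xw w : mixed_span (size w) (wordseq w).
Proof.
elim: w => [|x w IH].
  apply: qspan_ext (fun n => esym (wordseq_nil n)) _.
  by apply: qspan_gen; exists 0%N => //; exact: mixed_seq_delta0.
apply: qspan_ext (fun n => esym (wordseq_cons x w n)) _.
case: x => /=; [exact: (mixed_span_div _ 1 IH)|exact: (mixed_span_sum _ 0 IH)|].
by case: (parity w); [exact: (mixed_span_sum _ 0 IH)|exact: (mixed_span_sumle _ 0 IH)].
Qed.

(** A shift moves inwards through the letters, turning 2n+1 into 2n-1 and removing the last term of
    each strict sum. At the first [Lsec], which an odd word must contain, a weak sum becomes a
    strict one of the unshifted sequence and the shift is gone. *)
Lemma mixed_span_shift_xw w : parity w = true -> mixed_span (size w) (shiftS (wordseq w)).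
Proof.
elim: w => [//|x w IH] pw.
pose y := match x with Lcot => wordseq w | Ltan => sum_lt (wordseq w) | Lsec => if parity w then sum_lt (wordseq w) else sum_le (wordseq w) end.
apply: (@qspan_ext _ _ (divden OddPred 1 (shiftS y))).
  move=> n; rewrite divdenP_shift; case: n => [|n] //=.
  by rewrite wordseq_cons pw.
rewrite /y; case: x pw {y} => /= pw.
- exact: (mixed_span_div _ 1 (IH pw)).
- apply: (@qspan_ext _ _ (fun n => divden OddPred 1 (sum_lt (wordseq w)) n - divden OddPred 1 (shiftS (wordseq w)) n)).
    move=> n; rewrite /divden -mulrBl; congr (_ / _).
    by case: n => [|n] /=; rewrite ?sum_lt0 ?subr0// sum_ltS sum_leE addrK.
  by apply: qspanB; [exact: (mixed_span_sum _ 0 (mixed_span_xw w))|exact: (mixed_span_div _ 1 (IH pw))].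
- move: pw; case: (parity w) => // _.
  apply: (@qspan_ext _ _ (divden OddPred 1 (sum_lt (wordseq w)))); last exact: (mixed_span_sum _ 0 (mixed_span_xw w)).
  by move=> n; rewrite /divden; congr (_ / _); case: n => [|n] //=; rewrite sum_lt0.
Qed.

Lemma mixed_span_shift_Cs k a : word_span true k a -> mixed_span k (shiftS a).
Proof.
apply: qspan_map => [q f g n|f [w [_ <- pw hf]]]; first exact: shiftS_lin.
by apply: qspan_ext (mixed_span_shift_xw pw) => -[|n] //=; rewrite hf /wordseq pw.
Qed.

(** Normal form: all denominators before the next sum are collected, ready for partial fractions.
    There is at least one of them, so the inner sequence has smaller weight. *)
Lemma mixed_seq_cases w a : mixed_seq w a ->
  (exists x : rat, forall n, a n = ratr x * delta0 n) \/
  exists p q r w' c, [/\ mixed_seq w' c, (0 < p + q + r)%N, (p + q + r + w' = w)%N &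
    forall n, a n = mixden p q r (sum_lt c) n].
Proof.
elim=> {w a} [|w l a La [[x hx]|[p [q [r [w' [c [Lc pos sw hc]]]]]]]|w l a La _].
- by left; exists 1 => n; rewrite rmorph1 mul1r.
(* At n = 0 the three denominators are 0, 1 and -1, with [0^-1 = 0]. *)
- left; exists (x * (if l is Even then 0 else if l is OddSucc then 1 else -1)) => n.
  rewrite /divden hx expr1 rmorphM -[LHS]mulrA -[RHS]mulrA; congr (_ * _).
  case: n => [|n]; last by rewrite /delta0 /= mul0r mulr0.
  rewrite /delta0 eqxx mulr1 mul1r.
  case: l {La}; rewrite ?denE ?denO ?denP muln0 ?add0n ?sub0r ?invr0 ?invr1 ?rmorph0 ?rmorph1 ?rmorphN1 ?invrN1//.
- right; case: l.
  + exists p.+1, q, r, w', c; split => //; first by rewrite -sw; lia.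
    by move=> n; rewrite -(mixden_mm 1 0 0) mixdenE /divden hc.
  + exists p, q.+1, r, w', c; split => //; [by lia|by rewrite -sw; lia|].
    by move=> n; rewrite -(mixden_mm 0 1 0) mixdenO /divden hc.
  + exists p, q, r.+1, w', c; split => //; [by lia|by rewrite -sw; lia|].
    by move=> n; rewrite -(mixden_mm 0 0 1) mixdenP /divden hc.
- right; case: l.
  + by exists 1%N, 0%N, 0%N, w, a; split => // n; rewrite mixdenE.
  + by exists 0%N, 1%N, 0%N, w, a; split => // n; rewrite mixdenO.
  + by exists 0%N, 0%N, 1%N, w, a; split => // n; rewrite mixdenP.
Qed.

(** * Partial-fraction reduction for an abstract weight-indexed family *)

Section Reduction.
Variables (G : nat -> (nat -> R) -> Prop) (t : nat) (beta : bool).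
Hypothesis Glin : forall W q a c, G W a -> G W c -> G W (fun n => ratr q * a n + c n).
Hypothesis Gext : forall W a c, (forall n, a n = c n) -> G W a -> G W c.
Hypothesis Gsub : forall W W' a, (W <= W')%N -> G W a -> G W' a.
Hypothesis Gdelta : forall W, G W delta0.
Hypothesis Gzero : forall W, G W (fun=> 0).

(** [t] is the number of denominators required in front of a sum, and [beta] says whether a pure
    power of 2n-1 costs one extra weight. The uses are t = 1 without bonus for membership in
    [class_span], and t = 2 with bonus for summability. *)
Definition bonus p q : nat := [&& p == 0%N, q == 0%N & beta].

Definition pure_cases c k : Prop :=
  [/\ forall s, (t <= s)%N -> G (s + k) (divden Even s c),
      forall s, (t <= s)%N -> G (s + k) (divden OddSucc s c) &
      forall s, (t <= s)%N -> G (s + k + beta) (divden OddPred s c)].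

Definition mixed_pairs c k : Prop :=
  [/\ G (2 + k) (mixden 1 1 0 c), G (2 + k) (mixden 1 0 1 c) & G (2 + k) (mixden 0 1 1 c)].

Lemma bonus_le1 p q : (bonus p q <= 1)%N.
Proof. exact: leq_b1. Qed.

(** Each splitting removes one denominator, which leaves room for the bonus that a resulting power
    of 2n-1 may carry; so only an initial pure power exceeds the weight. For t = 2 two different
    denominators cannot be split without falling below the threshold, whence [mixed_pairs]. *)
Lemma mixed_reduce c k : (0 < t <= 2)%N -> c 0%N = 0 -> pure_cases c k ->
  (t = 2%N -> mixed_pairs c k) ->
  forall p q r, (t <= p + q + r)%N -> G (p + q + r + k + bonus p q) (mixden p q r c).
Proof.
move=> t12 c0 [pE pO pP] h2 p q r.
move: {2}(p + q + r)%N (leqnn (p + q + r)) => M; elim: M p q r => [|M IH] p q r leM let_.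
  by move: leM let_ t12; lia.
have IH' p' q' r' : (p' + q' + r').+1 = (p + q + r)%N -> (t <= p' + q' + r')%N ->
    G (p + q + r + k) (mixden p' q' r' c).
  move=> e l'; have b := bonus_le1 p' q'.
  by apply: Gsub (IH p' q' r' _ l'); move: leM; lia.
have small p' q' r' : (p' + q' + r').+1 = (p + q + r)%N -> (2 <= p + q + r)%N ->
    (t <= p' + q' + r')%N \/ (t = 2%N /\ (p + q + r = 2)%N).
  by move: let_ t12; lia.
have fin W a : G W a -> (W = p + q + r + k)%N -> G (p + q + r + k + bonus p q) a.
  by move=> Ga e; apply: Gsub Ga; rewrite e leq_addr.
case: p q r leM let_ IH' small fin => [|p] [|q] [|r] leM let_ IH' small fin.
- by move: let_ t12; lia.
- rewrite /bonus /= add0n; apply: Gext (pP _ let_) => n; by rewrite mixdenP.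
- apply: fin; last reflexivity; rewrite addn0 add0n; apply: Gext (pO q.+1 _) => [n|].
    by rewrite mixdenO.
  by move: let_; rewrite addn0.
- apply: fin; last reflexivity.
  have [l1|[t2 e]] := small 0%N q.+1 r ltac:(lia) ltac:(lia).
    apply: Gext (fun n => esym (mixden_OP 0 q r n c0)) _.
    apply: Glin; first by apply: IH' => //; lia.
    by apply: Glin; [apply: IH'; lia | exact: Gzero].
  have [q0 r0] : q = 0%N /\ r = 0%N by lia.
  by subst q r; case: (h2 t2).
- apply: fin; last reflexivity; rewrite !addn0; apply: Gext (pE p.+1 _) => [n|].
    by rewrite mixdenE.
  by move: let_; rewrite !addn0.
- apply: fin; last reflexivity.
  have [l1|[t2 e]] := small p 0%N r.+1 ltac:(lia) ltac:(lia).
    apply: Gext (fun n => esym (mixden_EP p 0 r n c0)) _.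
    by apply: Glin; apply: IH'; lia.
  have [p0 r0] : p = 0%N /\ r = 0%N by lia.
  by subst p r; case: (h2 t2).
- apply: fin; last reflexivity.
  have [l1|[t2 e]] := small p q.+1 0%N ltac:(lia) ltac:(lia).
    apply: Gext (fun n => esym (mixden_EO p q 0 n c0)) _.
    by apply: Glin; apply: IH'; lia.
  have [p0 q0] : p = 0%N /\ q = 0%N by lia.
  by subst p q; case: (h2 t2).
- apply: fin; last reflexivity.
  have l1 : (t <= p + q.+1 + r.+1)%N by move: t12; lia.
  apply: Gext (fun n => esym (mixden_EO p q r.+1 n c0)) _.
  by apply: Glin; apply: IH'; lia.
Qed.

Lemma G_rat_delta W x a : (forall n, a n = ratr x * delta0 n) -> G W a.
Proof.
move=> h; apply: Gext (Glin x (Gdelta W) (Gzero W)) => n; by rewrite h addr0.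
Qed.

Lemma mixden_delta p q r x a : (forall n, a n = ratr x * delta0 n) ->
  exists y, forall n, mixden p q r a n = ratr y * delta0 n.
Proof.
move=> h; exists (x * (if p is 0 then (-1) ^+ r else 0)) => n.
rewrite /mixden h rmorphM -[LHS]mulrA -[RHS]mulrA; congr (_ * _).
case: n => [|n]; last by rewrite /delta0 /= mul0r mulr0.
rewrite /delta0 eqxx mulr1 mul1r denE denO denP muln0 add0n sub0r expr1n mulr1.
case: p => [|p]; last by rewrite exprS mul0r mul0r invr0 rmorph0.
by rewrite expr0 mul1r rmorphXn rmorphN1 -exprVn invrN1.
Qed.

(** The threshold drops by one because a sequence of the span brings a denominator of its own,
    unless it is a multiple of [delta0]. *)
Definition inner_hyp w := forall y k, mixed_span k y -> (k <= w)%N -> forall p q r,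
  (t <= (p + q + r).+1)%N -> G (p + q + r + k + bonus p q) (mixden p q r y).

Hypothesis t12 : (0 < t <= 2)%N.
Hypothesis step : forall w a, mixed_seq w a -> inner_hyp w ->
  pure_cases (sum_lt a) w /\ (t = 2%N -> mixed_pairs (sum_lt a) w).

(** Strong induction on the weight. [inner_hyp] at w follows from smaller weights, since the normal
    form merges the denominators of the inner sequence with those in front. *)
Lemma mm_sum_lt_in w a : mixed_seq w a -> forall p q r, (t <= p + q + r)%N ->
  G (p + q + r + w + bonus p q) (mixden p q r (sum_lt a)).
Proof.
elim/ltn_ind: w a => w IH a La.
suff H : inner_hyp w.
  by have [h1 h2] := step La H; apply: mixed_reduce => //; exact: sum_lt0.
move=> y k Ly kw p q r tp.
elim: Ly => {y} [y y0|x f g y [k' k'k Lf] _ IHg hy].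
  by apply: Gext (Gzero _) => n; rewrite /mixden y0 mul0r.
apply: (@Gext _ (fun n => ratr x * mixden p q r f n + mixden p q r g n)).
  move=> n; rewrite -mixden_lin /mixden hy//.
apply: Glin => //.
have [[z hz]|[p' [q' [r' [w' [c [Lc pos sw hc]]]]]]] := mixed_seq_cases Lf.
  have [z' hz'] := mixden_delta p q r hz.
  exact: G_rat_delta hz'.
apply: (@Gext _ (mixden (p + p') (q + q') (r + r') (sum_lt c))).
  by move=> n; rewrite -mixden_mm /mixden hc.
have := IH w' _ c Lc (p + p')%N (q + q')%N (r + r')%N _.
have b : (bonus (p + p') (q + q') <= bonus p q)%N.
  by rewrite /bonus !addn_eq0; case: (p == 0%N); case: (q == 0%N); case: (p' == 0%N); case: (q' == 0%N); case: beta.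
by move=> H; apply: Gsub (H _ _); move: b pos sw k'k kw tp; lia.
Qed.

Lemma mixden_LL_in k y : mixed_span k y -> forall p q r,
  (t <= (p + q + r).+1)%N -> G (p + q + r + k + bonus p q) (mixden p q r y).
Proof.
move=> Ly p q r tp.
elim: Ly => {y} [y y0|x f g y [k' k'k Lf] _ IHg hy].
  by apply: Gext (Gzero _) => n; rewrite /mixden y0 mul0r.
apply: (@Gext _ (fun n => ratr x * mixden p q r f n + mixden p q r g n)).
  move=> n; rewrite -mixden_lin /mixden hy//.
apply: Glin => //.
have [[z hz]|[p' [q' [r' [w' [c [Lc pos sw hc]]]]]]] := mixed_seq_cases Lf.
  have [z' hz'] := mixden_delta p q r hz.
  exact: G_rat_delta hz'.
apply: (@Gext _ (mixden (p + p') (q + q') (r + r') (sum_lt c))).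
  by move=> n; rewrite -mixden_mm /mixden hc.
have := mm_sum_lt_in Lc (p := p + p') (q := q + q') (r := r + r').
have b : (bonus (p + p') (q + q') <= bonus p q)%N.
  by rewrite /bonus !addn_eq0; case: (p == 0%N); case: (q == 0%N); case: (p' == 0%N); case: (q' == 0%N); case: beta.
by move=> H; apply: Gsub (H _); move: b pos sw k'k tp; lia.
Qed.

End Reduction.

End MixedDenominators.

(** * Parts (c) and (d) *)

Section Regularization.
Variable R : realType.
Implicit Types (a c f g : nat -> R).
Local Notation C := R[i].

Definition weight_le W : set C := span_over (Qi R) (CMZV4_le R W).

Definition CMZV_b (l : linform) k : set C :=
  scale_set ('i%C ^+ delta l) (add_set (CMZV4 R k) (scale_set (nu l)%:R (CMZV4 R k.+1))).

Lemma Qi_rat (q : rat) : Qi R (ratr q).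
Proof. by exists q => //; exists 0 => //; rewrite rmorph0 mulr0 addr0. Qed.

Lemma Qi_i : Qi R 'i%C.
Proof. by exists 0 => //; exists 1 => //; rewrite rmorph0 rmorph1 mulr1 add0r. Qed.

Lemma Qi_mul x y : Qi R x -> Qi R y -> Qi R (x * y).
Proof.
move=> [a _ [b _ <-]] [c _ [d _ <-]].
exists (a * c - b * d) => //; exists (a * d + b * c) => //.
rewrite rmorphB rmorphD !rmorphM.
have -> : (ratr a + 'i%C * ratr b) * (ratr c + 'i%C * ratr d) =
  ratr a * ratr c + 'i%C ^+ 2 * (ratr b * ratr d) + 'i%C * (ratr a * ratr d + ratr b * ratr c) :> C by ring.
by rewrite sqr_i mulN1r.
Qed.

Lemma weight_le_lin W z x y : Qi R z -> weight_le W x -> weight_le W y ->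
  weight_le W (z * x + y).
Proof.
move=> hz [t ht ->] [t' ht' ->].
exists ([seq (z * p.1, p.2) | p <- t] ++ t').
  move=> p; rewrite mem_cat => /orP[/mapP[p' p't ->]|/ht'//].
  by have [h hV] := ht _ p't; split => //=; exact: Qi_mul.
rewrite big_cat big_map /= mulr_sumr; congr (_ + _).
by apply: eq_bigr => p _; rewrite mulrA.
Qed.

Lemma weight_le0 W : weight_le W 0. Proof. exact: span_over0. Qed.

Lemma weight_le_gen W k x : (k <= W)%N -> CMZV4 R k x -> weight_le W x.
Proof.
move=> kW Vx; exists [:: (1, x)]; last by rewrite big_seq1 mul1r.
move=> p; rewrite inE => /eqP -> /=; split.
  by have := Qi_rat 1; rewrite rmorph1.
exists (fun j => if j == k then x else 0).
  by move=> j _; case: eqP => [->//|_]; exact: CMZV4_0.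
have kW1 : (k < W.+1)%N by [].
rewrite (bigD1 (Ordinal kW1))//= eqxx big1 ?addr0// => j.
by rewrite -val_eqE /= => /negbTE ->.
Qed.

Lemma weight_le_sub W W' : (W <= W')%N -> weight_le W `<=` weight_le W'.
Proof.
move=> WW' x [t ht ->]; exists t => // p pt; have [h [v hv ->]] := ht _ pt; split => //.
exists (fun k => if (k <= W)%N then v k else 0).
  by move=> k _; case: ifP => [/hv//|_]; exact: CMZV4_0.
rewrite -(big_mkord xpredT v) -(big_mkord xpredT (fun k => if (k <= W)%N then v k else 0)).
rewrite [RHS](big_cat_nat (n := W.+1))//= [X in _ + X]big_nat_cond [X in _ + X]big1 ?addr0; last first.
  by move=> k /andP[/andP[Wk _] _]; rewrite leqNgt Wk.
rewrite [LHS]big_nat_cond [RHS]big_nat_cond; apply: eq_bigr => k /andP[/andP[_ kW] _].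
by rewrite -ltnS kW.
Qed.

Lemma CMZV_b_weight_le l k : CMZV_b l k `<=` weight_le (k + nu l).
Proof.
move=> _ [_ [v Vv [_ [v' Vv' <-] <-]] <-].
have Qd : Qi R ('i%C ^+ delta l).
  case: l => /=; rewrite ?expr0 ?expr1; try exact: Qi_i.
  by have := Qi_rat 1; rewrite rmorph1.
rewrite -[_ * _]addr0; apply: weight_le_lin => //; last exact: weight_le0.
rewrite -[v]mul1r; apply: weight_le_lin.
- by have := Qi_rat 1; rewrite rmorph1.
- by apply: weight_le_gen Vv; exact: leq_addr.
- case: l {Qd} => /=; rewrite ?mul0r; try exact: weight_le0.
  by rewrite mul1r; apply: weight_le_gen Vv'; rewrite addn1.
Qed.

(** For 2m-1 the shift replaces b_(n+1) by b_n + b_n/(2n+1); the second summand has one more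
    denominator, hence weight k+2. *)
Lemma summable_in_class_b l k a : class_b l k a -> summable_in (CMZV_b l k.+1) (divden l 1 a).
Proof.
have Z v : add_set (CMZV4 R k.+1) (scale_set 0 (CMZV4 R k.+2)) v <-> CMZV4 R k.+1 v.
  split=> [[x Vx [_ [y _ <-] <-]]|Vv]; first by rewrite mul0r addr0.
  by exists v => //; exists 0; rewrite ?addr0//; exists 0; rewrite ?mul0r//; exact: CMZV4_0.
case: l => Ha.
- apply: summable_in_sub (summable_in_Cs Ha) => _ [v Vv <-]; exists v => //; exact/Z.
- apply: summable_in_sub (summable_in_Cs Ha) => _ [v Vv <-]; exists v => //; exact/Z.
- case: Ha => c Cc hc.
  apply: (@eq_summable_in _ _ (shiftS (divden OddSucc 1 c))).
    by move=> n; rewrite -divdenP_shift /divden hc.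
  apply: summable_in_shift.
  have [S hS [v Vv ev]] := summable_in_Cs Cc.
  have [T hT [u Vu eu]] := summable_in_Cs (word_span_div Cc).
  exists (1 * S + T).
    rewrite (_ : rsum _ = fun N => 1 * rsum (divden OddSucc 1 c) N + rsum (divden OddSucc 1 (divden OddSucc 1 c)) N).
      by apply: cvgD => //; apply: cvgMr.
    by apply/funext => N; rewrite -rsum_lin; apply: eq_bigr => n _; rewrite mul1r.
  rewrite mul1r rmorphD /= -ev -eu -mulrDr; exists (v + u) => //.
  by exists v => //; exists u => //; exists u => //; rewrite mul1r.
Qed.

Definition class_span w := qspan (fun a => exists k l, (k <= w)%N /\ class_b l k a).

Lemma class_span_sub w w' a : (w <= w')%N -> class_span w a -> class_span w' a.
Proof.
move=> ww'; apply: qspan_sub => f [k [l [kw h]]]; apply: qspan_gen; exists k, l.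
by split => //; exact: leq_trans ww'.
Qed.

(** * Sums with a single kind of denominator in front *)

Section Pure.
Variables (G : nat -> (nat -> R) -> Prop) (t : nat) (beta : bool).
Hypothesis Glin : forall W q a c, G W a -> G W c -> G W (fun n => ratr q * a n + c n).
Hypothesis Gext : forall W a c, (forall n, a n = c n) -> G W a -> G W c.
Hypothesis Gsub : forall W W' a, (W <= W')%N -> G W a -> G W' a.
Hypothesis Gzero : forall W, G W (fun=> 0).
Hypothesis Gclass : forall l l' s k f, class_b l' k f -> (l' = OddPred -> l <> Even) ->
  (t <= s)%N -> G (s + k + (if l is OddPred then beta : nat else 0)) (divden l s (if l is OddSucc then sum_le f else sum_lt f)).

Lemma G_qspan (P : (nat -> R) -> Prop) (T : (nat -> R) -> nat -> R) W :
  (forall q f g n, T (fun k => q * f k + g k) n = q * T f n + T g n) ->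
  (forall f, P f -> G W (T f)) -> forall a, qspan P a -> G W (T a).
Proof.
move=> Tl TP.
have T0 n : T (fun=> 0) n = 0.
  have := Tl (-1) (fun=> 0) (fun=> 0) n.
  rewrite (_ : (fun k => _) = fun=> 0); last by apply/funext => k; rewrite mulr0 addr0.
  by rewrite mulN1r addNr.
move=> a; elim=> {a} [a a0|q f g a Pf _ IH ha].
  apply: Gext (Gzero W) => n.
  by have -> : a = (fun=> 0) by [apply/funext]; rewrite T0.
apply: Gext (Glin q (TP _ Pf) IH) => n; rewrite -Tl; congr (T _ n).
exact/funext.
Qed.

(** [class_b_step] covers everything except 2n over a shifted sequence and a strict sum under 2n+1.
    Both are repaired by a term without the sum, to which [inner_hyp] applies. *)
Lemma pure_from w a : (0 < t)%N -> class_span w a -> mixed_span w a -> inner_hyp G t beta w ->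
  pure_cases G t beta (sum_lt a) w.
Proof.
move=> t0 Za La Hin; split => s ts.
- move: Za; apply: (@G_qspan _ (fun a => divden Even s (sum_lt a))) => [q f g n|f [k [l [kw hf]]]].
    by rewrite -divden_lin /divden sum_lt_lin.
  case: l hf => [hf|hf|[c Cc hc]].
  + by have := Gclass (l := Even) hf (fun e => ltac:(discriminate e)) ts; apply: Gsub; rewrite addn0 leq_add2l.
  + by have := Gclass (l := Even) hf (fun e => ltac:(discriminate e)) ts; apply: Gsub; rewrite addn0 leq_add2l.
  (* The shifted strict sum is sum_lt c n - c (n-1). The subtracted shift is itself a mixed
     sequence, now over 2n. *)
  + apply: (@Gext _ (fun n => ratr (-1) * divden Even s (shiftS c) n + divden Even s (sum_lt c) n)).
      have -> : f = shiftS c by apply/funext.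
      move=> n; rewrite rmorphN1 -divden_lin /divden sum_lt_shift; congr (_ / _).
      by case: n => [|n] /=; rewrite ?sum_lt0 ?sum_ltS ?sum_leE; ring.
    apply: Glin.
      have := Hin _ _ (mixed_span_shift_Cs Cc) kw s 0%N 0%N.
      rewrite !addn0 => H; apply: Gsub (Gext _ (H _)).
      * rewrite /bonus; case: s ts {H} => [|s] ts; first by move: ts t0; case: t.
        by rewrite addn0 leq_add2l.
      * by move=> n; rewrite mixdenE.
      * exact: leq_trans ts _.
    have := Gclass (l := Even) (l' := OddSucc) Cc (fun e => ltac:(discriminate e)) ts.
    by apply: Gsub; rewrite addn0 leq_add2l.
- apply: (@Gext _ (fun n => ratr (-1) * divden OddSucc s a n + divden OddSucc s (sum_le a) n)).
    by move=> n; rewrite rmorphN1 -divden_lin /divden sum_leE; congr (_ / _); ring.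
  apply: Glin.
    have := Hin _ _ La (leqnn w) 0%N s 0%N.
    rewrite !addn0 !add0n => H; apply: Gsub (Gext _ (H _)).
    + rewrite /bonus; case: s ts {H} => [|s] ts; first by move: ts t0; case: t.
      by rewrite addn0.
    + by move=> n; rewrite mixdenO.
    + exact: leq_trans ts _.
  move: Za; apply: (@G_qspan _ (fun a => divden OddSucc s (sum_le a))) => [q f g n|f [k [l [kw hf]]]].
    by rewrite -divden_lin /divden sum_le_lin.
  by have := Gclass (l := OddSucc) hf (fun _ e => ltac:(discriminate e)) ts; apply: Gsub; rewrite addn0 leq_add2l.
- move: Za; apply: (@G_qspan _ (fun a => divden OddPred s (sum_lt a))) => [q f g n|f [k [l [kw hf]]]].
    by rewrite -divden_lin /divden sum_lt_lin.
  by have := Gclass (l := OddPred) hf (fun _ e => ltac:(discriminate e)) ts; apply: Gsub; rewrite leq_add2r leq_add2l.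
Qed.

End Pure.

(** First run of the reduction: no convergence is involved, and one denominator in front of a sum is
    all that [class_b_step] asks for. *)
Lemma Zs_mixed_span w a : mixed_span w a -> class_span w a.
Proof.
have H := @mixden_LL_in R class_span 1 false.
move=> La.
have := H _ _ _ _ _ isT _ w a La 0%N 0%N 0%N isT.
rewrite !add0n /bonus /= addn0 => K.
apply: qspan_ext (K _ _ _ _ _ _) => {K}.
- by move=> n; rewrite /mixden !expr0 !mulr1 divr1.
- by move=> W q f g; exact: qspan_lin.
- by move=> W f g; exact: qspan_ext.
- exact: class_span_sub.
- by move=> W; apply: qspan_gen; exists 0%N, Even; split => //; exact: word_span_delta0.
- by move=> W; exact: qspan_nil.
move=> {a La H} w' a La Hin; split => //.
have La' : mixed_span w' a by apply: qspan_gen; exists w'.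
apply: pure_from => //.
- by move=> W q f g; exact: qspan_lin.
- by move=> W f g; exact: qspan_ext.
- exact: class_span_sub.
- by move=> W; exact: qspan_nil.
- move=> l l' [//|s] k f hf hl _; apply: qspan_gen; exists (s.+1 + k)%N, l.
  by split; [exact: leq_addr|exact: class_b_step hf hl].
- have := Hin a w' La' (leqnn _) 0%N 0%N 0%N isT; rewrite !add0n /bonus /= addn0.
  by apply: qspan_ext => n; rewrite /mixden !expr0 !mulr1 divr1.
Qed.

(** * Growth estimates and the boundary term *)

Lemma den_ge l n : (0 < n)%N -> n%:R <= den R l n.
Proof.
case: n => // n _; case: l; rewrite ?denE ?denO ?denPS ?denO ler_nat; lia.
Qed.

Lemma mixed_seq_growth w a : mixed_seq w a -> exists B, quarter_bound (fun n => (a n)%:C%C) B.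
Proof.
elim=> {w a} [|w l a _ [B hB]|w l a _ [B hB]].
- exists 1 => n; have := @quarter_bound_delta0 R n.
  by rewrite /delta0 -(rmorph_nat (real_complex R)).
- exists B => n; apply: le_trans (hB n); rewrite !nrm_real /divden expr1 normrM.
  rewrite ler_piMr// normfV.
  have [->|dn] := eqVneq (den R l n) 0; first by rewrite normr0 invr0.
  rewrite invf_le1 ?normr_gt0//.
  case: n dn => [|n] dn.
    case: l dn; rewrite ?denE ?denO ?denP muln0 ?add0n ?sub0r ?normrN ?normr1// ?eqxx//.
  apply: le_trans (ler_norm _); apply: le_trans (den_ge l (ltn0Sn n)).
  by rewrite ler1n.
- exists (32 * B); apply: (quarter_bound_step hB) => m.
  rewrite -rmorph_sum !nrm_real /divden expr1 normrM -/(sum_lt a m).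
  case: m => [|m]; first by rewrite sum_lt0 normr0 !mul0r.
  rewrite ler_wpM2l// normfV.
  have h := den_ge l (ltn0Sn m).
  have h0 : 0 < den R l m.+1 by apply: lt_le_trans h; rewrite ltr0n.
  by rewrite gtr0_norm// lef_pV2 ?posrE// ltr0n.
Qed.

(** The true growth is b_n^2 ~ pi n; the constant 4 is exact at n = 1 and survives the induction
    since 4n(n+1) <= (2n+1)^2. *)
Lemma bcoefR_sqr n : bcoefR R n.+1 ^+ 2 <= 4 * n.+1%:R.
Proof.
elim: n => [|n IH].
  by rewrite bcoefRS bcoefR0 muln0 !add0n divr1 mul1r mulr1 -natrX ler_nat.
rewrite bcoefRS.
have -> : (2 * n.+1 + 2)%:R = 2 * n.+2%:R :> R by rewrite -natrM; congr _%:R; lia.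
have x0 : 0 < (2 * n.+1 + 1)%:R :> R by rewrite ltr0n addn1.
rewrite expr_div_n exprMn ler_pdivrMr ?exprn_gt0//.
apply: (@le_trans _ _ (4 * n.+1%:R * (2 * n.+2%:R) ^+ 2)).
  by rewrite ler_wpM2r// exprn_ge0// mulr_ge0.
by rewrite -!natrX -!natrM -natrX -natrM ler_nat; nia.
Qed.

Lemma bcoefR_root4 n : bcoefR R n.+1 <= 2 * root4 R n.+1 ^+ 2.
Proof.
have h1 : 0 <= bcoefR R n.+1 := ltW (@bcoefR_gt0 R _).
have h2 : 0 <= 2 * root4 R n.+1 ^+ 2 by rewrite mulr_ge0// exprn_ge0// root4_ge0.
rewrite -(@ler_pXn2r _ 2)//.
by apply: le_trans (bcoefR_sqr n) _; rewrite exprMn -exprM root4X -natrX.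
Qed.

(** The three factors are O(n^(1/2)), O(n^(1/4)) and O(1/n), so the product is O(n^(-1/4)). *)
Lemma boundary_cvg0 w a : mixed_seq w a ->
  (fun N => bcoefR R N * divden Even 1 (sum_lt a) N) @ \oo --> 0.
Proof.
move=> /mixed_seq_growth[B hB]; rewrite -cvg_shiftS.
have B0 := quarter_bound_ge0 hB.
apply/cvgrPdist_le => e e0.
have e1 : 0 < e / (4 * B + 1) by rewrite divr_gt0// ltr_wpDl// mulr_ge0.
have /cvgrPdist_le/(_ _ e1) H := @root4V_cvg R.
apply: filterS H => n; rewrite !sub0r !normrN.
have r0 := root4_gt0 R n.
rewrite ger0_norm ?invr_ge0 ?root4_ge0// ler_pdivlMr ?ltr_wpDl ?mulr_ge0//.
apply: le_trans.
have hS := quarter_bound_sum n.+1 hB.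
rewrite -rmorph_sum nrm_real -/(sum_lt a n.+1) in hS.
rewrite /= /divden expr1.
have y0 := @bcoefR_gt0 R n.+1; have hy := bcoefR_root4 n.
move: (bcoefR R n.+1) y0 hy => y y0 hy.
have d0 : 0 < den R Even n.+1 by rewrite denE ltr0n.
rewrite normrM normrM normfV (gtr0_norm y0) (gtr0_norm d0) denE natrM -(root4X R n.+1).
apply: (@le_trans _ _ (2 * root4 R n.+1 ^+ 2 * (4 * B * root4 R n.+1 / (2 * root4 R n.+1 ^+ 4)))).
  have z0 : 0 <= (2 * root4 R n.+1 ^+ 4)^-1.
    by rewrite invr_ge0 mulr_ge0// exprn_ge0// ltW.
  by apply: ler_pM => //; [exact: ltW|exact: mulr_ge0|rewrite ler_wpM2r].
move: (root4 R n.+1) r0 => x x0.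
rewrite (_ : _ * _ = 4 * B / x); last by field; rewrite gt_eqF.
by rewrite mulrC ler_wpM2l ?lerDl// invr_ge0 ltW.
Qed.

(* Summation by parts with b_(n+1) - b_n = b_n / (2n+1): the divergent sums of
   [b_n/(2n)] and [b_n/(2n+1)] cancel up to a boundary term. *)
Lemma rsum_EO a N : rsum (mixden 1 1 0 (sum_lt a)) N =
  rsum (divden OddSucc 1 a) N - bcoefR R N * divden Even 1 (sum_lt a) N.
Proof.
elim: N => [|N IH]; first by rewrite /rsum !big_nil /divden sum_lt0; ring.
rewrite /rsum !big_nat_recr//= -/(rsum _ N) -/(rsum _ N) IH.
rewrite /divden /mixden !expr1 expr0 mulr1 sum_ltS sum_leE bcoefRS denO !denE.
have -> : (2 * N.+1)%:R = (2 * N + 1)%:R + 1 :> R by rewrite natr1; congr _%:R; lia.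
have -> : (2 * N + 2)%:R = (2 * N + 1)%:R + 1 :> R by rewrite natr1 addn1 addn2.
have y0 : (2 * N + 1)%:R + 1 != 0 :> R by rewrite natr1 pnatr_eq0.
have x0 : (2 * N + 1)%:R != 0 :> R by rewrite pnatr_eq0 addn1.
case: N {IH} x0 y0 => [|N] x0 y0.
  by rewrite sum_lt0 !mul0r; move: (rsum _ _) (bcoefR R 0) (a 0%N) ((2 * 0 + 1)%:R : R) x0 y0 => p q r x x0 y0; field; rewrite x0 y0.
have z0 : (2 * N.+1)%:R != 0 :> R by rewrite pnatr_eq0 mulnS.
have e : (2 * N.+1 + 1)%:R = (2 * N.+1)%:R + 1 :> R by rewrite natrD.
move: x0 y0; rewrite e.
move: (rsum _ _) (bcoefR R _) (a _) (sum_lt a _) ((2 * N.+1)%:R : R) z0 => p q r s x x0 y0 z0.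
by field; rewrite x0 y0 z0.
Qed.

(** Index shift: b_(n+1)/((2n+2)(2n+1)) = b_n/(2n+1)^2, and the strict range becomes weak. *)
Lemma rsum_EP a N : rsum (mixden 1 0 1 (sum_lt a)) N.+1 = rsum (divden OddSucc 2 (sum_le a)) N.
Proof.
rewrite /rsum big_nat_recl//= {1}/mixden sum_lt0 mul0r mulr0 add0r; apply: eq_bigr => n _.
rewrite /mixden /divden !expr1 expr0 mulr1 sum_ltS denPS denE bcoefRS denO.
rewrite (_ : 2 * n.+1 = 2 * n + 2)%N; last by lia.
have : (2 * n + 2)%:R != 0 :> R by rewrite pnatr_eq0 addn2.
have : (2 * n + 1)%:R != 0 :> R by rewrite pnatr_eq0 addn1.
move: ((2 * n + 2)%:R : R) ((2 * n + 1)%:R : R) => x y y0 x0.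
by field; rewrite x0 y0.
Qed.

(** * Summability with bounded weight *)

Definition summable_le W a := summable_in (weight_le W) a.

Lemma summable_le_lin W q a c : summable_le W a -> summable_le W c -> summable_le W (fun n => ratr q * a n + c n).
Proof.
by move=> Ga Gc; apply: summable_in_lin => // x y; apply: weight_le_lin; exact: Qi_rat.
Qed.

Lemma summable_le_sub W W' a : (W <= W')%N -> summable_le W a -> summable_le W' a.
Proof. by move=> h; apply: summable_in_sub; exact: weight_le_sub. Qed.

Lemma summable_le_zero W : summable_le W (fun=> 0).
Proof. by apply: Good0 => //; exact: weight_le0. Qed.

Lemma summable_le_delta0 W : summable_le W delta0.
Proof.
exists 1.
  rewrite -cvg_shiftS (_ : [sequence _]_n = fun=> 1); first exact: cvg_cst.
  apply/funext => n; rewrite /= /rsum big_nat_recl//= big1 ?addr0 ?bcoefR0 ?mul1r//.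
  by move=> i _; rewrite /delta0 /= mulr0.
rewrite rmorph1; apply: (@weight_le_gen W 0) => //.
by exists 1 => //; rewrite rmorph1.
Qed.

(** One of the s >= 2 denominators is consumed by the outermost integration, and at least one must
    remain for [class_b_step]. *)
Lemma summable_le_class l l' s k f : class_b l' k f -> (l' = OddPred -> l <> Even) ->
  (2 <= s)%N -> summable_le (s + k + (if l is OddPred then true : nat else 0))
     (divden l s (if l is OddSucc then sum_le f else sum_lt f)).
Proof.
case: s => [|[|s]]// hf hl _.
have h := summable_in_class_b (class_b_step s hf hl).
apply: (@eq_summable_in _ _ (divden l 1 (divden l s.+1 (if l is OddSucc then sum_le f else sum_lt f)))).
  by move=> n; rewrite divden_add add1n.
apply: summable_in_sub h => x /CMZV_b_weight_le; apply: weight_le_sub.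
by case: (l).
Qed.

(** Among the mixed pairs, 2n with 2n+1 is summed by parts, 2n with 2n-1 by shifting the index, and
    2n+1 with 2n-1 reduces to these two. *)
Lemma summable_le_step w a : mixed_seq w a -> inner_hyp summable_le 2 true w ->
  pure_cases summable_le 2 true (sum_lt a) w /\ (2%N = 2%N -> mixed_pairs summable_le (sum_lt a) w).
Proof.
move=> La Hin.
have La' : mixed_span w a by apply: qspan_gen; exists w.
have Gext W f g : (forall n, f n = g n) -> summable_le W f -> summable_le W g by exact: eq_summable_in.
have P : pure_cases summable_le 2 true (sum_lt a) w.
  apply: (pure_from summable_le_lin Gext summable_le_sub summable_le_zero) => //; first exact: summable_le_class.
  exact: Zs_mixed_span.
split => // _; have [pE pO pP] := P.
have HO1 : summable_le (1 + w) (divden OddSucc 1 a).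
  apply: summable_le_sub (Gext _ _ _ (fun n => mixdenO 1 a n) (Hin a w La' (leqnn _) 0%N 1%N 0%N isT)).
  by rewrite /bonus /= addn0.
have HO2 : summable_le (2 + w) (divden OddSucc 2 a).
  apply: summable_le_sub (Gext _ _ _ (fun n => mixdenO 2 a n) (Hin a w La' (leqnn _) 0%N 2%N 0%N isT)).
  by rewrite /bonus /= addn0.
have EO : summable_le (2 + w) (mixden 1 1 0 (sum_lt a)).
  have [S hS VS] := summable_le_sub (leqnSn _) HO1; exists S => //.
  rewrite (_ : rsum _ = fun N => rsum (divden OddSucc 1 a) N - bcoefR R N * divden Even 1 (sum_lt a) N); last first.
    by apply/funext => N; exact: rsum_EO.
  by rewrite -[S]subr0; apply: cvgB => //; exact: boundary_cvg0 La.
have EP : summable_le (2 + w) (mixden 1 0 1 (sum_lt a)).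
  have [S hS VS] : summable_le (2 + w) (divden OddSucc 2 (sum_le a)).
    apply: Gext (summable_le_lin 1 HO2 (pO 2%N isT)) => n.
    by rewrite rmorph1 -divden_lin /divden sum_leE mul1r addrC.
  exists S => //; rewrite -cvg_shiftS.
  rewrite (_ : [sequence _]_n = rsum (divden OddSucc 2 (sum_le a)))//.
  by apply/funext => N; exact: rsum_EP.
split => //; apply: Gext (fun n => esym (mixden_OP2 n (sum_lt0 a))) _.
by apply: summable_le_lin => //; apply: summable_le_lin => //; exact: summable_le_zero.
Qed.

(** A weak sum is the strict sum plus the diagonal term; with s >= 2 the second run of the reduction
    applies to both. *)
Lemma GV_divden w l s a (b : bool) : mixed_span w a -> (2 <= s)%N ->
  summable_le (s + w + nu l) (divden l s (if b then sum_le a else sum_lt a)).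
Proof.
move=> La s2.
have Gext W f g : (forall n, f n = g n) -> summable_le W f -> summable_le W g by exact: eq_summable_in.
have A p q r : (2 <= (p + q + r).+1)%N -> summable_le (p + q + r + w + bonus true p q) (mixden p q r a).
  exact: (@mixden_LL_in R summable_le 2 true summable_le_lin Gext summable_le_sub summable_le_delta0 summable_le_zero isT summable_le_step w a La p q r).
have B p q r : (2 <= p + q + r)%N -> summable_le (p + q + r + w + bonus true p q) (mixden p q r (sum_lt a)).
  move=> h; move: La; apply: (@G_qspan summable_le summable_le_lin Gext summable_le_zero _ (fun a => mixden p q r (sum_lt a))).
    by move=> q' f g n; rewrite -mixden_lin /mixden sum_lt_lin.
  move=> f [k kw Lf].
  apply: summable_le_sub (@mm_sum_lt_in R summable_le 2 true summable_le_lin Gext summable_le_sub summable_le_delta0 summable_le_zero isT summable_le_step k f Lf p q r h).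
  by rewrite leq_add2r leq_add2l.
have A' : summable_le (s + w + nu l) (divden l s a).
  case: l.
  - apply: (summable_le_sub _ (Gext _ _ _ (fun n => mixdenE s a n) (A s 0%N 0%N _))); last by rewrite !addn0 ltnW.
    by case: s s2 {A B} => // s' _; rewrite /bonus /= ?add0n !addn0.
  - apply: (summable_le_sub _ (Gext _ _ _ (fun n => mixdenO s a n) (A 0%N s 0%N _))); last by rewrite !addn0 ltnW.
    by case: s s2 {A B} => // s' _; rewrite /bonus /= ?add0n !addn0.
  - apply: (summable_le_sub _ (Gext _ _ _ (fun n => mixdenP s a n) (A 0%N 0%N s _))); last by rewrite ltnW.
    by [].
have B' : summable_le (s + w + nu l) (divden l s (sum_lt a)).
  case: l {A'}.
  - apply: (summable_le_sub _ (Gext _ _ _ (fun n => mixdenE s _ n) (B s 0%N 0%N _))); last by rewrite !addn0.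
    by case: s s2 {A B} => // s' _; rewrite /bonus /= ?add0n !addn0.
  - apply: (summable_le_sub _ (Gext _ _ _ (fun n => mixdenO s _ n) (B 0%N s 0%N _))); last by rewrite !addn0.
    by case: s s2 {A B} => // s' _; rewrite /bonus /= ?add0n !addn0.
  - by apply: (summable_le_sub _ (Gext _ _ _ (fun n => mixdenP s _ n) (B 0%N 0%N s _))).
case: b => //; apply: Gext (summable_le_lin 1 A' B') => n.
by rewrite rmorph1 -divden_lin /divden sum_leE mul1r addrC.
Qed.

Lemma mixed_span_apery_seq d (s : 'I_d -> nat) l w : (forall j, (0 < s j)%N) ->
  mixed_span (\sum_(j < d) s j) (apery_seq R s l w).
Proof.
elim: d s l w => [|d IH] s l w s0.
  by rewrite big_ord0; apply: qspan_gen; exists 0%N => //; exact: mixed_seq_delta0.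
have IH' := IH _ (fun j => l (lift ord0 j)) (fun j => w (lift ord0 j)) (fun j => s0 (lift ord0 j)).
rewrite big_ord_recl; apply: qspan_ext (fun n => esym (@apery_seqS R d s l w n)) _.
have := s0 ord0; case: (s ord0) => // s1 _.
by case: (w ord0); [exact: mixed_span_sumle|exact: mixed_span_sum].
Qed.

(* Terms with a vanishing denominator contribute [0], in both sums. *)
Lemma apery_partialE d (d_gt0 : (0 < d)%N) s l w N : (0 < N)%N ->
  apery_partial R d_gt0 s l w N = (rsum (apery_seq R s l w) N)%:C%C.
Proof.
case: d d_gt0 s l w => // d d_gt0 s l w N0.
have e0 : Ordinal d_gt0 = ord0 by apply: val_inj.
pose phi (j : 'I_d.+1) n : R := (if j == ord0 then bcoefR R n else 1) * (den R (l j) n ^+ s j)^-1.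
have E n : bcoefR R n * apery_seq R s l w n = nest w phi n.
  rewrite /apery_seq /= /phi eqxx mulrA; congr (_ * _); apply: eq_bigr => k _.
  congr (nest _ _ _); apply/funext => j; apply/funext => m.
  by rewrite -(inj_eq val_inj) /= mul1r.
rewrite /rsum (eq_bigr _ (fun n _ => E n)) -(sum_chain _ _ xpredT N0) rmorph_sum.
rewrite /apery_partial e0; apply: eq_big => [n|n _]; first by rewrite andbT.
rewrite rmorph_prod /phi.
under [RHS]eq_bigr do rewrite rmorphM fmorphV.
have H1 : \prod_(i < d.+1) (if i == ord0 then bcoefR R (n i) else 1)%:C%C = (bcoefR R (n ord0))%:C%C.
  rewrite (bigD1 ord0)//= big1 ?mulr1// => j /negbTE ->; by rewrite rmorph1.
rewrite big_split /= H1 prodfV; congr (_ / _).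
  by rewrite /b_coef /bcoefR fmorph_div rmorphXn !rmorph_nat.
by apply: eq_bigr => j _; rewrite rmorphXn /den rmorph_int.
Qed.

Lemma apery_sum_in_summable_in d (d_gt0 : (0 < d)%N) s l w V :
  summable_in V (apery_seq R s l w) -> apery_sum_in d_gt0 s l w V.
Proof.
move=> [S hS VS]; exists S%:C%C => //.
apply/(@ccvg_shiftS R); apply: eq_ccvg (fun n => esym (apery_partialE d_gt0 s l w (ltn0Sn n))) _.
exact/(ccvg_shiftS (fun n => (rsum (apery_seq R s l w) n)%:C%C))/ccvg_real.
Qed.

End Regularization.

Theorem theorem4p4 (R : realType) (d : nat) (d_gt0 : (0 < d)%N)
    (s : 'I_d -> nat) (s_gt0 : forall j, (0 < s j)%N)
    (s1_ge2 : (2 <= s (Ordinal d_gt0))%N)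
    (l : 'I_d -> linform) :
  let l1 := l (Ordinal d_gt0) in
  let wt := (\sum_(j < d) s j)%N in
  let CMZV_b := scale_set ('i%C ^+ delta l1)
                  (add_set (CMZV4 R wt)
                     (scale_set (nu l1)%:R (CMZV4 R wt.+1))) in
  let CMZV_c := span_over (Qi R) (CMZV4_le R (wt + nu l1)) in
  [/\ (* (a) *)
      (forall j, l j = Even \/ l j = OddSucc) ->
        apery_sum_in d_gt0 s l (std_weak l)
          (scale_set ('i%C ^+ delta l1) (CMZV4 R wt)),
      (* (b) *)
      ((forall i j : 'I_d, j = i.+1 :> nat -> l j = OddPred -> l i <> Even) ->
        apery_sum_in d_gt0 s l (std_weak l) CMZV_b) /\
      ((forall j, l j <> Even) ->
        apery_sum_in d_gt0 s l (std_weak l) CMZV_b),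
      (* (c) *)
      apery_sum_in d_gt0 s l (std_weak l) CMZV_c &
      (* (d) *)
      forall w : 'I_d -> bool, apery_defined l w ->
        apery_sum_in d_gt0 s l w CMZV_c].
Proof.
case: d d_gt0 s s_gt0 s1_ge2 l => // d d_gt0 s s_gt0 s1_ge2 l l1 wt CMZVb CMZVc.
have e0 : Ordinal d_gt0 = ord0 by apply: val_inj.
have b : (forall i j : 'I_d.+1, j = i.+1 :> nat -> l j = OddPred -> l i <> Even) ->
    summable_in CMZVb (apery_seq R s l (std_weak l)).
  move=> hl.
  (* One of the s_1 >= 2 outermost denominators is set aside for [summable_in_class_b]; the reduced
     exponent is still positive. *)
  pose s' j := if j == ord0 then (s ord0).-1 else s j.
  have s1 : (2 <= s ord0)%N by rewrite -e0.
  have s'0 j : (0 < s' j)%N.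
    by rewrite /s'; case: eqP => _ //; rewrite -subn1 subn_gt0.
  have h := summable_in_class_b (apery_seq_class_b R s'0 hl).
  have wtE : wt = (\sum_(j < d.+1) s' j).+1%N.
    rewrite /wt !big_ord_recl /s' eqxx -addSn prednK; last exact: ltnW.
    by congr (_ + _)%N; apply: eq_bigr => j _.
  rewrite /CMZVb /l1 wtE e0; apply: eq_summable_in h => n.
  rewrite {1}/divden apery_seqS [RHS]apery_seqS.
  have -> : (fun j => s' (lift ord0 j)) = (fun j => s (lift ord0 j)) by [].
  have e1 : s ord0 = (s' ord0).+1 by rewrite /s' eqxx prednK// ltnW.
  by rewrite -[LHS]/(divden (l ord0) 1 (divden (l ord0) (s' ord0) _) n) divden_add e1 add1n.
(* Serves (c) and (d) alike, as the relations [w] are arbitrary here. *)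
have cd w : summable_in CMZVc (apery_seq R s l w).
  have := GV_divden (l ord0) (w ord0) (mixed_span_apery_seq R (fun j => l (lift ord0 j)) (fun j => w (lift ord0 j)) (fun j => s_gt0 (lift ord0 j))) (_ : 2 <= s ord0)%N.
  rewrite /CMZVc /wt /l1 e0 big_ord_recl -e0 => /(_ s1_ge2); rewrite e0.
  by apply: eq_summable_in => n; rewrite apery_seqS.
split.
(* Without 2m-1 the configuration excluded in (b) cannot occur, and [nu] = 0 removes the summand of
   higher weight. *)
- move=> hl; apply: apery_sum_in_summable_in.
  have /b : forall i j : 'I_d.+1, j = i.+1 :> nat -> l j = OddPred -> l i <> Even.
    by move=> i j _ lj; case: (hl j) => e; rewrite e in lj.
  apply: summable_in_sub => _ [_ [v Vv [_ [v' _ <-] <-]] <-]; exists v => //.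
  by rewrite /l1; case: (hl (Ordinal d_gt0)) => ->; rewrite mul0r addr0.
- split=> hl; apply: apery_sum_in_summable_in; first exact: b hl.
  by apply: b => i j _ _; exact: hl.
- exact/apery_sum_in_summable_in/cd.
- by move=> w _; exact/apery_sum_in_summable_in/cd.
Qed.
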